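(* Let $\Omega$ be convex. For every $m\in(2,\infty]$ there is a constant $C(m,T)$, not depending on $\varepsilon$, such that the following holds. Let $\varepsilon>0$, let $f_\varepsilon\in L^m(0,T;W^{1,m}(\Omega))$ and $u_0\in W^{1,m}(\Omega)$, and let $u_\varepsilon$ be a solution of $$\begin{cases}\partial_t u_\varepsilon-\alpha_\varepsilon(|Du_\varepsilon|^2)\,\mathcal{A}_{\varepsilon,u_\varepsilon}(D^2u_\varepsilon)=f_\varepsilon(x,t) & \text{in } Q_T,\\ \partial_\nu u_\varepsilon=0 & \text{on }\partial\Omega\times(0,T),\\ u_\varepsilon(x,0)=u_0(x) & \text{in }\Omega.\end{cases}$$ Then $$\operatorname*{ess\,sup}_{t\in[0,T]}\|Du_\varepsilon(t)\|_{L^m(\Omega)}\le C(m,T)\big(\|Df_\varepsilon\|_{L^m(Q_T)}+\|Du_0\|_{L^m(\Omega)}\big).$$ Moreover, $C(m,T)\to\overline{C}$ as $m\to\infty$ for some $\overline{C}>0$.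
   Context: $N\ge1$, $p>1$, $T>0$; $\Omega\subset\mathbb{R}^N$ is a bounded convex open set of class $C^1$, $\nu$ is its outward unit normal, $\partial_\nu$ the outward normal derivative, and $Q_T=\Omega\times(0,T)$. $D$ and $D^2$ denote the spatial gradient and Hessian. The function $\alpha:(0,\infty)\to(0,\infty)$ is of class $C^2$ and satisfies $$-1<i_\alpha:=\inf_{s>0}\frac{2s\alpha'(s)}{\alpha(s)}\le\sup_{s>0}\frac{2s\alpha'(s)}{\alpha(s)}=:s_\alpha<\infty,$$ and there exist $0<\underline{\alpha}\le\overline{\alpha}<\infty$ with $\underline{\alpha}\,s^{\frac{p-2}{2}}\le\alpha(s)\le\overline{\alpha}\,s^{\frac{p-2}{2}}$ for all $s>0$. For $\varepsilon>0$, $\alpha_\varepsilon(s):=\alpha(s+\varepsilon)$. For $v\in C^1$ and a symmetric $N\times N$ matrix $M$, $$\mathcal{A}_{\varepsilon,v}(M)=\mathrm{Tr}(M)+\frac{2\alpha_\varepsilon'(|Dv|^2)}{\alpha_\varepsilon(|Dv|^2)}\,M Dv\cdot Dv,$$ so that $\alpha_\varepsilon(|Du|^2)\mathcal{A}_{\varepsilon,u}(D^2u)=\mathrm{div}(\alpha_\varepsilon(|Du|^2)Du)$ for smooth $u$. The estimate is an a priori estimate: $f_\varepsilon$ is smooth, and solutions $u_\varepsilon$ are classical and smooth on $\overline{\Omega}\times[0,T]$. *)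

(* Defs.v *)
From HB Require Import structures.
From mathcomp Require Import all_boot all_order all_algebra.
From mathcomp Require Import all_classical all_reals all_analysis.

Set Implicit Arguments.
Unset Strict Implicit.
Unset Printing Implicit Defensive.

Import Order.TTheory GRing.Theory Num.Theory.
Import numFieldNormedType.Exports.

Local Open Scope classical_set_scope.
Local Open Scope ring_scope.

(* The Borel sigma-algebra of R^n, generated by the coordinates. *)
Section measurable_rV.
Context {R : realType} (n : nat).

Definition rV_coord (i : 'I_n) (x : 'rV[R]_n) : R := x ord0 i.

Let rV_set0 : g_sigma_preimage rV_coord set0.
Proof. exact: sigma_algebra0. Qed.

Let rV_setC A : g_sigma_preimage rV_coord A -> g_sigma_preimage rV_coord (~` A).
Proof. exact: sigma_algebraC. Qed.

Let rV_bigcup (F : (set 'rV[R]_n)^nat) :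
  (forall i, g_sigma_preimage rV_coord (F i)) ->
  g_sigma_preimage rV_coord (\bigcup_i (F i)).
Proof. exact: sigma_algebra_bigcup. Qed.

HB.instance Definition _ := @isMeasurable.Build default_measure_display
  'rV[R]_n (g_sigma_preimage rV_coord) rV_set0 rV_setC rV_bigcup.

Lemma measurable_rV_coord (i : 'I_n) : measurable_fun setT (rV_coord i).
Proof.
move=> _ Y mY; rewrite setTI; apply: sub_sigma_algebra => /=.
rewrite -bigcup_seq/=; exists i => /=; first by rewrite mem_index_enum.
by exists Y => //; rewrite setTI.
Qed.

Lemma measurable_fun_rV d (T : measurableType d) (f : T -> 'rV[R]_n) :
  (forall i, measurable_fun setT (rV_coord i \o f)) -> measurable_fun setT f.
Proof.
move=> mf.
suff : g_sigma_preimage (fun i => rV_coord i \o f) `<=` measurable.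
  by rewrite g_sigma_preimage_comp => h _ A mA; apply: h; exists A.
apply: smallest_sub; first exact: sigma_algebra_measurable.
rewrite -bigcup_seq/=; apply: bigcup_sub => i _.
by move=> A [B mB <-]; exact: mf.
Qed.

End measurable_rV.

Section lebesgue_rV.
Context {R : realType}.

Definition cons_rV n (p : R * 'rV[R]_n) : 'rV[R]_n.+1 := row_mx p.1%:M p.2.

Lemma cons_rVEl n (p : R * 'rV[R]_n) : cons_rV p ord0 ord0 = p.1.
Proof.
rewrite /cons_rV (_ : ord0 = lshift n (ord0 : 'I_1)); last exact/val_inj.
by apply: etrans (row_mxEl _ _ _ _) _; rewrite !mxE eqxx mulr1n.
Qed.

Lemma cons_rVEr n (p : R * 'rV[R]_n) (j : 'I_n) :
  cons_rV p ord0 (lift ord0 j) = p.2 ord0 j.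
Proof.
rewrite /cons_rV (_ : lift ord0 j = rshift 1 j); last exact/val_inj.
exact: row_mxEr.
Qed.

Lemma measurable_cons_rV n : measurable_fun setT (@cons_rV n).
Proof.
apply: measurable_fun_rV => i.
have [j ->|->] := unliftP ord0 i.
  rewrite (_ : _ \o _ = rV_coord j \o snd).
    by apply: measurableT_comp => //; exact: measurable_rV_coord.
  by apply/funext => p /=; rewrite /rV_coord cons_rVEr.
by rewrite (_ : _ \o _ = fst) //; apply/funext => p /=; exact: cons_rVEl.
Qed.

Definition uncons_rV n (x : 'rV[R]_n.+1) : R * 'rV[R]_n :=
  (x ord0 ord0, \row_j x ord0 (lift ord0 j)).

Lemma cons_rVK n : cancel (@cons_rV n) (@uncons_rV n).
Proof.
move=> p; rewrite /uncons_rV cons_rVEl [RHS]surjective_pairing; congr pair.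
by apply/rowP => j; rewrite mxE cons_rVEr.
Qed.

Lemma measurable_uncons_rV n : measurable_fun setT (@uncons_rV n).
Proof.
apply: measurable_fun_pair; first exact: (@measurable_rV_coord _ _ ord0).
apply: measurable_fun_rV => j.
rewrite (_ : _ \o _ = rV_coord (lift ord0 j)); first exact: measurable_rV_coord.
by apply/funext => x /=; rewrite /rV_coord mxE.
Qed.

Section step.
Context (n : nat) (mu : {sigma_finite_measure set 'rV[R]_n -> \bar R}).

Let nu := [the {measure set _ -> \bar R} of
  (lebesgue_measure \x mu)%E].

Definition lebesgue_rV_step : set 'rV[R]_n.+1 -> \bar R :=
  pushforward (lebesgue_measure \x mu)%E (@cons_rV n).

Let measurable_preimage_cons (A : set 'rV[R]_n.+1) :
  measurable A -> measurable (@cons_rV n @^-1` A).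
Proof.
by move=> mA; rewrite -[X in measurable X]setTI; exact: measurable_cons_rV.
Qed.

Let step0 : lebesgue_rV_step set0 = 0%E.
Proof. exact: (measure0 nu). Qed.

Let step_ge0 A : (0 <= lebesgue_rV_step A)%E.
Proof. exact: (measure_ge0 nu). Qed.

Let step_semi_sigma_additive : semi_sigma_additive lebesgue_rV_step.
Proof.
move=> F mF tF mUF; rewrite /lebesgue_rV_step /pushforward preimage_bigcup.
apply: (measure_semi_sigma_additive (s := nu)).
- by move=> k; exact: measurable_preimage_cons.
- apply/trivIsetP => /= i j _ _ ij; rewrite -preimage_setI.
  by move/trivIsetP : tF => /(_ _ _ _ _ ij) ->//; rewrite preimage_set0.
- by rewrite -preimage_bigcup; exact: measurable_preimage_cons.
Qed.

HB.instance Definition _ := isMeasure.Build _ _ _ lebesgue_rV_step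
  step0 step_ge0 step_semi_sigma_additive.

Let step_sigma_finite : sigma_finite setT lebesgue_rV_step.
Proof.
have /sigma_finiteP[F [TF ndF Foo]] :=
  sigma_finiteT [the {sigma_finite_measure set _ -> \bar R} of lebesgue_measure].
have /sigma_finiteP[G [TG ndG Goo]] := sigma_finiteT mu.
exists (fun k => @uncons_rV n @^-1` (F k `*` G k)).
  rewrite -preimage_bigcup (_ : \bigcup_k _ = setT) ?preimage_setT//.
  apply/seteqP; split => // -[x y] _.
  have [k _ Fkx] : (\bigcup_k F k) x by rewrite -TF.
  have [l _ Gly] : (\bigcup_k G k) y by rewrite -TG.
  exists (maxn k l) => //; split => /=.
  - by move: x Fkx; exact/subsetPset/ndF/leq_maxl.
  - by move: y Gly; exact/subsetPset/ndG/leq_maxr.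
move=> k; have [mF Fk] := Foo k; have [mG Gk] := Goo k; split.
  rewrite -[X in measurable X]setTI; apply: measurable_uncons_rV => //.
  exact: measurableX.
rewrite /lebesgue_rV_step /pushforward -comp_preimage.
rewrite (_ : _ \o _ = id); last by apply/funext => p; exact: cons_rVK.
rewrite preimage_id.
by rewrite product_measure1E// lte_mul_pinfty// ge0_fin_numE.
Qed.

HB.instance Definition _ := Measure_isSigmaFinite.Build _ _ _ lebesgue_rV_step
  step_sigma_finite.

End step.

(* The n-fold product of the Lebesgue measure of R, transported along
   R * R^n ~ R^(n+1). *)
Fixpoint lebesgue_rV n : {sigma_finite_measure set 'rV[R]_n -> \bar R} :=
  match n with
  | 0%N => dirac (0 : 'rV[R]_0)
  | n'.+1 => lebesgue_rV_step (lebesgue_rV n')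
  end.

End lebesgue_rV.

Section calculus.
Context {R : realType}.

(* In finite dimension this is C^k on the open set O: all iterated directional
   derivatives up to order k exist and are continuous. *)
Fixpoint Ck (V : normedModType R) (k : nat) (O : set V) (g : V -> R) : Prop :=
  match k with
  | 0%N => forall x, O x -> {for x, continuous g}
  | k'.+1 => (forall x, O x -> {for x, continuous g}) /\
      forall v : V, (forall x, O x -> derivable g x v) /\ Ck k' O ('D_v g)
  end.

(* For a set K that is not open: g is C^oo on some open neighbourhood of K,
   so that its derivatives at the points of K are the ordinary ones. *)
Definition smooth (V : normedModType R) (K : set V) (g : V -> R) : Prop :=
  exists O : set V, [/\ open O, K `<=` O & forall k, Ck k O g].

Context {N : nat}.
Implicit Types (x y : 'rV[R]_N) (v : 'rV[R]_N -> R) (M : 'M[R]_N).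

Definition dot x y : R := \sum_(i < N) x ord0 i * y ord0 i.
Definition enorm x : R := Num.sqrt (dot x x).

Definition partial (i : 'I_N) v : 'rV[R]_N -> R := 'D_(delta_mx ord0 i) v.
Definition grad v x : 'rV[R]_N := \row_i partial i v x.
Definition hessian v x : 'M[R]_N := \matrix_(i, j) partial i (partial j v) x.

(* Near x, Omega is {rho < 0} for a C^1 function rho without critical points;
   grad rho then points outwards on the boundary. *)
Definition local_C1_equation (Omega : set 'rV[R]_N) x (O : set 'rV[R]_N)
    (rho : 'rV[R]_N -> R) : Prop :=
  [/\ open O, O x, Ck 1 O rho, (forall y, O y -> grad rho y != 0) &
      Omega `&` O = [set y | O y /\ rho y < 0]].

Definition boundary (Omega : set 'rV[R]_N) : set 'rV[R]_N :=
  closure Omega `\` interior Omega.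

Definition C1_domain (Omega : set 'rV[R]_N) : Prop :=
  forall x, boundary Omega x -> exists O rho, local_C1_equation Omega x O rho.

Definition outward_unit_normal (Omega : set 'rV[R]_N) x (n : 'rV[R]_N) : Prop :=
  exists O rho, local_C1_equation Omega x O rho /\
    n = (enorm (grad rho x))^-1 *: grad rho x.

End calculus.

Section sobolev.
Context {R : realType}.

(* The L^m(D) norm: g is extended by 0 outside D. *)
Definition Lnorm_on d (X : measurableType d) (mu : {measure set X -> \bar R})
    (m : \bar R) (D : set X) (g : X -> R) : \bar R :=
  'N[mu]_m[(EFin \o g) \_ D].

Definition Lp_on d (X : measurableType d) (mu : {measure set X -> \bar R})
    (m : \bar R) (D : set X) (g : X -> R) : Prop :=
  measurable_fun D g /\ (Lnorm_on mu m D g < +oo)%E.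

Context {N : nat}.
Implicit Types (Omega : set 'rV[R]_N) (v w : 'rV[R]_N -> R).

Definition test_function Omega (phi : 'rV[R]_N -> R) : Prop :=
  [/\ smooth setT phi, compact (closure [set x | phi x != 0]) &
      closure [set x | phi x != 0] `<=` Omega].

Definition L1_loc Omega v : Prop :=
  measurable_fun Omega v /\
  forall K, compact K -> K `<=` Omega ->
    (lebesgue_rV N).-integrable K (EFin \o v).

Definition weak_gradient Omega v (g : 'rV[R]_N -> 'rV[R]_N) : Prop :=
  [/\ L1_loc Omega v, (forall i, L1_loc Omega (fun x => g x ord0 i)) &
      forall i phi, test_function Omega phi ->
        (\int[lebesgue_rV N]_(x in Omega) (v x * partial i phi x)%:E =
         - \int[lebesgue_rV N]_(x in Omega) (g x ord0 i * phi x)%:E)%E].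

Definition sobolev (m : \bar R) Omega v : Prop :=
  Lp_on (lebesgue_rV N) m Omega v /\
  exists2 g, weak_gradient Omega v g &
    Lp_on (lebesgue_rV N) m Omega (fun x => enorm (g x)).

(* The weak gradient is unique up to a null set, so the norm below does not
   depend on the representative that is chosen here. *)
Definition wgrad Omega v : 'rV[R]_N -> 'rV[R]_N :=
  xget (fun=> 0) [set g | weak_gradient Omega v g].

Definition sobolev_norm (m : \bar R) Omega v : \bar R :=
  (Lnorm_on (lebesgue_rV N) m Omega v +
   Lnorm_on (lebesgue_rV N) m Omega (fun x => enorm (wgrad Omega v x)))%E.

Definition simple_sobolev (m : \bar R) Omega (s : R -> 'rV[R]_N -> R) : Prop :=
  exists n (A : 'I_n -> set R) (w : 'I_n -> 'rV[R]_N -> R),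
    (forall i, measurable (A i) /\ sobolev m Omega (w i)) /\
    forall t x, s t x = \sum_(i < n) \1_(A i) t * w i x.

(* The Bochner space L^m(0,T;W^{1,m}(Omega)): strongly measurable functions
   with m-integrable norm. *)
Definition bochner_sobolev (m : \bar R) (T : R) Omega (f : R -> 'rV[R]_N -> R)
    : Prop :=
  [/\ {ae lebesgue_measure, forall t, 0 < t < T -> sobolev m Omega (f t)},
      exists s : nat -> R -> 'rV[R]_N -> R,
        (forall k, simple_sobolev m Omega (s k)) /\
        {ae lebesgue_measure, forall t, 0 < t < T ->
          (fun k => sobolev_norm m Omega (fun x => f t x - s k t x)) @ \oo
            --> 0%E} &
      ('N[lebesgue_measure]_m[(fun t => sobolev_norm m Omega (f t)) \_ [set` `]0%R, T[]]
        < +oo)%E].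

End sobolev.

Section equation.
Context {R : realType}.

Definition i_index (alpha : R -> R) : \bar R :=
  ereal_inf [set (2 * s * derive1 alpha s / alpha s)%:E | s in [set s : R | 0 < s]].

Definition s_index (alpha : R -> R) : \bar R :=
  ereal_sup [set (2 * s * derive1 alpha s / alpha s)%:E | s in [set s : R | 0 < s]].

Definition shift_coef (alpha : R -> R) (eps s : R) : R := alpha (s + eps).

Context {N : nat}.
Implicit Types (Omega : set 'rV[R]_N) (v : 'rV[R]_N -> R).

(* M Dv . Dv is written with row vectors; M is symmetric where this is used. *)
Definition opA (alpha : R -> R) (eps : R) v (x : 'rV[R]_N) (M : 'M[R]_N) : R :=
  let Dv := grad v x in
  let aeps := shift_coef alpha eps in
  \tr M + 2 * derive1 aeps (enorm Dv ^+ 2) / aeps (enorm Dv ^+ 2) *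
    dot (Dv *m M) Dv.

Definition cylinder (I : set R) Omega : set (R * 'rV[R]_N) :=
  [set z | I z.1 /\ Omega z.2].

Definition classical_solution (alpha : R -> R) (eps T : R) Omega
    (f : R -> 'rV[R]_N -> R) (u0 : 'rV[R]_N -> R) (u : R -> 'rV[R]_N -> R)
    : Prop :=
  [/\ smooth (cylinder [set` `[0, T]] (closure Omega)) (fun z => u z.1 z.2),
      (forall t x, 0 < t < T -> Omega x ->
        derive1 (u ^~ x) t -
          shift_coef alpha eps (enorm (grad (u t) x) ^+ 2) *
            opA alpha eps (u t) x (hessian (u t) x) = f t x),
      (forall t x n, 0 < t < T -> boundary Omega x ->
        outward_unit_normal Omega x n -> 'D_n (u t) x = 0) &
      (forall x, Omega x -> u 0 x = u0 x)].

End equation.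

(* Main.v *)
From HB Require Import structures.
Require Import Defs.
From mathcomp Require Import all_boot all_order all_algebra.
From mathcomp Require Import all_classical all_reals all_analysis.
From mathcomp Require Import ess_sup_inf measurable_realfun.
From mathcomp Require Import ring lra.

Set Implicit Arguments.
Unset Strict Implicit.
Unset Printing Implicit Defensive.

Import Order.TTheory GRing.Theory Num.Theory.
Import numFieldNormedType.Exports.

Local Open Scope classical_set_scope.
Local Open Scope ring_scope.


(** The constant is exp T, for all exponents. It comes from an estimate of the
    energy, the integral over Omega of |Du| ^ m.

    Let a(s) = alpha(s + eps), so that the equation reads
    u_t = div (a(|Du|^2) Du) + f. Differentiating (|Du|^2 + kappa) ^ (m / 2) in
    time gives phi Du . D(div (a Du)) + phi Du . Df, where
    phi = m (|Du|^2 + kappa) ^ (m / 2 - 1) is a nondecreasing function of |Du|^2;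
    kappa > 0 makes the power smooth and is removed at the end. By Young's
    inequality the second term is at most (m - 1) times the density plus
    |Df| ^ m. If the first one has a nonpositive integral (the dissipation,
    Rintegral_dissipation_le0), the argument of Gronwall gives the bound
    exp ((m - 1) T) for the energy at time t in terms of the initial energy and
    of the integral of |Df| ^ m (energy_le, energy_bound). Taking m-th roots
    gives the estimate with the constant exp T. Since this constant is uniform
    in m, and Omega is bounded, the case m = +oo follows from the finite
    exponents by Chebyshev's inequality (Lnorm_on_estimate).

    The dissipation is where convexity enters. Put b = Du and consider the field
    X_i = phi sum_k b_k d_k(a b_i). Its divergence is phi b . D(div (a b)) plus a
    quadratic expression in the Hessian; the latter is nonnegative because phi is
    nondecreasing and a + 2 s a' >= 0, which is what the lower bound of the index
    of alpha says (interior_term_ge0). So it suffices that the integral of div X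
    is nonpositive. On the boundary the Neumann condition makes b tangent,
    therefore X . nu is a nonnegative multiple of (D_b b) . nu, and this is
    nonpositive because a tangent field bends inwards at the boundary of a
    convex set (tangent_derive_le0). The boundary being only of class C^1, the
    latter is proved by comparing b at two boundary points, with the supporting
    hyperplane at the second one, instead of differentiating the normal.

    The divergence theorem enters as an inequality without surface integral: if a
    field does not point outwards, in the sense of supporting hyperplanes, then
    its total divergence is nonpositive (Rintegral_div_le0). Multiply the field
    by C^1 cutoffs that depend on the distances to finitely many supporting
    hyperplanes, use that the divergence of a compactly supported field has
    integral zero (Rintegral_derive_eq0, from the translation invariance of
    Lebesgue measure), and let the cutoffs tend to 1. In the same spirit the
    energy is never differentiated under the integral sign: the time derivative
    is integrated over the cylinder with Fubini's theorem (slab_le). *)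

(** * Directional derivatives *)

Section calculus.
Context {R : realType} {V : normedModType R}.
Implicit Types (g h : V -> R) (O : set V) (x y v w : V).

Lemma growth_line g x v (s : R) :
  (fun r : R => r^-1 *: (g (((r *: (1 : R)) + s) *: v + x) - g (s *: v + x))) =
  (fun r : R => r^-1 *: (g (r *: v + (s *: v + x)) - g (s *: v + x))).
Proof. by apply/funext => r; rewrite [_ *: 1]mulr1 scalerDl addrA. Qed.

Lemma derivable_line g x v (s : R) :
  derivable (fun r : R => g (r *: v + x)) s 1 = derivable g (s *: v + x) v.
Proof. by rewrite /derivable /= growth_line. Qed.

Lemma derive_line g x v (s : R) :
  'D_1 (fun r : R => g (r *: v + x)) s = 'D_v g (s *: v + x).
Proof. by rewrite /derive /= growth_line. Qed.

Lemma is_derive_line g x v (s : R) : derivable g (s *: v + x) v ->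
  is_derive s 1 (fun r : R => g (r *: v + x)) ('D_v g (s *: v + x)).
Proof.
move=> gd; rewrite -derive_line; apply: derivableP.
by rewrite derivable_line.
Qed.

Lemma is_derive_shift_add g x y v (l : R) :
  is_derive (y + x) v g l -> is_derive x v (fun z => g (y + z)) l.
Proof.
have E : (fun r : R => r^-1 *: (g (y + (r *: v + x)) - g (y + x))) =
         (fun r : R => r^-1 *: (g (r *: v + (y + x)) - g (y + x))).
  by apply/funext => r; rewrite addrCA.
by move=> [dg <-]; split; rewrite /derivable /derive/= E.
Qed.

Lemma MVT_line_ge0 g x v (h : R) : 0 <= h ->
  (forall s : R, 0 <= s <= h -> derivable g (s *: v + x) v) ->
  exists2 c : R, 0 <= c <= h &
    g (h *: v + x) - g x = h * 'D_v g (c *: v + x).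
Proof.
move=> h0 gd.
have [||c] := @MVT_segment R (fun r => g (r *: v + x))
  (fun s => 'D_v g (s *: v + x)) 0 h h0.
- move=> s; rewrite in_itv/= => /andP[s0 sh].
  by apply: is_derive_line; apply: gd; rewrite !ltW.
- apply: derivable_within_continuous => s; rewrite in_itv/= => sh.
  by rewrite derivable_line; exact: gd.
rewrite in_itv/= scale0r add0r subr0 => ch E.
by exists c => //; rewrite E mulrC.
Qed.

Lemma MVT_line g x v (h : R) :
  (forall s : R, `|s| <= `|h| -> derivable g (s *: v + x) v) ->
  exists2 c : R, `|c| <= `|h| &
    g (h *: v + x) - g x = h * 'D_v g (c *: v + x).
Proof.
move=> gd; have [h0|h0] := leP 0 h.
  have [s /andP[s0 sh]|c /andP[c0 ch] E] := MVT_line_ge0 h0 (g := g) (x := x) (v := v).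
    by apply: gd; rewrite !ger0_norm.
  by exists c => //; rewrite !ger0_norm.
have h0' : 0 <= - h by rewrite oppr_ge0 ltW.
have sE (s : R) : s *: v + (h *: v + x) = (s + h) *: v + x.
  by rewrite addrA -scalerDl.
have nh s : 0 <= s <= - h -> `|s + h| <= `|h|.
  by rewrite ler_norml (ltr0_norm h0); lra.
have [s sh|c ch] := MVT_line_ge0 h0' (g := g) (x := h *: v + x) (v := v).
  by rewrite sE; exact/gd/nh.
rewrite !sE addNr scale0r add0r => E.
by exists (c + h); [exact: nh | rewrite -[LHS]opprB E mulNr opprK].
Qed.

Lemma line_ball x v (d : R) : 0 < d ->
  exists2 e : R, 0 < e & forall y (s : R), `|y - x| < e -> `|s| < e ->
    `|s *: v + y - x| < d.
Proof.
move=> d0; have v1 : 0 < 1 + `|v| by rewrite ltr_pwDl.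
exists (d / (2 * (1 + `|v|))); first by rewrite divr_gt0// mulr_gt0.
move=> y s yx sd; rewrite -addrA (le_lt_trans (ler_normD _ _))//.
rewrite normrZ [ltRHS](splitr d).
have dd : d / (2 * (1 + `|v|)) <= d / 2.
  rewrite ler_pM2l// lef_pV2 ?posrE ?mulr_gt0//.
  by rewrite ler_peMr// ler_wpDr.
apply: ler_ltD; last exact: lt_le_trans dd.
have -> : d / 2 = d / (2 * (1 + `|v|)) * (1 + `|v|).
  by field; rewrite gt_eqF.
by apply: ler_pM => //; [exact: ltW | rewrite ler_wpDl].
Qed.

Lemma open_dist O x : open O -> O x ->
  exists2 d : R, 0 < d & forall y, `|y - x| < d -> O y.
Proof.
move=> oO Ox; have /nbhs_ballP[d /= d0 dO] : nbhs x O by exact: open_nbhs_nbhs.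
by exists d => // y yx; apply: dO; rewrite -ball_normE/= distrC.
Qed.

Lemma continuous_dist g x (e : R) : {for x, continuous g} -> 0 < e ->
  exists2 d : R, 0 < d & forall y, `|y - x| < d -> `|g y - g x| < e.
Proof.
move=> /cvgrPdist_lt/(_ e) /[apply] /nbhs_ballP[d /= d0 H].
exists d => // y yx; rewrite distrC; apply: H.
by rewrite -ball_normE/= distrC.
Qed.

Lemma dist_continuous g x :
  (forall e : R, 0 < e ->
     exists2 d : R, 0 < d & forall y, `|y - x| < d -> `|g y - g x| < e) ->
  {for x, continuous g}.
Proof.
move=> H; apply/cvgrPdist_lt => e /H[d d0 dH].
apply/nbhs_ballP; exists d => //= y; rewrite -ball_normE/= distrC => /dH.
by rewrite distrC.
Qed.

Lemma Ck_cont k O g : Ck k O g -> forall x, O x -> {for x, continuous g}.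
Proof. by case: k => [//|k] []. Qed.

Lemma Ck_derivable k O g : Ck k.+1 O g -> forall v x, O x -> derivable g x v.
Proof. by case=> _ H v; case: (H v). Qed.

Lemma Ck_D k O g v : Ck k.+1 O g -> Ck k O ('D_v g).
Proof. by case=> _ /(_ v)[]. Qed.

Lemma Ck_S k O g : Ck k.+1 O g -> Ck k O g.
Proof.
elim: k O g => [|k IH] O g; first by case.
by case=> cg H; split => // v; have [dg Cg] := H v; split => //; exact: IH.
Qed.

Lemma Ck_le k l O g : (k <= l)%N -> Ck l O g -> Ck k O g.
Proof.
move=> /subnK <-; elim: (l - k)%N => [//|n IH]; rewrite addSn => /Ck_S.
exact: IH.
Qed.

Lemma Ck_sub k O O' g : O' `<=` O -> Ck k O g -> Ck k O' g.
Proof.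
move=> sO; elim: k g => [|k IH] g; first by move=> H x /sO/H.
move=> [cg H]; split; first by move=> x /sO/cg.
by move=> v; have [dg Cg] := H v; split => [x /sO/dg//|]; exact: IH.
Qed.

(** Only directional derivatives are at hand, so differentiability is replaced by
    an expansion whose remainder is uniform in the base point; the mean value
    theorem on lines and the continuity of the derivative give it. *)
Lemma C1_expansion O g x v : open O -> Ck 1 O g -> O x ->
  forall e : R, 0 < e -> exists2 d : R, 0 < d &
    forall y (s : R), `|y - x| < d -> `|s| < d ->
      `|g (s *: v + y) - g y - s * 'D_v g x| <= e * `|s|.
Proof.
move=> oO Cg Ox e e0.
have [d1 d10 d1O] := open_dist oO Ox.
have [d2 d20 d2D] := continuous_dist (Ck_cont (Ck_D v Cg) Ox) e0.
have d12 : 0 < Num.min d1 d2 by rewrite lt_min d10.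
have [d d0 dH] := line_ball x v d12.
exists d => // y s yx sd.
have [r rs|c cs ->] := @MVT_line g y v s.
  apply: (Ck_derivable Cg); apply: d1O.
  by have := dH y r yx (le_lt_trans rs sd); rewrite lt_min => /andP[].
rewrite -mulrBr normrM mulrC ler_wpM2r//.
apply/ltW/d2D.
by have := dH y c yx (le_lt_trans cs sd); rewrite lt_min => /andP[].
Qed.

Lemma is_derive_expansion g x v (l : R) :
  (forall e : R, 0 < e -> exists2 d : R, 0 < d &
    forall s : R, `|s| < d -> `|g (s *: v + x) - g x - s * l| <= e * `|s|) ->
  is_derive x v g l.
Proof.
move=> H.
have cv : (fun h : R => h^-1 *: ((g \o shift x) (h *: v) - g x)) @ 0^' --> l.
  apply/cvgrPdist_le => e e0; have [d d0 dH] := H e e0.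
  apply/nbhs_ballP; exists d => // s; rewrite -ball_normE/= sub0r normrN => sd s0.
  rewrite -normrN opprB -(@ler_pM2r _ `|s|) ?normr_gt0// -normrM.
  rewrite (le_trans _ (dH s sd))// mulrBl [_^-1 *: _]mulrC mulfVK//.
  by rewrite [l * s]mulrC.
split; first by apply/cvg_ex; exists l.
exact/cvg_lim.
Qed.

(** Additivity of the derivative in the direction: walk along w first, then along
    v, from a base point that has moved; hence the uniformity above. *)
Lemma is_deriveD_dir O g x v w : open O -> Ck 1 O g -> O x ->
  is_derive x (v + w) g ('D_v g x + 'D_w g x).
Proof.
move=> oO Cg Ox; apply: is_derive_expansion => e e0.
have e20 : 0 < e / 2 by rewrite divr_gt0.
have [d1 d10 d1H] := C1_expansion v oO Cg Ox e20.
have [d2 d20 d2H] := C1_expansion w oO Cg Ox e20.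
have [d3 d30 d3H] := line_ball x w d10.
exists (Num.min d1 (Num.min d2 d3)); first by rewrite !lt_min d10 d20.
move=> s; rewrite !lt_min => /and3P[s1 s2 s3].
have xx d : 0 < d -> `|x - x| < d by rewrite subrr normr0.
have E1 := d1H (s *: w + x) s (d3H x s (xx _ d30) s3) s1.
have E2 := d2H x s (xx _ d20) s2.
rewrite scalerDr -[s *: v + s *: w + x]addrA [e]splitr mulrDl (le_trans _ (lerD E1 E2))//.
by rewrite (le_trans _ (ler_normD _ _))// le_eqVlt; apply/orP; left; apply/eqP; congr (`|_|); ring.
Qed.

Lemma deriveD_dir O g x v w : open O -> Ck 1 O g -> O x ->
  'D_(v + w) g x = 'D_v g x + 'D_w g x.
Proof. by move=> oO Cg Ox; have [] := is_deriveD_dir v w oO Cg Ox. Qed.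

Lemma deriveZ_dir O g x v (k : R) : open O -> Ck 1 O g -> O x ->
  'D_(k *: v) g x = k * 'D_v g x.
Proof.
move=> oO Cg Ox; suff [] : is_derive x (k *: v) g (k * 'D_v g x) by [].
apply: is_derive_expansion => e e0.
have k1 : 0 < 1 + `|k| by rewrite ltr_pwDl.
have e10 : 0 < e / (1 + `|k|) by rewrite divr_gt0.
have [d1 d10 d1H] := C1_expansion v oO Cg Ox e10.
exists (d1 / (1 + `|k|)); first by rewrite divr_gt0.
move=> s sd; rewrite scalerA mulrA (le_trans (d1H x (s * k) _ _))//.
- by rewrite subrr normr0.
- rewrite normrM (@le_lt_trans _ _ (`|s| * (1 + `|k|)))//.
    by rewrite ler_wpM2l// ler_wpDl.
  by rewrite -ltr_pdivlMr.
- rewrite normrM mulrA mulrAC ler_wpM2r// mulrAC ler_pdivrMr//.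
  by apply: ler_wpM2l; [exact: ltW | rewrite ler_wpDl].
Qed.

(** Schwarz: the mixed second difference on a small parallelogram is an
    intermediate value of either mixed derivative. *)
Lemma derive_comm O g x v w : open O -> Ck 2 O g -> O x ->
  'D_v ('D_w g) x = 'D_w ('D_v g) x.
Proof.
move=> oO Cg Ox.
have main (a b : V) (e : R) : 0 < e -> exists2 d : R, 0 < d &
    forall h : R, 0 < h < d ->
    `|(g (h *: a + (h *: b + x)) - g (h *: b + x) - (g (h *: a + x) - g x))
      - h ^+ 2 * 'D_b ('D_a g) x| <= e * h ^+ 2.
  move=> e0.
  have [d1 d10 d1O] := open_dist oO Ox.
  have [d2 d20 d2H] := C1_expansion b oO (Ck_D a Cg) Ox e0.
  have [d3 d30 d3H] := line_ball x b d10.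
  have d23 : 0 < Num.min d2 d3 by rewrite lt_min d20.
  have [d4 d40 d4H] := line_ball x a d23.
  have xx d : 0 < d -> `|x - x| < d by rewrite subrr normr0.
  exists (Num.min d2 (Num.min d3 d4)); first by rewrite !lt_min d20 d30.
  move=> h; rewrite !lt_min => /and4P[h0 h2 h3 h4].
  pose G y := g (h *: b + y) - g y.
  have hn : `|h| = h by rewrite gtr0_norm.
  have inO (s : R) : `|s| <= `|h| -> O (s *: a + x) /\ O (h *: b + (s *: a + x)).
    move=> sh; have := d4H x s (xx _ d40); rewrite (le_lt_trans sh) ?hn//.
    rewrite lt_min => /(_ isT)/andP[s2 s3]; split.
      by apply: d1O; have := d3H _ 0 s3; rewrite scale0r add0r normr0 => /(_ d30).
    by apply: d1O; apply: d3H => //; rewrite hn.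
  have dG s : `|s| <= `|h| -> is_derive (s *: a + x) a G
      ('D_a g (h *: b + (s *: a + x)) - 'D_a g (s *: a + x)).
    move=> /inO[sO1 sO2]; apply: is_deriveB; last first.
      by apply: DeriveDef => //; exact: (Ck_derivable Cg).
    by apply: is_derive_shift_add; apply: DeriveDef => //; exact: (Ck_derivable Cg).
  have [s sh|c ch] := @MVT_line G x a h.
    by case: (dG s sh).
  have [_ ->] := dG c ch.
  rewrite /G [h *: b + (h *: a + x)]addrCA => E.
  have -> : g (h *: a + (h *: b + x)) - g (h *: b + x) - (g (h *: a + x) - g x) =
    g (h *: a + (h *: b + x)) - g (h *: a + x) - (g (h *: b + x) - g x) by ring.
  rewrite {}E.
  have := d2H (c *: a + x) h; have := d4H x c (xx _ d40).
  rewrite (le_lt_trans ch) ?hn// => /(_ isT); rewrite lt_min => /andP[c2 c3].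
  move=> /(_ c2 h2) E2.
  rewrite expr2 -mulrA -mulrBr normrM hn mulrCA ler_pM2l//.
apply/eqP; rewrite -subr_eq0 -normr_le0; apply/ler_addgt0Pl => e e0; rewrite addr0.
have e20 : 0 < e / 2 by rewrite divr_gt0.
have [d1 d10 d1H] := main v w _ e20.
have [d2 d20 d2H] := main w v _ e20.
pose h := Num.min d1 d2 / 2.
have d12 : 0 < Num.min d1 d2 by rewrite lt_min d10.
have h0 : 0 < h by rewrite divr_gt0.
have hd : h < Num.min d1 d2 by rewrite ltr_pdivrMr// ltr_pMr// ltr1n.
move: hd; rewrite lt_min => /andP[hd1 hd2].
have := d1H h; rewrite h0 hd1 => /(_ isT) E1.
have := d2H h; rewrite h0 hd2 => /(_ isT) E2.
have h20 : 0 < h ^+ 2 by rewrite exprn_gt0.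
rewrite -(ler_pM2r h20) -{1}(gtr0_norm h20) -normrM.
rewrite [e]splitr [leRHS]mulrDl (le_trans _ (lerD E1 E2))//.
rewrite -[X in _ <= _ + X]normrN (le_trans _ (ler_normD _ _))//.
rewrite le_eqVlt; apply/orP; left; apply/eqP; congr (`|_|).
rewrite [h *: w + (h *: v + x)]addrCA.
move: (g _) (g (h *: w + x)) (g (h *: v + x)) (g x) => a b c d'.
move: ('D_v _ x) ('D_w _ x) => p q; ring.
Qed.

End calculus.

(** * Rules for functions of class C^k *)

Section calculus_rules.
Context {R : realType} {V : normedModType R}.
Implicit Types (f g : V -> R) (O : set V) (x y v w : V).

Lemma eq_open_near O f g x : open O -> O x -> (forall y, O y -> f y = g y) ->
  \near x, f x = g x.
Proof.
by move=> oO Ox fg; apply: filterS (open_nbhs_nbhs (conj oO Ox)) => y /fg.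
Qed.

Lemma eq_open_derive O f g v x : open O -> O x -> (forall y, O y -> f y = g y) ->
  'D_v f x = 'D_v g x.
Proof. by move=> oO Ox fg; apply: near_eq_derive; exact: eq_open_near fg. Qed.

Lemma Ck_congr k O f g : open O -> (forall y, O y -> f y = g y) ->
  Ck k O f -> Ck k O g.
Proof.
move=> oO; elim: k f g => [|k IH] f g fg.
  move=> cf x Ox; rewrite /prop_for /continuous_at -(fg x Ox); apply: cvg_trans (cf x Ox).
  exact/near_eq_cvg/(eq_open_near oO Ox).
move=> [cf H]; split.
  move=> x Ox; rewrite /prop_for /continuous_at -(fg x Ox); apply: cvg_trans (cf x Ox).
  exact/near_eq_cvg/(eq_open_near oO Ox).
move=> v; have [df Cf] := H v; split.
  move=> x Ox; apply: near_eq_derivable (df x Ox).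
  exact: (eq_open_near oO Ox).
apply: IH Cf => y Oy; exact: eq_open_derive fg.
Qed.

Lemma Ck_cst k O (c : R) : Ck k O (cst c).
Proof.
elim: k c => [|k IH] c; first by move=> x _; exact: cst_continuous.
split; first by move=> x _; exact: cst_continuous.
move=> v; split; first by move=> x _; exact: derivable_cst.
rewrite (_ : 'D_v (cst c) = cst 0); first exact: IH.
by apply/funext => x; rewrite derive_cst.
Qed.

Lemma CkD k O f g : open O -> Ck k O f -> Ck k O g -> Ck k O (f \+ g).
Proof.
move=> oO; elim: k f g => [|k IH] f g.
  by move=> cf cg x Ox; apply: continuousD; [exact: cf|exact: cg].
move=> [cf Hf] [cg Hg]; split.
  by move=> x Ox; apply: continuousD; [exact: cf|exact: cg].
move=> v; have [df Cf] := Hf v; have [dg Cg] := Hg v; split.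
  by move=> x Ox; apply: derivableD; [exact: df|exact: dg].
apply: Ck_congr (IH _ _ Cf Cg) => // y Oy.
by rewrite [RHS]deriveD//; [exact: df|exact: dg].
Qed.

Lemma CkM k O f g : open O -> Ck k O f -> Ck k O g -> Ck k O (f \* g).
Proof.
move=> oO; elim: k f g => [|k IH] f g.
  by move=> cf cg x Ox; apply: continuousM; [exact: cf|exact: cg].
move=> Cf0 Cg0; have [cf Hf] := Cf0; have [cg Hg] := Cg0; split.
  by move=> x Ox; apply: continuousM; [exact: cf|exact: cg].
move=> v; have [df Cf] := Hf v; have [dg Cg] := Hg v; split.
  by move=> x Ox; apply: derivableM; [exact: df|exact: dg].
have := CkD oO (IH _ _ (Ck_S Cf0) Cg) (IH _ _ (Ck_S Cg0) Cf).
apply: Ck_congr => // y Oy.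
by rewrite [RHS]deriveM//; [exact: df|exact: dg].
Qed.

Lemma CkN k O f : open O -> Ck k O f -> Ck k O (fun x => - f x).
Proof.
move=> oO Cf; apply: Ck_congr (CkM oO (Ck_cst k O (-1)) Cf) => // y _ /=.
by rewrite mulN1r.
Qed.

Lemma CkB k O f g : open O -> Ck k O f -> Ck k O g ->
  Ck k O (fun x => f x - g x).
Proof. by move=> oO Cf Cg; have := CkD oO Cf (CkN oO Cg). Qed.

Lemma Ck_sum k O (I : Type) (r : seq I) (F : I -> V -> R) : open O ->
  (forall i, Ck k O (F i)) -> Ck k O (fun x => \sum_(i <- r) F i x).
Proof.
move=> oO CF; elim: r => [|i r IH].
  apply: Ck_congr (Ck_cst k O 0) => // y _; by rewrite big_nil.
by apply: Ck_congr (CkD oO (CF i) IH) => // y _; rewrite big_cons.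
Qed.

Lemma Ck_prod k O (I : Type) (r : seq I) (F : I -> V -> R) : open O ->
  (forall i, Ck k O (F i)) -> Ck k O (fun x => \prod_(i <- r) F i x).
Proof.
move=> oO CF; elim: r => [|i r IH].
  apply: Ck_congr (Ck_cst k O 1) => // y _; by rewrite big_nil.
by apply: Ck_congr (CkM oO (CF i) IH) => // y _; rewrite big_cons.
Qed.

Lemma is_derive_sum (I : Type) (r : seq I) (F : I -> V -> R) (dF : I -> R) x v :
  (forall i, is_derive x v (F i) (dF i)) ->
  is_derive x v (fun y => \sum_(i <- r) F i y) (\sum_(i <- r) dF i).
Proof.
move=> H; elim: r => [|i r IH].
  rewrite big_nil (_ : (fun y => _) = cst 0); first exact: is_derive_cst.
  by apply/funext => y; rewrite big_nil.
rewrite big_cons (_ : (fun y => _) = F i \+ (fun y => \sum_(j <- r) F j y)).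
  exact: is_deriveD.
by apply/funext => y; rewrite big_cons.
Qed.

Lemma is_derive_of_line f x v (df : R) :
  is_derive (0 : R) 1 (fun r : R => f (r *: v + x)) df -> is_derive x v f df.
Proof.
move=> [fd <-]; split; first by rewrite derivable_line scale0r add0r in fd.
by rewrite derive_line scale0r add0r.
Qed.

(** Along a line this is the chain rule in one variable. *)
Lemma is_derive_scomp (h : R -> R) f x v (dh df : R) :
  is_derive x v f df -> is_derive (f x) 1 h dh ->
  is_derive x v (h \o f) (dh * df).
Proof.
move=> [fd <-] hd; apply: is_derive_of_line.
have ld : is_derive (0 : R) 1 (fun r : R => f (r *: v + x)) ('D_v f x).
  by rewrite -{2}[x]add0r -(scale0r v); apply: is_derive_line; rewrite scale0r add0r.
have hd' : is_derive (f (0 *: v + x)) 1 h dh by rewrite scale0r add0r.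
exact: (@is_derive1_comp R h (fun r : R => f (r *: v + x)) 0 dh ('D_v f x) hd' ld).
Qed.

Lemma Ck1_is_derive k O f x v : Ck k.+1 O f -> O x -> is_derive x v f ('D_v f x).
Proof. by move=> Cf Ox; apply: DeriveDef => //; exact: (Ck_derivable Cf). Qed.

End calculus_rules.

Lemma Ck_derive1 {R : realType} k (A : set R) (h : R -> R) :
  Ck k.+1 A h -> Ck k A (derive1 h).
Proof.
by move=> /(Ck_D (1 : R)); rewrite (_ : 'D_(1 : R) h = (derive1 h))//; apply/funext => x; rewrite derive1E.
Qed.

Lemma Ck_comp {R : realType} {V : normedModType R} k (A : set R) (h : R -> R)
    (O : set V) (f : V -> R) : open O -> (forall x, O x -> A (f x)) ->
  Ck k A h -> Ck k O f -> Ck k O (h \o f).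
Proof.
move=> oO fA; elim: k h => [|k IH] h.
  by move=> ch cf x Ox; apply: continuous_comp; [exact: cf|exact/ch/fA].
move=> Ch Cf; split.
  move=> x Ox; apply: continuous_comp; first exact: (Ck_cont Cf).
  exact/(Ck_cont Ch)/fA.
move=> v.
have d x : O x -> is_derive x v (h \o f) (derive1 h (f x) * 'D_v f x).
  move=> Ox; apply: is_derive_scomp; first exact: Ck1_is_derive Cf Ox.
  by rewrite derive1E; exact: (Ck1_is_derive (1 : R) Ch (fA _ Ox)).
split; first by move=> x /d[].
apply: Ck_congr (CkM oO (IH _ (Ck_derive1 Ch) (Ck_S Cf)) (Ck_D v Cf)) => // x Ox.
by have [_ ->] := d x Ox.
Qed.

Section coordinates.
Context {R : realType} {N : nat}.
Implicit Types (x y v w : 'rV[R]_N) (O : set 'rV[R]_N).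

Lemma is_derive_coord (i : 'I_N) x v :
  is_derive x v (fun y : 'rV[R]_N => y ord0 i) (v ord0 i).
Proof.
apply: is_derive_expansion => e e0; exists 1 => // s _.
by rewrite !mxE addrK subrr normr0 mulr_ge0// ltW.
Qed.

Lemma Ck_coord k O (i : 'I_N) : open O -> Ck k O (fun y : 'rV[R]_N => y ord0 i).
Proof.
move=> oO; case: k => [|k]; first by move=> x _; exact: coord_continuous.
split; first by move=> x _; exact: coord_continuous.
move=> v; split; first by move=> x _; case: (is_derive_coord i x v).
apply: Ck_congr (Ck_cst k O (v ord0 i)) => // y _.
by case: (is_derive_coord i y v).
Qed.

Lemma Ck_dot k O (a : 'rV[R]_N) : open O -> Ck k O (dot a).
Proof.
move=> oO; apply: Ck_sum => // i; apply: CkM => //; last exact: Ck_coord.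
exact: Ck_cst.
Qed.

Lemma dotC x y : dot x y = dot y x.
Proof. by apply: eq_bigr => i _; rewrite mulrC. Qed.

Lemma dotDl x y w : dot (x + y) w = dot x w + dot y w.
Proof. by rewrite -big_split; apply: eq_bigr => i _ /=; rewrite mxE mulrDl. Qed.

Lemma dotDr x y w : dot w (x + y) = dot w x + dot w y.
Proof. by rewrite dotC dotDl ![dot _ w]dotC. Qed.

Lemma dotZl (k : R) x y : dot (k *: x) y = k * dot x y.
Proof. by rewrite mulr_sumr; apply: eq_bigr => i _ /=; rewrite mxE mulrA. Qed.

Lemma dotZr (k : R) x y : dot x (k *: y) = k * dot x y.
Proof. by rewrite dotC dotZl dotC. Qed.

Lemma dotNl x y : dot (- x) y = - dot x y.
Proof. by rewrite -scaleN1r dotZl mulN1r. Qed.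

Lemma dotNr x y : dot x (- y) = - dot x y.
Proof. by rewrite dotC dotNl dotC. Qed.

Lemma dotBl x y w : dot (x - y) w = dot x w - dot y w.
Proof. by rewrite dotDl dotNl. Qed.

Lemma dotBr x y w : dot w (x - y) = dot w x - dot w y.
Proof. by rewrite dotDr dotNr. Qed.

Lemma dot_ge0 x : 0 <= dot x x.
Proof. by apply: sumr_ge0 => i _; rewrite -expr2 sqr_ge0. Qed.

Lemma dot_eq0 x : (dot x x == 0) = (x == 0).
Proof.
apply/eqP/eqP => [/eqP|->]; last by apply: big1 => i _; rewrite mxE mul0r.
rewrite psumr_eq0 => [/allP H|i _]; last by rewrite -expr2 sqr_ge0.
apply/rowP => i; have := H i (mem_index_enum i); rewrite mulf_eq0 orbb mxE.
by move=> /eqP.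
Qed.

Lemma dot_gt0 x : x != 0 -> 0 < dot x x.
Proof. by move=> x0; rewrite lt_def dot_ge0 dot_eq0 x0. Qed.

Lemma enorm_ge0 x : 0 <= enorm x.
Proof. exact: sqrtr_ge0. Qed.

Lemma enorm_sqr x : enorm x ^+ 2 = dot x x.
Proof. by rewrite sqr_sqrtr// dot_ge0. Qed.

(** Expand the square of dot y y *: x - dot x y *: y, the defect between x and its
    projection on y up to a factor. *)
Lemma dot_CS x y : dot x y ^+ 2 <= dot x x * dot y y.
Proof.
have [->|y0] := eqVneq y 0.
  have z w : dot w 0 = 0 by apply: big1 => i _; rewrite mxE mulr0.
  by rewrite !z mulr0 expr0n.
have := dot_ge0 (dot y y *: x - dot x y *: y).
rewrite !(dotBl, dotBr, dotZl, dotZr) [dot y x]dotC => H.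
rewrite -(ler_pM2l (dot_gt0 y0)) -subr_ge0; apply: le_trans H _.
by rewrite le_eqVlt; apply/orP; left; apply/eqP; ring.
Qed.

(** Additivity and homogeneity in the direction reduce v to the basis vectors. *)
Lemma derive_grad O (f : 'rV[R]_N -> R) x v : open O -> Ck 1 O f -> O x ->
  'D_v f x = dot v (grad f x).
Proof.
move=> oO Cf Ox.
have S (I : Type) (r : seq I) (F : I -> 'rV[R]_N) :
    'D_(\sum_(i <- r) F i) f x = \sum_(i <- r) 'D_(F i) f x.
  elim: r => [|i r IH]; first by rewrite !big_nil derive0.
  by rewrite !big_cons (deriveD_dir _ _ oO Cf Ox) IH.
rewrite {1}[v]row_sum_delta S; apply: eq_bigr => i _.
by rewrite (deriveZ_dir _ _ oO Cf Ox) mxE.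
Qed.

End coordinates.

(** * Borel sets and Lebesgue measure of R^n *)

Section borel_rV.
Context {R : realType}.

Lemma mx_norm_lt n (x : 'rV[R]_n) (r : R) : 0 < r ->
  (`|x| < r) = [forall i, `|x ord0 i| < r].
Proof.
move=> r0; rewrite {1}/Num.norm/= mx_normrE; apply/bigmax_ltP/forallP => /=.
  by move=> [_ H] i; exact: (H (ord0, i)).
by move=> H; split=> // -[i j] _ /=; rewrite (ord1 i); exact: H.
Qed.

Lemma mx_coord_le n (x : 'rV[R]_n) i : `|x ord0 i| <= `|x|.
Proof.
by rewrite [leRHS]/Num.norm/= mx_normrE; apply/bigmax_geP; right => /=; exists (ord0, i).
Qed.

Lemma measurable_ball_rV n (x : 'rV[R]_n) (r : R) :
  measurable [set y : 'rV[R]_n | `|y - x| < r].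
Proof.
have [r0|r0] := leP r 0.
  rewrite (_ : [set _ | _] = set0)//; apply/seteqP; split => // y /=.
  by rewrite ltNge (le_trans r0).
rewrite (_ : [set _ | _] =
    \bigcap_(i in [set: 'I_n]) (rV_coord i @^-1` [set z | `|z - x ord0 i| < r])).
  apply: fin_bigcap_measurable; first exact: finite_finset.
  move=> i _; rewrite -[X in measurable X]setTI; apply: measurable_rV_coord => //.
  apply: open_measurable.
  rewrite (_ : [set _ | _] = ball (x ord0 i) r); first exact: ball_open.
  by rewrite -ball_normE; apply/seteqP; split => z /=; rewrite distrC.
apply/seteqP; split => y /=; rewrite mx_norm_lt//.
  by move=> /forallP H i _ /=; have := H i; rewrite !mxE.
by move=> H; apply/forallP => i; have := H i I; rewrite /= /rV_coord !mxE.
Qed.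

Lemma rat_approx n (x : 'rV[R]_n) (r : R) : 0 < r ->
  exists q : 'rV[rat]_n, `|x - map_mx ratr q| < r.
Proof.
move=> r0.
have H (i : 'I_n) : exists q : rat, `|x ord0 i - ratr q| < r.
  have [q /andP[xq qx]] : exists q : rat, x ord0 i - r < ratr q < x ord0 i + r.
    have [|q] := @rat_in_itvoo R (x ord0 i - r) (x ord0 i + r).
      by rewrite ltrBlDr -addrA ltrDl addr_gt0.
    by rewrite in_itv/= => qq; exists q.
  by exists q; rewrite ltr_distl; apply/andP; split; lra.
have [q Hq] := choice H.
exists (\row_i q i); rewrite mx_norm_lt//; apply/forallP => i.
by rewrite !mxE.
Qed.

(** Open sets are countable unions of products of intervals and boxes with
    rational centres. *)
Lemma open_measurable_prod n (U : set (R * 'rV[R]_n)) :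
  open U -> measurable (U : set (measurableTypeR R * 'rV[R]_n)).
Proof.
move=> oU.
pose B (k : rat * 'rV[rat]_n * nat) : set (R * 'rV[R]_n) :=
  [set y : R | `|y - ratr k.1.1| < k.2.+1%:R^-1] `*`
  [set y : 'rV[R]_n | `|y - map_mx ratr k.1.2| < k.2.+1%:R^-1].
have mB k : measurable (B k : set (measurableTypeR R * 'rV[R]_n)).
  apply: measurableX; last exact: measurable_ball_rV.
  apply: open_measurable.
  rewrite (_ : [set _ | _] = ball (ratr k.1.1 : R) k.2.+1%:R^-1); first exact: ball_open.
  by rewrite -ball_normE; apply/seteqP; split => z /=; rewrite distrC.
rewrite (_ : U = \bigcup_k (if `[< B k `<=` U >] then B k else set0)).
  apply: countable_bigcupT_measurable => [|k]; first exact: countableP.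
  by case: ifP.
apply/seteqP; split => [[t x] Utx|z [k _]]; last by case: asboolP => // kU /kU.
have [d d0 dU] := open_dist oU Utx.
have [m md] : exists m : nat, m.+1%:R^-1 < d / 2.
  have [m _ mH] := near_infty_natSinv_lt (PosNum (divr_gt0 d0 (ltr0n R 2))).
  by exists m; exact: (mH m (leqnn m)).
have m0 : 0 < m.+1%:R^-1 :> R by rewrite invr_gt0.
have [q] := rat_approx x m0.
have [q0] := rat_approx (\row_(i < 1) t) m0.
rewrite mx_norm_lt// => /forallP/(_ ord0); rewrite !mxE => tq xq.
exists (q0 ord0 ord0, q, m) => //=.
rewrite asboolT; first by split.
move=> [s y] [/= sq yq]; apply: dU.
rewrite prod_normE/= gt_max; apply/andP; split.
  rewrite -(subrKA (ratr (q0 ord0 ord0))) (le_lt_trans (ler_normD _ _))//.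
  by rewrite [`|_ - t|]distrC [ltRHS]splitr ltrD//; [exact: lt_trans sq md|exact: lt_trans tq md].
rewrite -(subrKA (map_mx ratr q)) (le_lt_trans (ler_normD _ _))//.
by rewrite [`|_ - x|]distrC [ltRHS]splitr ltrD//; [exact: lt_trans yq md|exact: lt_trans xq md].
Qed.
End borel_rV.

Section lebesgue_rV_facts.
Context {R : realType}.
Local Notation leb n := (@lebesgue_rV R n).

(** A section of a measurable subset of the product. *)
Lemma open_measurable_rV n (U : set 'rV[R]_n) : open U -> measurable U.
Proof.
move=> oU.
have oTU : open (snd @^-1` U : set (R * 'rV[R]_n)).
  by apply: open_comp => // x _; exact: cvg_snd.
have := measurable_xsection (0 : R) (open_measurable_prod oTU).
rewrite (_ : xsection _ _ = U)//.
by apply/seteqP; split => x; rewrite /xsection/= inE.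
Qed.

Lemma closed_measurable_rV n (K : set 'rV[R]_n) : closed K -> measurable K.
Proof. by move=> /closed_openC/open_measurable_rV/measurableC; rewrite setCK. Qed.

Lemma lebesgue_rVS n (A : set 'rV[R]_n.+1) :
  leb n.+1 A = (lebesgue_measure \x leb n)%E (@cons_rV R n @^-1` A).
Proof. by []. Qed.

Definition box_rV n (r : R) : set 'rV[R]_n := [set x | forall i, (`|x ord0 i| <= r)%R].

Arguments box_rV n r : clear implicits.

Lemma measurable_box_rV n (r : R) : measurable (box_rV n r).
Proof.
apply: closed_measurable_rV.
rewrite (_ : box_rV n r = \bigcap_(i in [set: 'I_n])
    ((fun x : 'rV[R]_n => x ord0 i) @^-1` `[-r, r])).
  apply: closed_bigI => i _; apply: closed_comp => [x _|].
    exact: coord_continuous.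
  exact: itv_closed.
apply/seteqP; split => x /= H i; last by have := H i I; rewrite /= in_itv/= ler_norml.
by move=> _ /=; rewrite in_itv/= -ler_norml.
Qed.

Lemma lebesgue_rV_box_fin n (r : R) :
  (leb n (box_rV n r) < +oo)%E.
Proof.
elim: n => [|n IH].
  by rewrite /= /dirac indicE ltry.
rewrite lebesgue_rVS (_ : _ @^-1` _ =
    [set t : R | `|t| <= r] `*` box_rV n r).
  rewrite (_ : [set t : R | `|t| <= r] = `[-r, r]%classic); last first.
    by apply/seteqP; split => t /=; rewrite in_itv/= ler_norml.
  rewrite product_measure1E//.
    rewrite lte_mul_pinfty//.
      by rewrite /= lebesgue_measure_itv; case: ifP => _ //=; rewrite -EFinB.
  exact: measurable_box_rV.
apply/seteqP; split => -[t x] /=.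
  move=> H; split; first by have := H ord0; rewrite cons_rVEl.
  by move=> i; have := H (lift ord0 i); rewrite cons_rVEr.
move=> [tr xr] i; have [j ->|->] := unliftP ord0 i; first by rewrite cons_rVEr.
by rewrite cons_rVEl.
Qed.

Lemma lebesgue_rV_bounded n (A : set 'rV[R]_n) : measurable A -> bounded_set A ->
  (leb n A < +oo)%E.
Proof.
move=> mA [M [_ HM]].
apply: le_lt_trans (lebesgue_rV_box_fin n (M + 1)).
apply: le_measure; rewrite ?inE//.
  exact: measurable_box_rV.
move=> x /HM H i; apply: le_trans (mx_coord_le x i) _.
by apply: H; rewrite ltrDl.
Qed.

Lemma lebesgue_measure_shift (c : R) (A : set R) : measurable A ->
  pushforward lebesgue_measure (fun x : measurableTypeR R => x + c : measurableTypeR R) A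
    = lebesgue_measure A.
Proof.
move=> mA.
have mc : measurable_fun setT (fun x : measurableTypeR R => x + c : measurableTypeR R).
  exact: measurable_funD.
apply/esym/lebesgue_measure_unique => //= _ [[a b]] _ <-.
rewrite /pushforward/= (_ : _ @^-1` _ = `]a - c, b - c]%classic); last first.
  by apply/seteqP; split => x /=; rewrite !in_itv/= ltrBlDr lerBrDr.
rewrite !lebesgue_measure_itv/= !lte_fin ltrD2r.
by case: ifP => // _; rewrite -!EFinB; congr (_%:E); ring.
Qed.

End lebesgue_rV_facts.

Section translation.
Context {R : realType}.
Local Notation leb n := (@lebesgue_rV R n).

Lemma measurable_shift_rV n (c : 'rV[R]_n) :
  measurable_fun setT (fun x : 'rV[R]_n => x + c).
Proof.
apply: measurable_fun_rV => i.
rewrite (_ : _ \o _ = fun x => rV_coord i x + c ord0 i); last first.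
  by apply/funext => x; rewrite /= /rV_coord mxE.
by apply: measurable_funD => //; exact: measurable_rV_coord.
Qed.

Lemma cons_rVD n (p q : R * 'rV[R]_n) : cons_rV p + cons_rV q = cons_rV (p + q).
Proof.
apply/rowP => i; rewrite mxE.
have [j ->|->] := unliftP ord0 i; first by rewrite !cons_rVEr/= mxE.
by rewrite !cons_rVEl.
Qed.

Lemma uncons_rVK n : cancel (@uncons_rV R n) (@cons_rV R n).
Proof.
move=> x; apply/rowP => i; have [j ->|->] := unliftP ord0 i.
  by rewrite cons_rVEr mxE.
by rewrite cons_rVEl.
Qed.

(** Induction on the dimension: by Fubini the translation acts on each slice and
    on the line that parametrises the slices. *)
Lemma lebesgue_rV_shift n (c : 'rV[R]_n) (A : set 'rV[R]_n) : measurable A ->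
  leb n ((fun x => x + c) @^-1` A) = leb n A.
Proof.
elim: n c A => [|n IH] c A mA.
  rewrite (_ : _ @^-1` A = A)//; apply/seteqP; split => x /=;
  by have -> : x + c = x by apply/rowP => -[].
rewrite !lebesgue_rVS.
set B := cons_rV (n:=n) @^-1` A.
have mB : measurable (B : set (measurableTypeR R * 'rV[R]_n)).
  by rewrite -[X in measurable X]setTI; exact: measurable_cons_rV.
have [c0 [c' ->]] : exists c0 c', c = cons_rV (c0, c').
  by exists (uncons_rV c).1, (uncons_rV c).2; rewrite -surjective_pairing uncons_rVK.
rewrite /product_measure1/=.
transitivity (\int[lebesgue_measure]_t (leb n (xsection B (t + c0)%R)))%E.
  apply: eq_integral => t _ /=.
  rewrite -[RHS](IH c'); last exact: measurable_xsection.
  congr (leb n _); apply/seteqP; split => x; rewrite /xsection/= !inE /B/=.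
    by rewrite cons_rVD.
  by rewrite cons_rVD.
have ms : measurable_fun setT (fun x : measurableTypeR R => x + c0 : measurableTypeR R).
  exact: measurable_funD.
transitivity (\int[pushforward lebesgue_measure
    (fun x : measurableTypeR R => (x + c0)%R : measurableTypeR R)]_t
      (leb n (xsection B t)))%E.
  rewrite ge0_integral_pushforward//.
  exact: measurable_fun_xsection.
by apply: eq_measure_integral => //= D mD _; exact: lebesgue_measure_shift.
Qed.

Lemma Rintegral_rV_shift n (c : 'rV[R]_n) (F : 'rV[R]_n -> R) :
  measurable_fun setT F ->
  (leb n).-integrable setT (fun x => (F (x + c))%:E) ->
  \int[leb n]_x F (x + c) = \int[leb n]_x F x.
Proof.
move=> mF iF; rewrite /Rintegral; congr fine.
transitivity (\int[pushforward (leb n) (fun x : 'rV[R]_n => x + c)%R]_x (F x)%:E)%E.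
  rewrite integral_pushforward//; first exact: measurable_shift_rV.
  exact/measurable_EFinP.
apply: eq_measure_integral => //=; first exact: measurable_shift_rV.
by move=> mc D mD _; exact: lebesgue_rV_shift.
Qed.

Lemma continuous_measurable_rV n (D : set 'rV[R]_n) (F : 'rV[R]_n -> R) :
  open D -> (forall x, D x -> {for x, continuous F}) -> measurable_fun D F.
Proof.
move=> oD cF; apply: (measurability _ (RGenOpens.measurableE R)) => _ [_ [a [b ->]] <-].
apply: open_measurable_rV.
rewrite openE => x [Dx Fx].
rewrite /interior; apply: filterI; first exact: open_nbhs_nbhs.
apply: cF => //.
exact: (open_nbhs_nbhs (conj (interval_open _ _) Fx)).
Qed.

End translation.

(** * Integrals of derivatives *)

Section integration_by_parts.
Context {R : realType} {N : nat}.
Local Notation leb := (@lebesgue_rV R N).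

Lemma compact_bounded_fun {T : topologicalType} (K : set T) (F : T -> R) :
  compact K -> (forall x, K x -> {for x, continuous F}) ->
  exists2 M : R, 0 < M & forall x, K x -> `|F x| <= M.
Proof.
move=> cK cF.
have cFK : compact (F @` K).
  apply: continuous_compact cK; apply: continuous_in_subspaceT => x.
  by rewrite inE; exact: cF.
have [M [_ HM]] := compact_bounded cFK.
exists (`|M| + 1); first by rewrite ltr_wpDl.
move=> x Kx; apply: HM; last by exists x.
by rewrite (le_lt_trans (ler_norm _))// ltrDl.
Qed.

Lemma bounded_closure (A : set 'rV[R]_N) : bounded_set A -> compact (closure A).
Proof.
move=> [M [Mr HM]]; apply: bounded_closed_compact; last exact: closed_closure.
exists M; split => // M' MM' x Ax.
have cl : closed [set y : 'rV[R]_N | `|y| <= M'].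
  rewrite (_ : [set _ | _] = (fun y : 'rV[R]_N => `|y|) @^-1` [set t | t <= M'])//.
  by apply: closed_comp => [y _|]; [exact: norm_continuous|exact: closed_le].
have := closure_subset (HM M' MM'); rewrite /= => /(_ x Ax).
by rewrite -(closure_id _).1.
Qed.

Lemma bounded_ball (r : R) : bounded_set [set x : 'rV[R]_N | `|x| <= r].
Proof.
exists r; split; first exact: num_real.
by move=> M rM x /= /le_trans; apply; exact: ltW.
Qed.

Lemma closed_norm_ball (r : R) : closed [set x : 'rV[R]_N | `|x| <= r].
Proof.
rewrite (_ : [set _ | _] = (fun y : 'rV[R]_N => `|y|) @^-1` [set t | t <= r])//.
by apply: closed_comp => [y _|]; [exact: norm_continuous|exact: closed_le].
Qed.

Lemma integrable_near_closure (Omega O : set 'rV[R]_N) (F : 'rV[R]_N -> R) :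
  open Omega -> bounded_set Omega -> closure Omega `<=` O ->
  (forall x, O x -> {for x, continuous F}) ->
  leb.-integrable Omega (EFin \o F).
Proof.
move=> oW bW WO cF.
have mW := open_measurable_rV oW.
apply: measurable_bounded_integrable => //.
- exact: lebesgue_rV_bounded.
- by apply: continuous_measurable_rV => // x /(@subset_closure _ Omega)/WO/cF.
- have [|M M0 HM] := compact_bounded_fun (bounded_closure bW) (F := F).
    by move=> x /WO/cF.
  exists M; split; first exact: num_real.
  move=> M' MM' x Wx; apply: le_trans (HM x _) (ltW MM').
  exact: subset_closure.
Qed.

(** The integral of F (h *: v + x) does not depend on h, and its derivative at
    h = 0 is the integral of 'D_v F: a bound on the derivative, times the
    indicator of a large ball, dominates the difference quotients. *)
Lemma Rintegral_derive_eq0 (F : 'rV[R]_N -> R) (r : R) (v : 'rV[R]_N) :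
  Ck 1 setT F -> (forall x, r < `|x| -> F x = 0) ->
  \int[leb]_x ('D_v F x) = 0.
Proof.
move=> CF F0.
(* The translates by h *: v with |h| < 1 all vanish outside the ball of radius
   rho. *)
pose rho := r + `|v| + 1.
pose K := [set x : 'rV[R]_N | `|x| <= rho].
have cK : compact K by apply: bounded_closed_compact; [exact: bounded_ball|exact: closed_norm_ball].
have mK : measurable K by apply: closed_measurable_rV; exact: closed_norm_ball.
have rrho : r <= rho by rewrite /rho -addrA lerDl addr_ge0.
have [M1 M10 HM1] := compact_bounded_fun cK (fun x _ => Ck_cont CF (I : setT x)).
have [M2 M20 HM2] := compact_bounded_fun cK (fun x _ => Ck_cont (Ck_D v CF) (I : setT x)).
have o0 : open [set x : 'rV[R]_N | r < `|x|].
  rewrite (_ : [set _ | _] = (fun y : 'rV[R]_N => `|y|) @^-1` [set t | r < t])//.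
  by apply: open_comp => [y _|]; [exact: norm_continuous|exact: open_gt].
have D0 x : r < `|x| -> 'D_v F x = 0.
  move=> rx; rewrite (@eq_open_derive _ _ [set x : 'rV[R]_N | r < `|x|] F (cst 0))//.
  exact: derive_cst.
have bF x : `|F x| <= M1.
  have [xr|rx] := leP `|x| r; first by apply: HM1; rewrite /K/= (le_trans xr).
  by rewrite F0// normr0 ltW.
have bD x : `|'D_v F x| <= M2.
  have [xr|rx] := leP `|x| r; first by apply: HM2; rewrite /K/= (le_trans xr).
  by rewrite D0// normr0 ltW.
have far (h : R) x : `|h| < 1 -> rho < `|x| -> r < `|h *: v + x|.
  move=> h1 xr; rewrite addrC.
  apply: lt_le_trans (lerB_normD x (h *: v)).
  rewrite ltrBrDr (le_lt_trans _ xr)// normrZ /rho -addrA lerD2l.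
  by rewrite ler_wpDr// ler_piMl// ltW.
have mF : measurable_fun setT F.
  by apply: continuous_measurable_rV; [exact: openT|move=> x; exact: (Ck_cont CF)].
have Ktop : (leb K < +oo)%E by apply: lebesgue_rV_bounded mK _; exact: bounded_ball.
have intG (M : R) : leb.-integrable setT (EFin \o (fun x => M * \1_K x)).
  have := @integrableZl _ _ R leb setT measurableT M (EFin \o \1_K).
  apply; apply/integrableP; split; first exact/measurable_EFinP/measurable_indic.
  under eq_integral do rewrite gee0_abs ?lee_fin//.
  by rewrite integral_indic// setIT.
have inth (h : R) : `|h| < 1 -> leb.-integrable setT (EFin \o (fun x => F (h *: v + x))).
  move=> h1; apply: (le_integrable _ _ _ (intG M1)) => //.
    apply/measurable_EFinP.
    rewrite (_ : (fun x => _) = F \o (fun x => x + h *: v)); last first.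
      by apply/funext => x /=; rewrite addrC.
    by apply: measurableT_comp mF _; exact: measurable_shift_rV.
  move=> x _; rewrite /= lee_fin indicE; have [Kx|Kx] := boolP (x \in K).
    by rewrite mulr1 (le_trans (bF _))// ler_norm.
  rewrite F0 ?normr0//; apply: far => //; rewrite ltNge; apply/negP => xr.
  by move/negP : Kx; apply; rewrite inE.
have I0 : (`]-1, 1[%classic : set R) 0 by rewrite /= in_itv/= ltrN10 ltr01.
have IP (h : R) : (`]-1, 1[%classic : set R) h -> `|h| < 1.
  by rewrite /= in_itv/= ltr_norml.
have d1E h x : partial1of2 (fun h x => F (h *: v + x)) h x = 'D_v F (h *: v + x).
  by rewrite partial1of2E derive_line.
have := @differentiation_under_integral R _ _ leb (fun h x => F (h *: v + x)) setT
  measurableT 0 (-1) 1 I0 (fun h Ih => inth h (IP h Ih)) _ (fun x => M2 * \1_K x) _ (intG M2) _.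
move=> H.
have -> : \int[leb]_x 'D_v F x =
    \int[leb]_y (partial1of2 (fun h x => F (h *: v + x)))^~ y 0.
  by apply: eq_Rintegral => x _; rewrite d1E scale0r add0r.
rewrite -H.
- rewrite derive1E; rewrite (@eq_open_derive R R (`]-1, 1[%classic : set R) _ (cst (\int[leb]_x F x)))//.
    by rewrite derive_cst.
  move=> h Ih; rewrite -(Rintegral_rV_shift mF (c := h *: v)).
    by apply: eq_Rintegral => x _; rewrite addrC.
  have := inth _ (IP _ Ih); congr (integrable _ _ _).
  by apply/funext => x; rewrite /= addrC.
- move=> h x Ih _; rewrite derivable_line; exact: (Ck_derivable CF).
- by move=> x; rewrite mulr_ge0// ltW.
- move=> h x Ih _; rewrite d1E indicE; have [Kx|Kx] := boolP (x \in K).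
    by rewrite mulr1 bD.
  rewrite D0 ?normr0 ?mulr0//; apply: far; first exact: IP.
  by rewrite ltNge; apply/negP => xr; move/negP : Kx; apply; rewrite inE.
Qed.

End integration_by_parts.

(** * A divergence inequality on bounded sets with supporting hyperplanes *)

Section cutoff.
Context {R : realType}.
Implicit Types (s t d : R).

Definition posqr t : R := Num.max 0 t ^+ 2.

Lemma posqr_ge0 t : 0 <= posqr t.
Proof. exact: sqr_ge0. Qed.

Lemma is_derive_posqr t v : is_derive t v posqr (2 * Num.max 0 t * v).
Proof.
apply: is_derive_expansion => e e0.
have v1 : 0 < 1 + v ^+ 2 by rewrite ltr_pwDl// sqr_ge0.
exists (e / (1 + v ^+ 2)); first by rewrite divr_gt0.
move=> s; rewrite ltr_pdivlMr// => sd.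
have H w : `|posqr (w + t) - posqr t - 2 * Num.max 0 t * w| <= w ^+ 2.
  rewrite /posqr ler_norml; apply/andP; split;
  by case: (lerP 0 (w + t)) => ?; case: (lerP 0 t) => ?; nra.
rewrite -[_ *: _]/(s * v) mulrCA; apply: le_trans (H _) _.
rewrite exprMn -(real_normK (num_real s)) expr2 -mulrA mulrC ler_wpM2r//.
apply: le_trans (ltW sd); rewrite ler_wpM2l// lerDr//.
Qed.

Lemma Ck1_posqr (A : set R) : Ck 1 A posqr.
Proof.
have cm t : {for t, continuous (fun s : R => Num.max 0 s)}.
  apply: dist_continuous => e e0; exists e => // y.
  by case: (lerP 0 y) => ?; case: (lerP 0 t) => ?; rewrite ?subrr ?normr0// ltr_norml;
    rewrite ltr_norml => /andP[? ?]; apply/andP; split; lra.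
have c t : {for t, continuous posqr}.
  rewrite (_ : posqr = fun s => Num.max 0 s * Num.max 0 s)//.
  exact: continuousM.
split; first by move=> t _.
move=> v; split; first by move=> t _; case: (is_derive_posqr t v).
move=> t _; rewrite (_ : 'D_v posqr = fun t => 2 * Num.max 0 t * v).
  apply: continuousM; last exact: cst_continuous.
  by apply: continuousM => //; exact: cst_continuous.
by apply/funext => x; case: (is_derive_posqr x v).
Qed.

(** A decreasing step: 1 up to - d and 0 from - d / 2 on. One application of posqr
    smooths each of the two corners. *)
Definition step d t : R := posqr (1 - posqr (2 / d * (t + d))).

Lemma step_ge0 d t : 0 <= step d t. Proof. exact: posqr_ge0. Qed.

Lemma step_le1 d t : step d t <= 1.
Proof.
rewrite /step {1}/posqr exprn_ile1 ?le_max ?lexx// ge_max ler01/=.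
by rewrite gerBl posqr_ge0.
Qed.

Lemma step1 d t : 0 < d -> t <= - d -> step d t = 1.
Proof.
move=> d0 td; rewrite /step [posqr (_ * _)]/posqr max_l; last first.
  by rewrite mulr_ge0_le0//; [exact/divr_ge0/ltW|lra].
by rewrite expr0n subr0 /posqr max_r// expr1n.
Qed.

Lemma step0 d t : 0 < d -> - (d / 2) <= t -> step d t = 0.
Proof.
move=> d0 td; have H : 1 <= 2 / d * (t + d).
  by rewrite mulrAC ler_pdivlMr//; lra.
rewrite /step [posqr (_ * _)]/posqr max_r; last exact: le_trans H.
rewrite /posqr max_l ?expr0n//.
by rewrite subr_le0 exprn_ege1.
Qed.

Lemma is_derive_step d t v : is_derive t v (step d)
  (2 * Num.max 0 (1 - posqr (2 / d * (t + d))) *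
    - (2 * Num.max 0 (2 / d * (t + d)) * (2 / d)) * v).
Proof.
have lin : is_derive t v (fun s => 2 / d * (s + d)) (2 / d * v).
  apply: is_derive_expansion => e e0; exists 1 => // s _.
  rewrite -[s *: v]/(s * v) (_ : _ - _ = 0); last by ring.
  by rewrite normr0 mulr_ge0// ltW.
have inn : is_derive t v (fun s => 1 - posqr (2 / d * (s + d)))
    (0 - 2 * Num.max 0 (2 / d * (t + d)) * 1 * (2 / d * v)).
  apply: is_deriveB; apply: (is_derive_scomp lin); exact: is_derive_posqr.
have := is_derive_scomp inn (is_derive_posqr (1 - posqr (2 / d * (t + d))) 1).
congr (is_derive _ _ _ _); ring.
Qed.

Lemma Ck1_step d : Ck 1 setT (step d).
Proof.
have lin : Ck 1 setT (fun s => 2 / d * (s + d)).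
  have idC : Ck 1 setT (@id R).
    split; first by move=> x _.
    move=> v; split; first by move=> x _; exact: derivable_id.
    rewrite (_ : 'D_v id = cst v); first exact: (Ck_cst 0).
    by apply/funext => x; rewrite derive_id.
  apply: (CkM openT (Ck_cst 1 _ (2 / d))).
  exact: (CkD openT idC (Ck_cst 1 _ d)).
have sq (h : R -> R) : Ck 1 setT h -> Ck 1 setT (posqr \o h).
  exact: (Ck_comp openT (fun _ _ => I) (Ck1_posqr setT)).
exact: (sq _ (CkB openT (Ck_cst 1 _ 1) (sq _ lin))).
Qed.

Lemma derive_step_le0 d t : 0 < d -> 'D_1 (step d) t <= 0.
Proof.
move=> d0; have [_ ->] := is_derive_step d t 1; rewrite mulr1 mulr_ge0_le0//.
  by rewrite mulr_ge0// le_max lexx.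
by rewrite oppr_le0 !mulr_ge0// ?le_max ?lexx// invr_ge0 ltW.
Qed.

Lemma derive_step_eq0 d t : 0 < d -> t <= - d -> 'D_1 (step d) t = 0.
Proof.
move=> d0 td; have [_ ->] := is_derive_step d t 1.
rewrite [Num.max 0 (_ / _ * _)]max_l ?mulr0 ?mul0r ?oppr0 ?mulr0 ?mul0r//.
by rewrite mulr_ge0_le0//; [exact/divr_ge0/ltW|lra].
Qed.

End cutoff.

Section divergence.
Context {R : realType} {N : nat}.
Local Notation leb := (@lebesgue_rV R N).
Implicit Types (x y z nu w : 'rV[R]_N) (Omega O : set 'rV[R]_N).

Definition supports Omega y nu := dot nu nu = 1 /\ forall z, Omega z -> dot nu (z - y) <= 0.

(** Fields are families of components, which is the form in which the
    divergence is written. *)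
Definition vdot (X : 'I_N -> 'rV[R]_N -> R) x nu : R := \sum_i X i x * nu ord0 i.

Lemma Rintegral_sum (I : Type) (r : seq I) Omega O (F : I -> 'rV[R]_N -> R) :
  open Omega -> bounded_set Omega -> closure Omega `<=` O -> open O ->
  (forall i, Ck 0 O (F i)) ->
  \int[leb]_(x in Omega) (\sum_(i <- r) F i x) = \sum_(i <- r) \int[leb]_(x in Omega) F i x.
Proof.
move=> oW bW WO oO cF; elim: r => [|i r IH].
  rewrite [RHS]big_nil -[RHS](mul0r (fine (leb Omega))) -Rintegral_cst; last exact: open_measurable_rV.
  by apply: eq_Rintegral => x _; rewrite big_nil.
rewrite [RHS]big_cons -IH -RintegralD//.
- by apply: eq_Rintegral => x _; rewrite big_cons.
- exact: open_measurable_rV.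
- exact: (integrable_near_closure oW bW WO (cF i)).
- exact: (integrable_near_closure oW bW WO (Ck_sum r oO cF)).
Qed.

Lemma Ck_cover k O1 O2 (f : 'rV[R]_N -> R) :
  Ck k O1 f -> Ck k O2 f -> Ck k (O1 `|` O2) f.
Proof.
elim: k f => [|k IH] f; first by move=> c1 c2 x [/c1|/c2].
move=> [c1 H1] [c2 H2]; split; first by move=> x [/c1|/c2].
move=> v; have [d1 C1] := H1 v; have [d2 C2] := H2 v; split; last exact: IH.
by move=> x [/d1|/d2].
Qed.

Lemma coord_le_dot nu i : dot nu nu = 1 -> `|nu ord0 i| <= 1.
Proof.
move=> n1; rewrite -[leRHS]sqrtr1 -sqrtr_sqr ler_wsqrtr// -n1 /dot (bigD1 i)//= expr2.
by rewrite lerDl sumr_ge0// => j _; rewrite -expr2 sqr_ge0.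
Qed.

Lemma unit_norm_le nu : dot nu nu = 1 -> `|nu| <= 1.
Proof.
move=> n1; apply/ler_addgt0Pr => e e0; apply/ltW.
rewrite mx_norm_lt ?addr_gt0//; apply/forallP => i.
by rewrite (le_lt_trans (coord_le_dot i n1))// ltrDl.
Qed.

(** A point from which a ball of radius r fits in Omega lies at depth r below
    every supporting hyperplane. *)
Lemma supports_deep Omega y nu x (r : R) : supports Omega y nu -> 0 <= r ->
  Omega (x + r *: nu) -> dot nu (x - y) <= - r.
Proof.
move=> [n1 H] r0 /H; rewrite (_ : x + r *: nu - y = r *: nu + (x - y)).
  by rewrite [dot nu (r *: nu + _)]dotDr dotZr n1 mulr1 -lerBrDl sub0r.
by rewrite addrCA addrA.
Qed.

Lemma derive_vdot O (X : 'I_N -> 'rV[R]_N -> R) (eta : 'rV[R]_N -> R) x :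
  open O -> Ck 1 O eta -> O x ->
  \sum_i X i x * partial i eta x = 'D_(\row_i X i x) eta x.
Proof.
move=> oO Ce Ox; rewrite (derive_grad _ oO Ce Ox).
by apply: eq_bigr => i _; rewrite !mxE.
Qed.

Lemma derive_prod_ge0 (I : eqType) (r : seq I) (F : I -> 'rV[R]_N -> R) x w :
  (forall i, 0 <= F i x) ->
  (forall i, i \in r -> derivable (F i) x w /\ 0 <= 'D_w (F i) x) ->
  derivable (fun y => \prod_(i <- r) F i y) x w /\
  0 <= 'D_w (fun y => \prod_(i <- r) F i y) x.
Proof.
move=> F0; elim: r => [|i r IH] dF.
  rewrite (_ : (fun y => _) = cst 1); last by apply/funext => y; rewrite big_nil.
  by rewrite derive_cst; split => //; exact: derivable_cst.
rewrite (_ : (fun y => _) = F i \* (fun y => \prod_(j <- r) F j y)); last first.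
  by apply/funext => y; rewrite big_cons.
have [dFi Fi0] := dF i (mem_head _ _).
have [|IH1 IH2] := IH; first by move=> j jr; apply: dF; rewrite in_cons jr orbT.
split; first exact: (derivableM dFi IH1).
rewrite [leRHS](deriveM dFi IH1); apply: addr_ge0; apply: mulr_ge0 => //.
exact: prodr_ge0.
Qed.

Lemma Ck_affine k nu y : Ck k setT (fun x => dot nu (x - y)).
Proof.
have := CkB openT (Ck_dot k nu openT) (Ck_cst k setT (dot nu y)).
by apply: Ck_congr => [|x _]; [exact: openT|rewrite dotBr].
Qed.

Lemma is_derive_affine nu y x w :
  is_derive x w (fun z => dot nu (z - y)) (dot nu w).
Proof.
apply: is_derive_expansion => e e0; exists 1 => // s _.
rewrite (_ : s *: w + x - y = s *: w + (x - y)); last by rewrite addrA.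
rewrite [dot nu (s *: w + _)]dotDr.
by rewrite dotZr addrK subrr normr0 mulr_ge0// ltW.
Qed.

(** Multiply X by steps in the depths below finitely many supporting hyperplanes
    that catch the whole boundary, by compactness. The product eta X is
    compactly supported in Omega, so its divergence integrates to zero. The
    remaining term, the derivative of eta in the direction X, is nonnegative:
    each step decreases towards its hyperplane, and in the strip where it
    varies X does not point towards that hyperplane. *)
Lemma cutoff_div_le0 Omega O (X : 'I_N -> 'rV[R]_N -> R) (d : R) :
  open Omega -> bounded_set Omega -> open O -> closure Omega `<=` O ->
  (forall i, Ck 1 O (X i)) ->
  (forall y, boundary Omega y -> exists nu, supports Omega y nu) ->
  0 < d ->
  (forall x y nu, Omega x -> boundary Omega y -> supports Omega y nu ->
     - d < dot nu (x - y) -> vdot X x nu <= 0) ->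
  exists eta : 'rV[R]_N -> R, [/\ Ck 1 setT eta,
    (forall x, 0 <= eta x <= 1),
    (forall x, (forall y nu, boundary Omega y -> supports Omega y nu ->
       dot nu (x - y) <= - d) -> eta x = 1) &
    \int[leb]_(x in Omega) (eta x * \sum_i partial i (X i) x) <= 0].
Proof.
move=> oW bW oO WO CX hsupp d0 hX.
have bdE y : boundary Omega y <-> closure Omega y /\ ~ Omega y.
  by rewrite /boundary (interior_id Omega).1.
have cbd : compact (boundary Omega).
  apply: (subclosed_compact _ (bounded_closure bW)); last by move=> y [].
  rewrite /boundary setDE; apply: closedI; first exact: closed_closure.
  exact/open_closedC/open_interior.
pose D := [set p : 'rV[R]_N * 'rV[R]_N | boundary Omega p.1 /\ supports Omega p.1 p.2].
pose A (p : 'rV[R]_N * 'rV[R]_N) := [set x | - (d / 2) < dot p.2 (x - p.1)].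
have Caff (p : 'rV[R]_N * 'rV[R]_N) k := Ck_affine k p.2 p.1.
have oA p : open (A p).
  rewrite (_ : A p = (fun x => dot p.2 (x - p.1)) @^-1` [set t | - (d / 2) < t])//.
  by apply: open_comp => [x _|]; [exact: (Ck_cont (Caff p 0%N))|exact: open_gt].
have [ps psD bdA] : exists2 ps : seq ('rV[R]_N * 'rV[R]_N),
    (forall p, p \in ps -> D p) &
    forall x, boundary Omega x -> exists2 p, p \in ps & A p x.
  have [D' D'D bdA] : finite_subset_cover D A (boundary Omega).
    move: cbd; rewrite compact_cover; apply; first by move=> p _.
    move=> y By; have [nu sy] := hsupp y By; exists (y, nu) => //=.
    rewrite /A/= subrr /dot big1 ?oppr_lt0 ?divr_gt0// => i _.
    by rewrite mxE mulr0.
  exists (finmap.enum_fset D') => [p /D'D/set_mem//|x /bdA[p pD Ap]].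
  by exists p.
pose th (p : 'rV[R]_N * 'rV[R]_N) x := step d (dot p.2 (x - p.1)).
pose eta x := \prod_(p <- ps) th p x.
have Cth p : Ck 1 setT (th p).
  by apply: (Ck_comp openT _ (Ck1_step d) (Caff p 1%N)).
have Ceta : Ck 1 setT eta by apply: Ck_prod => //; exact: openT.
have th0 p x : 0 <= th p x by exact: step_ge0.
have eta01 x : 0 <= eta x <= 1.
  by rewrite prodr_ge0//= Num.Theory.prodr_ile1// => p _; rewrite th0 step_le1.
exists eta; split => //.
  move=> x H; rewrite /eta big_seq big1// => p /psD[Bp sp].
  by rewrite /th step1//; exact: H.
(* The field eta X, extended by zero; W is a neighbourhood of the complement of
   Omega on which it vanishes, so that the extension is C^1. *)
pose F i x := if x \in Omega then eta x * X i x else 0.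
pose W := ~` closure Omega `|` \bigcup_(p in [set p | p \in ps]) A p.
have oWc : open W.
  apply: openU; first by apply: closed_openC; exact: closed_closure.
  by apply: bigcup_open => p _.
have FW i x : W x -> F i x = 0.
  rewrite /F; case: ifP => // xW [H|[p /= pD Apx]].
    by exfalso; apply: H; apply: subset_closure; rewrite inE in xW.
  rewrite /eta (big_rem p)//= /th step0 ?mul0r//; exact: ltW.
have FO i x : Omega x -> F i x = eta x * X i x by move=> ?; rewrite /F mem_set.
have CF i : Ck 1 setT (F i).
  apply: (@Ck_sub _ _ _ (Omega `|` W)).
    move=> x _; have [xW|xW] := pselect (Omega x); first by left.
    right; have [xC|xC] := pselect (closure Omega x); last by left.
    right; have [p pD Ap] := bdA x ((bdE x).2 (conj xC xW)).
    by exists p.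
  apply: Ck_cover.
    apply: (Ck_congr oW (f := eta \* X i)) => [x /FO-> //|].
    apply: CkM => //; first exact: Ck_sub Ceta.
    by apply: Ck_sub (CX i) => x /subset_closure/WO.
  apply: (Ck_congr oWc (f := cst 0)) => [x Wx|]; first by rewrite FW.
  exact: Ck_cst.
have [r Hr] : exists r : R, forall x, r < `|x| -> ~ Omega x.
  have [M [_ HM]] := bW; exists (M + 1) => x xM Wx.
  by have := HM (M + 1) _ x Wx; rewrite ltrDl ltr01 => /(_ isT) /=; rewrite leNgt xM.
have dF i : \int[leb]_(x in Omega) (partial i (fun y => eta y * X i y) x) = 0.
  have := @Rintegral_derive_eq0 R N (F i) r (delta_mx ord0 i) (CF i).
  have F0 x : r < `|x| -> F i x = 0.
    by move=> /Hr xW; rewrite /F ifF//; apply/negP; rewrite inE.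
  move=> /(_ F0) <-; rewrite Rintegral_mkcond; apply: eq_Rintegral => x _.
  rewrite patchE; case: ifPn => [|xW].
    by rewrite inE => xW; apply: (eq_open_derive _ oW xW) => y /FO->.
  have [xC|xC] := pselect (closure Omega x); last first.
    rewrite (@eq_open_derive _ _ W (F i) (cst 0))//; last by move=> y /FW->.
      by rewrite derive_cst.
    by left.
  have Wx : W x.
    right; have [|p pD Ap] := bdA x; last by exists p.
    by apply/bdE; split => //; move: xW => /negP; rewrite inE.
  rewrite (@eq_open_derive _ _ W (F i) (cst 0))//; last by move=> y /FW->.
  by rewrite derive_cst.
have CXi i k : Ck 0 O (partial k (X i)) by exact: (Ck_D _ (CX i)).
have CetaO k : Ck k setT eta -> Ck k O eta by exact: Ck_sub.
have CP i : Ck 0 O (partial i (fun y => eta y * X i y)).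
  by apply: (Ck_D _ (CkM oO (CetaO _ Ceta) (CX i))).
have key : \int[leb]_(x in Omega) (\sum_i partial i (fun y => eta y * X i y) x) = 0.
  by rewrite (@Rintegral_sum _ _ _ O)// big1.
rewrite -[leRHS]key; apply: le_Rintegral.
- exact: open_measurable_rV.
- apply: (integrable_near_closure oW bW WO).
  apply: (CkM (k := 0%N) oO (CetaO _ (Ck_S Ceta))).
  exact: (@Ck_sum R _ 0 O _ (index_enum 'I_N) (fun i => partial i (X i)) oO (fun i => CXi i i)).
- apply: (integrable_near_closure oW bW WO).
  exact: (@Ck_sum R _ 0 O _ (index_enum 'I_N)
    (fun i => partial i (fun y => eta y * X i y)) oO CP).
move=> x Wx.
have Ox : O x by exact/WO/subset_closure.
have -> : \sum_i partial i (fun y => eta y * X i y) x =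
   eta x * (\sum_i partial i (X i) x) + \sum_i X i x * partial i eta x.
  rewrite mulr_sumr -big_split; apply: eq_bigr => i _ /=.
  rewrite /partial [LHS]deriveM//; first by exact: (Ck_derivable Ceta).
  exact: (Ck_derivable (CX i)).
rewrite lerDl (derive_vdot _ openT Ceta)//.
have [|_] := @derive_prod_ge0 _ ps th x (\row_i X i x) (th0 ^~ x); last by [].
move=> p /psD[Bp sp]; set w := \row_i X i x.
have H := is_derive_scomp (is_derive_affine p.2 p.1 x w)
  (Ck1_is_derive (1 : R) (Ck1_step d) (I : setT (dot p.2 (x - p.1)))).
have [dth Eth] := H; split => //; rewrite [leRHS]Eth.
have [td|td] := leP (dot p.2 (x - p.1)) (- d).
  by rewrite derive_step_eq0// mul0r.
rewrite mulr_le0// ?derive_step_le0//.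
rewrite (_ : dot _ _ = vdot X x p.2); first exact: hX td.
by apply: eq_bigr => i _; rewrite mxE mulrC.
Qed.

(** Compactness of the set of pairs (x, nu). Near a pair at which X does not
    already satisfy the bound, nu does not support Omega, so some z in Omega lies
    beyond the hyperplane; the same z excludes all neighbouring pairs once d is
    small. *)
Lemma vdot_near_boundary Omega O (X : 'I_N -> 'rV[R]_N -> R) (e : R) :
  open Omega -> bounded_set Omega -> open O -> closure Omega `<=` O ->
  (forall i, Ck 0 O (X i)) ->
  (forall x nu, closure Omega x -> supports Omega x nu -> vdot X x nu <= 0) ->
  0 < e -> exists2 d : R, 0 < d & forall x nu, closure Omega x -> dot nu nu = 1 ->
    (forall z, Omega z -> dot nu (z - x) <= d) -> vdot X x nu <= e.
Proof.
move=> oW bW oO WO CX hX e0.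
pose S : set 'rV[R]_N := [set nu | dot nu nu = 1].
have cdot : continuous (fun p : 'rV[R]_N * 'rV[R]_N => dot p.1 p.2).
  move=> p; apply: (@Ck_cont _ _ 0 setT) => //.
  apply: (Ck_sum (k := 0%N) _ openT) => i; apply: (CkM (k := 0%N) openT) => q _.
    exact: (@continuous_comp _ _ _ fst (fun y : 'rV[R]_N => y ord0 i) q cvg_fst (@coord_continuous _ _ _ _ _ _)).
  exact: (@continuous_comp _ _ _ snd (fun y : 'rV[R]_N => y ord0 i) q cvg_snd (@coord_continuous _ _ _ _ _ _)).
have cS : compact S.
  apply: bounded_closed_compact.
    exists 1; split; first exact: num_real.
    by move=> M M1 x /unit_norm_le /le_trans; apply; exact: ltW.
  rewrite (_ : S = (fun nu => dot nu nu) @^-1` [set 1])//.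
  apply: closed_comp => [nu _|]; last exact: closed_eq.
  apply: (@Ck_cont _ _ 0 setT) => //.
  apply: (Ck_sum (k := 0%N) _ openT) => i.
  by apply: (CkM (k := 0%N) openT); exact: (Ck_coord 0 i openT).
have cK := compact_setX (bounded_closure bW) cS.
pose P (d : R) (p : 'rV[R]_N * 'rV[R]_N) :=
  (forall z, Omega z -> dot p.2 (z - p.1) <= d) -> vdot X p.1 p.2 <= e.
have H : \forall d \near (0 : R)^'+, closure Omega `*` S `<=` P d.
  apply: (compact_near_coveringP _).1 => //.
  move=> [x nu] [/= xW nu1].
  have [small|big] := ltP (vdot X x nu) e.
    exists ([set p | vdot X p.1 p.2 < e], setT) => /=; last first.
      by move=> [p d] [/= pe _] _; exact: ltW.
    split; last exact: filterT.
    have cv : {for (x, nu), continuous (fun p : 'rV[R]_N * 'rV[R]_N => vdot X p.1 p.2)}.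
      have oOT : open (fst @^-1` O : set ('rV[R]_N * 'rV[R]_N)).
        by apply: open_comp => // p _; exact: cvg_fst.
      apply: (@Ck_cont _ _ 0 (fst @^-1` O)) => /=; last exact: WO.
      apply: (Ck_sum (k := 0%N) _ oOT) => i; apply: (CkM (k := 0%N) oOT) => q Oq.
        exact: (@continuous_comp _ _ _ fst (X i) q cvg_fst (CX i _ Oq)).
      exact: (@continuous_comp _ _ _ snd (fun y : 'rV[R]_N => y ord0 i) q cvg_snd (@coord_continuous _ _ _ _ _ _)).
    exact: (cvgr_lt _ cv _ small).
  have [z Wz nz] : exists2 z, Omega z & 0 < dot nu (z - x).
    apply: contrapT => H; suff : vdot X x nu <= 0 by rewrite leNgt (lt_le_trans e0 big).
    apply: hX => //; split => // z Wz; rewrite leNgt; apply/negP => nz.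
    by apply: H; exists z.
  pose c := dot nu (z - x) / 2.
  have c0 : 0 < c by rewrite divr_gt0.
  exists ([set p | c < dot p.2 (z - p.1)], [set d | d < c]) => /=; last first.
    move=> [p d] [/= pc dc] /(_ z Wz); rewrite leNgt => /negP[].
    exact: lt_trans pc.
  split; last exact: nbhs_right_lt.
  have cv : {for (x, nu), continuous (fun p : 'rV[R]_N * 'rV[R]_N => dot p.2 (z - p.1))}.
    apply: (@continuous2_cvg _ _ _ _ _ _ snd (fun p => z - p.1) dot nu (z - x)).
    - exact: (cdot (nu, z - x)).
    - exact: cvg_snd.
    - by apply: cvgB; [exact: cvg_cst|exact: cvg_fst].
  apply: (cvgr_gt _ cv c); rewrite /= /c; lra.
have [d [/= d0 dH]] : exists d : R, 0 < d /\ closure Omega `*` S `<=` P d.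
  have [d] := filter_ex (filterI (nbhs_right_gt (0 : R)) H).
  by move=> [d0 dH]; exists d.
by exists d => // x nu xW nu1; exact: (dH (x, nu)).
Qed.

End divergence.

Section inward_fields.
Context {R : realType} {N : nat}.
Local Notation leb := (@lebesgue_rV R N).
Implicit Types (x y z nu w : 'rV[R]_N) (Omega O : set 'rV[R]_N).

(** One half of the divergence theorem. Supporting hyperplanes replace the
    surface measure: the field is multiplied by cutoffs that tend to the
    indicator of Omega. Near the boundary X need only be almost inward, which a
    small multiple of x - x0, for an interior point x0, corrects; this multiple
    then tends to zero. *)
Lemma Rintegral_div_le0 Omega O (X : 'I_N -> 'rV[R]_N -> R) :
  open Omega -> bounded_set Omega -> open O -> closure Omega `<=` O ->
  (forall i, Ck 1 O (X i)) ->
  (forall y, boundary Omega y -> exists nu, supports Omega y nu) ->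
  (forall x nu, closure Omega x -> supports Omega x nu -> vdot X x nu <= 0) ->
  \int[leb]_(x in Omega) (\sum_i partial i (X i) x) <= 0.
Proof.
move=> oW bW oO WO CX hsupp hX.
have mW := open_measurable_rV oW.
have [->|/set0P[x0 Wx0]] := eqVneq Omega set0; first by rewrite Rintegral_set0.
have [rho rho0 rhoW] := open_dist oW Wx0.
pose r0 := rho / 2.
have r00 : 0 < r0 by rewrite divr_gt0.
have x0nu nu : dot nu nu = 1 -> Omega (x0 + r0 *: nu).
  move=> nu1; apply: rhoW; rewrite [x0 + _]addrC addrK normrZ gtr0_norm//.
  rewrite (le_lt_trans (ler_piMr (ltW r00) (unit_norm_le nu1)))// /r0.
  by rewrite ltr_pdivrMr// ltr_pMr// ltr1n.
have fW : leb Omega \is a fin_num.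
  by rewrite ge0_fin_numE//; exact: lebesgue_rV_bounded.
suff H e : 0 < e -> \int[leb]_(x in Omega) (\sum_i partial i (X i) x) <=
    2 * e / r0 * N%:R * fine (leb Omega).
  pose C := 2 / r0 * N%:R * fine (leb Omega).
  have C0 : 0 <= C by rewrite !mulr_ge0// ?fine_ge0// invr_ge0 ltW.
  apply/ler_addgt0Pr => e e0; rewrite add0r.
  have e1 : 0 < e / (1 + C) by rewrite divr_gt0// ltr_pwDl.
  apply: le_trans (H _ e1) _.
  rewrite (_ : _ * fine _ = e / (1 + C) * C); last by rewrite /C; ring.
  by rewrite mulrAC ler_pdivrMr ?ltr_pwDl// ler_pM2l// lerDr.
(* x - x0 has component at least r0 / 2 along every nu that supports Omega at a
   point close to x, so that subtracting k times it gains e. *)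
move=> e0; pose k := 2 * e / r0.
have k0 : 0 < k by rewrite !mulr_gt0// invr_gt0.
pose Y i x := X i x - k * (x ord0 i - x0 ord0 i).
have Clin i : Ck 1 O (fun x => k * (x ord0 i - x0 ord0 i)).
  apply: (CkM oO (Ck_cst 1 O k)).
  exact: (CkB oO (Ck_coord 1 i oO) (Ck_cst 1 O (x0 ord0 i))).
have CY i : Ck 1 O (Y i) by exact: (CkB oO (CX i) (Clin i)).
have dY i x : O x -> partial i (Y i) x = partial i (X i) x - k.
  move=> Ox; rewrite /partial /Y [LHS]deriveB; last 2 first.
    exact: (Ck_derivable (CX i)).
    exact: (Ck_derivable (Clin i)).
  congr (_ - _).
  have : is_derive x (delta_mx ord0 i) (fun x => k * (x ord0 i - x0 ord0 i)) (k * 1).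
    apply: is_derive_expansion => e1 e10; exists 1 => // s _.
    rewrite !mxE !eqxx /= (_ : _ - _ = 0); last by ring.
    by rewrite normr0 mulr_ge0// ltW.
  by move=> [_ ->]; rewrite mulr1.
have vY x nu : vdot Y x nu = vdot X x nu - k * dot nu (x - x0).
  rewrite /vdot /dot mulr_sumr -sumrB; apply: eq_bigr => i _; rewrite /Y !mxE.
  ring.
(* At points close to the boundary vdot X x nu is at most e for every nu that
   supports Omega at a nearby boundary point. *)
have [d1 d10 d1H] := vdot_near_boundary oW bW oO WO (fun i => Ck_S (CX i)) hX e0.
pose d0 := Num.min d1 (r0 / 2).
have d00 : 0 < d0 by rewrite lt_min d10 divr_gt0.
have hY d x y nu : d <= d0 -> Omega x -> boundary Omega y -> supports Omega y nu ->
    - d < dot nu (x - y) -> vdot Y x nu <= 0.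
  rewrite le_min => /andP[dd1 dr0] Wx By sy dxy; have [nu1 ny] := sy.
  have far : dot nu (x0 - y) <= - r0 by apply: supports_deep sy (ltW r00) (x0nu nu nu1).
  have E1 : vdot X x nu <= e.
    apply: d1H => //; first exact: subset_closure.
    move=> z Wz; have := ny z Wz.
    rewrite (_ : z - x = z - y - (x - y)); last by rewrite opprB addrA subrK.
    rewrite [dot nu (_ - (x - y))]dotBr; lra.
  have E2 : r0 / 2 <= dot nu (x - x0).
    rewrite (_ : x - x0 = x - y - (x0 - y)); last by rewrite opprB addrA subrK.
    rewrite [dot nu (_ - (x0 - y))]dotBr; lra.
  rewrite vY subr_le0; apply: le_trans E1 _.
  apply: le_trans (_ : k * (r0 / 2) <= _); last by rewrite ler_pM2l.
  by rewrite /k le_eqVlt; apply/orP; left; apply/eqP; field; rewrite gt_eqF.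
pose dn (n : nat) := d0 / n.+1%:R.
have dn0 n : 0 < dn n by rewrite divr_gt0.
have dnd n : dn n <= d0 by rewrite ler_pdivrMr// ler_peMr ?ler1n// ltW.
have /choice[eta Heta] : forall n, exists eta : 'rV[R]_N -> R, [/\ Ck 1 setT eta,
    (forall x, 0 <= eta x <= 1),
    (forall x, (forall y nu, boundary Omega y -> supports Omega y nu ->
       dot nu (x - y) <= - dn n) -> eta x = 1) &
    \int[leb]_(x in Omega) (eta x * \sum_i partial i (Y i) x) <= 0].
  move=> n; apply: (cutoff_div_le0 oW bW oO WO CY hsupp (dn0 n)) => x y nu.
  exact: hY.
pose G x := \sum_i partial i (Y i) x.
have CG : Ck 0 O G.
  exact: (@Ck_sum R _ 0 O _ (index_enum 'I_N) _ oO (fun i => Ck_D _ (CY i))).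
have iG : leb.-integrable Omega (EFin \o G) := integrable_near_closure oW bW WO CG.
have CE n : Ck 0 O (fun x => eta n x * G x).
  have [Ce _ _ _] := Heta n.
  by apply: (CkM (k := 0%N) oO) => //; exact: (Ck_sub _ (Ck_S Ce)).
have iE n : leb.-integrable Omega (EFin \o (fun x => eta n x * G x)).
  exact: (integrable_near_closure oW bW WO (CE n)).
have cv x : Omega x -> (fun n => (eta n x * G x)%:E) @ \oo --> (G x)%:E.
  move=> Wx; have [s s0 sW] := open_dist oW Wx.
  apply: cvg_EFin; first exact: nearW.
  apply: cvg_near_cst.
  have : \forall n \near \oo, dn n < s / 2.
    have e1 : 0 < s / 2 / d0 by rewrite !divr_gt0.
    have := near_infty_natSinv_lt (PosNum e1); apply: filterS => n /= nh.
    by rewrite /dn mulrC -ltr_pdivlMr.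
  apply: filterS => n dns /=.
  have [_ _ H1 _] := Heta n; rewrite H1 ?mul1r// => y nu By sy.
  apply: le_trans (_ : - (s / 2) <= _); last by rewrite lerN2 ltW.
  apply: (supports_deep sy); first by rewrite ltW// divr_gt0.
  apply: sW; rewrite [x + _]addrC addrK normrZ gtr0_norm ?divr_gt0//.
  rewrite (le_lt_trans (ler_piMr _ (unit_norm_le sy.1)))//; first by rewrite ltW// divr_gt0.
  by rewrite ltr_pdivrMr// ltr_pMr// ltr1n.
have dom x n : Omega x -> (`|(eta n x * G x)%:E| <= (`|G x|)%:E)%E.
  move=> _; have [_ e01 _ _] := Heta n; have /andP[e00 e11] := e01 x.
  by rewrite abse_EFin lee_fin normrM ger0_norm// ler_piMl.
have [_ _ lim] := @dominated_convergence _ _ R leb Omega mW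
  (fun n x => (eta n x * G x)%:E) (EFin \o G) (EFin \o (fun x => `|G x|))
  (fun n => measurable_int _ (iE n)) (measurable_int _ iG)
  (aeW _ cv) (integrable_norm iG)
  (aeW _ dom).
have HG : \int[leb]_(x in Omega) G x <= 0.
  rewrite /Rintegral fine_le0//; apply: (cvge_to_le lim); apply: nearW => n.
  have [_ _ _] := Heta n; rewrite /Rintegral -lee_fin fineK//.
  exact: integrable_fin_num (iE n).
have EG : \int[leb]_(x in Omega) G x =
    \int[leb]_(x in Omega) (\sum_i partial i (X i) x) - k * N%:R * fine (leb Omega).
  rewrite -Rintegral_cst// -RintegralB//.
  - apply: eq_Rintegral => x /set_mem Wx; rewrite /G.
    rewrite (eq_bigr (fun i => partial i (X i) x - k)); last first.
      by move=> i _; apply: dY; exact/WO/subset_closure.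
    by rewrite sumrB sumr_const card_ord mulr_natr.
  - apply: (integrable_near_closure oW bW WO).
    exact: (@Ck_sum R _ 0 O _ (index_enum 'I_N) _ oO (fun i => Ck_D _ (CX i))).
  - apply: (integrable_near_closure oW bW WO (F := cst (k * N%:R))) => x _.
    exact: cst_continuous.
by move: HG; rewrite EG subr_le0.
Qed.
End inward_fields.

(** * Boundary points of convex sets of class C^1 *)

Section boundary.
Context {R : realType} {N : nat}.
Implicit Types (x y z nu w tau : 'rV[R]_N) (Omega O : set 'rV[R]_N) (rho : 'rV[R]_N -> R).

Lemma eq_le0 (a : R) : a = 0 -> a <= 0. Proof. by move=> ->. Qed.

Lemma closureP Omega x : closure Omega x <->
  forall e : R, 0 < e -> exists2 y, Omega y & `|y - x| < e.
Proof.
split=> [cx e e0|H B /nbhs_ballP[e /= e0 eB]].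
  have [|y [Wy By]] := cx (ball x e); first exact: nbhsx_ballx.
  by exists y => //; move: By; rewrite -ball_normE/= distrC.
have [y Wy yx] := H e e0; exists y; split => //; apply: eB.
by rewrite -ball_normE/= distrC.
Qed.

Lemma convex_comb Omega x y (s : R) : convex_set Omega -> Omega x -> Omega y ->
  0 <= s <= 1 -> Omega (x + s *: (y - x)).
Proof.
move=> cW Wx Wy /andP[s0 s1].
have := cW y x (Itv01 s0 s1) (mem_set Wy) (mem_set Wx); rewrite inE.
congr Omega; rewrite /conv/= scalerBl scale1r scalerBr.
by rewrite addrCA.
Qed.

Lemma convex_comb_closure Omega x y (s : R) : convex_set Omega ->
  closure Omega x -> Omega y -> 0 <= s <= 1 -> closure Omega (x + s *: (y - x)).
Proof.
move=> cW /closureP Wx Wy s01; have /andP[s0 s1] := s01.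
apply/closureP => e /Wx[z Wz zx].
exists (z + s *: (y - z)); first exact: convex_comb.
rewrite (_ : _ - _ = (1 - s) *: (z - x)).
  by rewrite normrZ ger0_norm ?subr_ge0// (le_lt_trans _ zx)// ler_piMl// gerBl.
rewrite !scalerBr !scalerBl !scale1r.
by apply/rowP => i; rewrite !mxE; ring.
Qed.

Lemma dot_le0_closure Omega y nu : (forall z, Omega z -> dot nu (z - y) <= 0) ->
  forall z, closure Omega z -> dot nu (z - y) <= 0.
Proof.
move=> H z Wz.
pose K := [set z | dot nu (z - y) <= 0].
have cK : closed K.
  rewrite (_ : K = (fun z => dot nu (z - y)) @^-1` [set t | t <= 0])//.
  apply: closed_comp => [x _|]; last exact: closed_le.
  exact: (Ck_cont (Ck_affine 0 nu y)).
have : closure K z by apply: closure_subset Wz => x /H.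
by rewrite -(closure_id K).1.
Qed.

Section local_equation.
Variables (Omega O : set 'rV[R]_N) (rho : 'rV[R]_N -> R).
Hypotheses (oW : open Omega) (cW : convex_set Omega) (oO : open O)
  (Crho : Ck 1 O rho) (g0 : forall y, O y -> grad rho y != 0)
  (WE : Omega `&` O = [set y | O y /\ rho y < 0]).

Lemma local_neg y : O y -> Omega y <-> rho y < 0.
Proof.
move=> Oy; split => [Wy|ry].
  have : (Omega `&` O) y by split.
  by rewrite WE => -[].
have : [set y | O y /\ rho y < 0] y by split.
by rewrite -WE => -[].
Qed.

(** First order expansion along v. *)
Lemma descent y v : O y -> rho y <= 0 -> 'D_v rho y < 0 ->
  exists2 d : R, 0 < d & forall s : R, 0 < s < d -> Omega (s *: v + y).
Proof.
move=> Oy ry Dv; pose e := - 'D_v rho y / 2.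
have e0 : 0 < e by rewrite divr_gt0// oppr_gt0.
have [d1 d10 d1H] := C1_expansion v oO Crho Oy e0.
have [d2 d20 d2O] := open_dist oO Oy.
have [d3 d30 d3H] := line_ball y v d20.
exists (Num.min d1 d3); first by rewrite lt_min d10.
move=> s /andP[s0]; rewrite lt_min => /andP[s1 s3].
have Os : O (s *: v + y) by apply/d2O/d3H; rewrite ?subrr ?normr0 ?gtr0_norm.
apply/(local_neg Os).
have := d1H y s; rewrite subrr normr0 gtr0_norm// => /(_ d10 s1).
rewrite ler_norml => /andP[_]; rewrite /e; nra.
Qed.

(** A zero of rho is a limit of points of Omega because rho decreases along
    - grad rho, which does not vanish. *)
Lemma boundary_rho y : O y -> boundary Omega y <-> rho y = 0.
Proof.
move=> Oy; rewrite /boundary (interior_id Omega).1//; split => [[cy nWy]|ry].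
  apply/eqP; rewrite eq_le; apply/andP; split; last first.
    by rewrite leNgt; apply/negP => /(local_neg Oy).
  rewrite leNgt; apply/negP => ry.
  have [d1 d10 d1O] := open_dist oO Oy.
  have [d2 d20 d2H] := continuous_dist (Ck_cont Crho Oy) ry.
  have d12 : 0 < Num.min d1 d2 by rewrite lt_min d10.
  have [z Wz] := (closureP _ _).1 cy _ d12; rewrite lt_min => /andP[z1 z2].
  have := (local_neg (d1O _ z1)).1 Wz.
  by have := d2H _ z2; rewrite ltr_norml => /andP[? _]; lra.
split; last by move=> /(local_neg Oy); rewrite ry ltxx.
have Dg : 'D_(- grad rho y) rho y < 0.
  by rewrite (derive_grad _ oO Crho Oy) dotNl oppr_lt0 dot_gt0// g0.
have [d d0 dH] := descent Oy (eq_le0 ry) Dg.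
apply/closureP => e e0.
have [d2 d20 d2H] := line_ball y (- grad rho y) e0.
pose s := Num.min d d2 / 2.
have m0 : 0 < Num.min d d2 by rewrite lt_min d0.
have s0 : 0 < s by rewrite divr_gt0.
have : s < Num.min d d2 by rewrite ltr_pdivrMr// ltr_pMr// ltr1n.
rewrite lt_min => /andP[s1 s2].
exists (s *: - grad rho y + y); first by apply: dH; rewrite s0.
by apply: d2H; rewrite ?subrr ?normr0 ?gtr0_norm.
Qed.

(** If grad rho y had a positive component along z - y with z in Omega, then rho
    would be positive on the beginning of the segment from y to z; by convexity
    this segment stays in the closure of Omega, where rho is nonpositive. *)
Lemma grad_supports y z : O y -> rho y = 0 -> closure Omega z ->
  dot (grad rho y) (z - y) <= 0.
Proof.
move=> Oy ry; apply: dot_le0_closure => {}z Wz.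
rewrite leNgt; apply/negP => gz.
pose e := dot (grad rho y) (z - y) / 2.
have e0 : 0 < e by rewrite divr_gt0.
have [d1 d10 d1H] := C1_expansion (z - y) oO Crho Oy e0.
have [d2 d20 d2O] := open_dist oO Oy.
have [d3 d30 d3H] := line_ball y (z - y) d20.
pose m := Num.min 1 (Num.min d1 d3).
have m0 : 0 < m by rewrite !lt_min ltr01 d10.
pose s := m / 2.
have s0 : 0 < s by rewrite divr_gt0.
have : s < m by rewrite ltr_pdivrMr// ltr_pMr// ltr1n.
rewrite !lt_min => /and3P[s1 s2 s3].
have Os : O (s *: (z - y) + y) by apply/d2O/d3H; rewrite ?subrr ?normr0 ?gtr0_norm.
have cy : closure Omega y by have /(boundary_rho Oy)[] := ry.
have cs : closure Omega (s *: (z - y) + y).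
  rewrite addrC; apply: convex_comb_closure => //.
  by rewrite ltW//= ltW.
have pos : 0 < rho (s *: (z - y) + y).
  have := d1H y s; rewrite subrr normr0 gtr0_norm// => /(_ d10 s2).
  rewrite (derive_grad _ oO Crho Oy) dotC ry ler_norml => /andP[H _].
  move: H; rewrite /e; nra.
have [Ws|nWs] := pselect (Omega (s *: (z - y) + y)).
  by have /(local_neg Os) := Ws; lra.
have /(boundary_rho Os) : boundary Omega (s *: (z - y) + y).
  by rewrite /boundary (interior_id Omega).1.
lra.
Qed.

(** Every direction of descent of rho enters Omega, hence makes an obtuse angle
    with nu. Such directions fill the open half-space opposite to grad rho, so
    nu is the positive unit multiple of grad rho. *)
Lemma supports_grad y nu : O y -> rho y = 0 -> supports Omega y nu ->
  nu = (enorm (grad rho y))^-1 *: grad rho y.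
Proof.
move=> Oy ry [nu1 Hnu]; set g := grad rho y.
have gg : 0 < dot g g by rewrite dot_gt0// g0.
have gn : 0 < enorm g by rewrite sqrtr_gt0.
have gn2 : enorm g ^+ 2 = dot g g by exact: enorm_sqr.
have half v : dot v g < 0 -> dot nu v <= 0.
  move=> vg; have [|d d0 dH] := @descent y v Oy (eq_le0 ry).
    by rewrite (derive_grad _ oO Crho Oy).
  have d2 : 0 < d / 2 by rewrite divr_gt0.
  have := Hnu _ (dH (d / 2) _); rewrite d2 ltr_pdivrMr// ltr_pMr// ltr1n => /(_ isT).
  by rewrite addrK dotZr pmulr_rle0.
have ng0 : 0 <= dot nu g.
  by have := half (- g); rewrite dotNl oppr_lt0 dotNr oppr_le0; exact.
have key : enorm g <= dot nu g.
  suff : dot g g <= dot nu g ^+ 2.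
    by rewrite -gn2 ler_sqr// nnegrE ?enorm_ge0.
  apply/ler_addgt0Pl => e e0.
  (* Test the component of nu orthogonal to g, tilted by - dl *: g so that it
     becomes a direction of descent. *)
  pose c := dot nu g.
  pose dl := e / (1 + c).
  have den : 0 < 1 + c by rewrite ltr_pwDl.
  have dl0 : 0 < dl by rewrite divr_gt0.
  have := half (dot g g *: nu - c *: g - dl *: g).
  rewrite !(dotBl, dotBr, dotZl, dotZr) nu1 -/c => H.
  have {H} : dot g g * 1 - c * c - dl * c <= 0.
    by apply: H; rewrite [dot g g * c]mulrC subrr sub0r oppr_lt0 mulr_gt0.
  have : dl * c <= e.
    by rewrite /dl mulrAC ler_pdivrMr// ler_pM2l// lerDr.
  rewrite -/c; nra.
apply/eqP; rewrite -subr_eq0 -dot_eq0 eq_le dot_ge0 andbT.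
rewrite !(dotBl, dotBr, dotZl, dotZr) nu1 [dot g nu]dotC -gn2.
set n := enorm g; have nn : n^-1 * (n^-1 * n ^+ 2) = 1 by field; rewrite gt_eqF.
rewrite nn; have : 1 <= n^-1 * dot nu g by rewrite mulrC ler_pdivlMr// mul1r.
lra.
Qed.

(** A point displaced tangentially from the boundary by s is outside Omega, or on
    its boundary, because grad rho x supports Omega at x; moving back by
    kappa * s along - grad rho x brings it inside. In between rho vanishes. *)
Lemma boundary_crossing x tau (kappa eta : R) : O x -> rho x = 0 ->
  dot tau (grad rho x) = 0 -> 0 < kappa -> 0 < eta ->
  exists s r : R, [/\ 0 < s < eta, 0 <= r <= kappa * s /\ r < eta,
    `|s *: tau + x - x| < eta,
    `|(- r) *: grad rho x + (s *: tau + x) - x| < eta &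
    O ((- r) *: grad rho x + (s *: tau + x)) /\
    rho ((- r) *: grad rho x + (s *: tau + x)) = 0].
Proof.
move=> Ox rx tg k0 eta0; set g := grad rho x.
have [d1 d10 d1O] := open_dist oO Ox.
have m10 : 0 < Num.min d1 eta by rewrite lt_min d10.
have [d2 d20 d2H] := line_ball x g m10.
have m20 : 0 < Num.min d2 eta by rewrite lt_min d20.
have [d3 d30 d3H] := line_ball x tau m20.
have Dg : 'D_(tau + (- kappa) *: g) rho x < 0.
  rewrite (derive_grad _ oO Crho Ox) dotDl tg add0r dotZl.
  by rewrite mulNr oppr_lt0 mulr_gt0// dot_gt0// g0.
have [d4 d40 d4H] := descent Ox (eq_le0 rx) Dg.
pose m := Num.min (Num.min d2 eta / (1 + kappa)) (Num.min eta (Num.min d3 d4)).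
have k10 : 0 < 1 + kappa by rewrite addr_gt0.
have m0 : 0 < m by rewrite !lt_min !divr_gt0// eta0 d30 d40.
pose s := m / 2.
have s0 : 0 < s by rewrite divr_gt0.
have : s < m by rewrite ltr_pdivrMr// ltr_pMr// ltr1n.
rewrite !lt_min => /and4P[s1 s2 s3 s4].
have ks : kappa * s < Num.min d2 eta.
  by move: s1; rewrite ltr_pdivlMr// => s1; apply: lt_trans s1; rewrite mulrC ltr_pM2l// ltrDr.
have xx d : 0 < d -> `|x - x| < d by rewrite subrr normr0.
have Htau : `|s *: tau + x - x| < Num.min d2 eta by apply: d3H; rewrite ?xx ?gtr0_norm.
have Hr (r : R) : 0 <= r <= kappa * s ->
    `|(- r) *: g + (s *: tau + x) - x| < Num.min d1 eta.
  move=> /andP[r0 rk]; move: Htau ks; rewrite !lt_min => /andP[t1 t2] /andP[k1 k2].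
  have := d2H _ (- r) t1; rewrite normrN ger0_norm// (le_lt_trans rk k1) => /(_ isT).
  by rewrite lt_min.
have HO r : 0 <= r <= kappa * s -> O ((- r) *: g + (s *: tau + x)).
  by move=> /Hr; rewrite lt_min => /andP[H _]; exact: d1O.
have ks0 : 0 <= kappa * s by rewrite mulr_ge0// ltW.
pose f r := rho ((- r) *: g + (s *: tau + x)).
have f0 : 0 <= f 0.
  have O0 : O ((- 0) *: g + (s *: tau + x)) by apply: HO; rewrite lexx.
  rewrite leNgt; apply/negP => /(local_neg O0); rewrite oppr0 scale0r add0r => W0.
  have [e e0 eW] := open_dist oW W0.
  have [e1 e10 e1H] := line_ball (s *: tau + x) g e0.
  have W1 : Omega ((e1 / 2) *: g + (s *: tau + x)).
    apply: eW; apply: e1H; first by rewrite subrr normr0.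
    by rewrite gtr0_norm ?divr_gt0// ltr_pdivrMr// ltr_pMr// ltr1n.
  have := grad_supports Ox rx (subset_closure W1).
  rewrite addrA addrK dotDr !dotZr [dot _ tau]dotC tg mulr0 addr0.
  by rewrite leNgt mulr_gt0 ?divr_gt0// dot_gt0// g0.
have f1 : f (kappa * s) < 0.
  apply/(local_neg (HO _ _)); first by rewrite ks0/=.
  have := d4H s; rewrite s0 s4 => /(_ isT); congr Omega.
  rewrite scalerDr -addrA addrCA; congr (_ + _).
  by rewrite scalerA mulrN mulrC.
have [||r] := @IVT R f 0 (kappa * s) 0 ks0.
- apply: derivable_within_continuous => r; rewrite in_itv/= => rk.
  have -> : f = (fun r => rho (r *: g + (s *: tau + x))) \o -%R by [].
  have H : is_derive (- r) 1 (fun r => rho (r *: g + (s *: tau + x)))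
      ('D_g rho ((- r) *: g + (s *: tau + x))).
    by apply: is_derive_line; apply: (Ck_derivable Crho); exact: HO.
  by case: (is_derive1_comp H (is_deriveNid r 1)).
- by rewrite ge_min le_max (ltW f1) f0 orbT.
rewrite in_itv/= => rk fr; exists s, r; split => //.
- by rewrite s0 s2.
- split=> //; move: rk => /andP[_ /le_lt_trans]; apply.
  by move: ks; rewrite lt_min => /andP[].
- by move: Htau; rewrite lt_min => /andP[].
- by have := Hr r rk; rewrite lt_min => /andP[].
- by split => //; exact: HO.
Qed.

End local_equation.

Lemma uniform_near (I : finType) (P : I -> R -> Prop) :
  (forall i d d', 0 < d' <= d -> P i d -> P i d') ->
  (forall i, exists2 d : R, 0 < d & P i d) ->
  exists2 d : R, 0 < d & forall i, P i d.
Proof.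
move=> mono H.
have : \forall d \near (0 : R)^'+, forall i, P i d.
  apply: filter_forall => i; have [d d0 Pd] := H i.
  near=> d'; apply: mono Pd; apply/andP; split.
    by near: d'; exact: nbhs_right_gt.
  by near: d'; exact: nbhs_right_le.
move=> /(filterI (nbhs_right_gt (0 : R)))/filter_ex[d [/= d0 Pd]].
by exists d.
Unshelve. all: by end_near. Qed.

End boundary.

Section curvature.
Context {R : realType} {N : nat}.
Implicit Types (x y z nu w tau : 'rV[R]_N) (Omega O : set 'rV[R]_N) (rho : 'rV[R]_N -> R).

Lemma C1_expansion_family O (b : 'I_N -> 'rV[R]_N -> R) x v (e : R) :
  open O -> (forall i, Ck 1 O (b i)) -> O x -> 0 < e ->
  exists2 d : R, 0 < d & forall i y (s : R), `|y - x| < d -> `|s| < d ->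
    `|b i (s *: v + y) - b i y - s * 'D_v (b i) x| <= e * `|s|.
Proof.
move=> oO Cb Ox e0.
apply: (@uniform_near R 'I_N (fun i d => forall y s, `|y - x| < d -> `|s| < d ->
    `|b i (s *: v + y) - b i y - s * 'D_v (b i) x| <= e * `|s|)).
  move=> i d d' /andP[_ d'd] H y s yx sd.
  by apply: H; exact: lt_le_trans d'd.
by move=> i; exact: C1_expansion (Cb i) Ox _ e0.
Qed.

Lemma continuous_family (b : 'I_N -> 'rV[R]_N -> R) x (e : R) :
  (forall i, {for x, continuous (b i)}) -> 0 < e ->
  exists2 d : R, 0 < d & forall i y, `|y - x| < d -> `|b i y - b i x| < e.
Proof.
move=> cb e0.
apply: (@uniform_near R 'I_N (fun i d => forall y, `|y - x| < d -> `|b i y - b i x| < e)).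
  by move=> i d d' /andP[_ d'd] H y yx; apply: H; exact: lt_le_trans d'd.
by move=> i; exact: continuous_dist (cb i) e0.
Qed.

(** For a C^2 boundary this is the nonnegativity of the curvature of a convex
    set. For a C^1 boundary, go from x to a boundary point
    y = x + s b(x) - r grad rho x with r much smaller than s. There
    b(y) . grad rho y = 0, whereas b(x) . grad rho y >= 0 because grad rho y
    supports Omega at y while x lies in its closure. Hence the increment
    b(y) - b(x), which is s times the derivative of b along b(x) up to a
    smaller error, has a nonpositive product with grad rho y, and grad rho y is
    close to grad rho x. *)
Lemma tangent_derive_le0 Omega O O' rho (b : 'I_N -> 'rV[R]_N -> R) x :
  open Omega -> convex_set Omega ->
  open O -> Ck 1 O rho -> (forall y, O y -> grad rho y != 0) ->
  Omega `&` O = [set y | O y /\ rho y < 0] ->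
  open O' -> (forall i, Ck 1 O' (b i)) ->
  (forall y, O y -> rho y = 0 -> \sum_i b i y * grad rho y ord0 i = 0) ->
  O x -> O' x -> rho x = 0 ->
  \sum_i grad rho x ord0 i * 'D_(\row_j b j x) (b i) x <= 0.
Proof.
move=> oW cW oO Crho g0 WE oO' Cb tang Ox O'x rx.
set tau := \row_j b j x; set g := grad rho x.
rewrite leNgt; apply/negP => S0; set S := \sum_i _ in S0.
pose a i := 'D_tau (b i) x; pose c i := 'D_g (b i) x.
(* If the sum S is positive, the errors are made small against it. A, B and Q
   bound the errors due to the normal displacement, to the expansion of b
   and to the variation of grad rho; each is to cost at most S / 8 per unit of
   s, the second one twice. *)
pose A := \sum_i (`|g ord0 i| + 1) * `|c i|.
pose B := \sum_(i < N) (`|g ord0 i| + 1).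
pose Q := \sum_i `|a i|.
have A0 : 0 <= A by apply: sumr_ge0 => i _; rewrite mulr_ge0// addr_ge0.
have B0 : 0 <= B by apply: sumr_ge0 => i _; rewrite addr_ge0.
have Q0 : 0 <= Q by apply: sumr_ge0.
have frac (D : R) : 0 <= D -> 0 < S / (8 * (D + 1)).
  by move=> D0; rewrite divr_gt0// mulr_gt0// ltr_wpDl.
have fracE (D : R) : 0 <= D -> S / (8 * (D + 1)) * D <= S / 8.
  move=> D0; have D1 : 0 < D + 1 by rewrite ltr_wpDl.
  rewrite (_ : S / (8 * (D + 1)) * D = S / 8 * (D / (D + 1))); last by field; rewrite gt_eqF.
  rewrite ler_piMr//; first by rewrite divr_ge0// ltW.
  by rewrite ler_pdivrMr// mul1r lerDl.
pose kappa := Num.min 1 (S / (8 * (A + 1))).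
have k0 : 0 < kappa by rewrite lt_min ltr01 frac.
have kA : kappa * A <= S / 8.
  by apply: le_trans (fracE A A0); rewrite ler_wpM2r// ge_min lexx orbT.
have k1 : kappa <= 1 by rewrite ge_min lexx.
pose e := S / (8 * (B + 1)).
have e0 : 0 < e by exact: frac.
have eB : e * B <= S / 8 by exact: fracE.
pose e2 := Num.min 1 (S / (8 * (Q + 1))).
have e20 : 0 < e2 by rewrite lt_min ltr01 frac.
have e2Q : e2 * Q <= S / 8.
  by apply: le_trans (fracE Q Q0); rewrite ler_wpM2r// ge_min lexx orbT.
have e21 : e2 <= 1 by rewrite ge_min lexx.
have [d1 d10 d1H] := C1_expansion_family tau oO' Cb O'x e0.
have [d2 d20 d2H] := C1_expansion_family g oO' Cb O'x e0.
have cg i : {for x, continuous (fun y => grad rho y ord0 i)}.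
  rewrite (_ : (fun y => _) = partial i rho); last by apply/funext => y; rewrite mxE.
  exact: (Ck_cont (Ck_D _ Crho)).
have [d3 d30 d3H] := continuous_family cg e20.
have gg : 0 < dot g g by rewrite dot_gt0// g0.
have cgg : {for x, continuous (fun y => dot g (grad rho y))}.
  apply: (@Ck_cont _ _ 0 O) => //; apply: (Ck_sum (k := 0%N) _ oO) => i.
  apply: (CkM (k := 0%N) oO (Ck_cst 0 O (g ord0 i))).
  rewrite (_ : (fun y => _) = partial i rho); last by apply/funext => y; rewrite mxE.
  exact: (Ck_D _ Crho).
have [d4 d40 d4H] := continuous_dist cgg gg.
pose eta := Num.min (Num.min d1 d2) (Num.min d3 d4).
have eta0 : 0 < eta by rewrite !lt_min d10 d20 d30.
have tg : dot tau g = 0.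
  by rewrite -[RHS](tang x Ox rx); apply: eq_bigr => i _; rewrite (_ : tau ord0 i = b i x)// mxE.
have [s [r [/andP[s0 s_eta] [/andP[r0 rk] r_eta] sx yx [Oy ry]]]] :=
  boundary_crossing oW cW oO Crho g0 WE Ox rx tg k0 eta0.
pose y := (- r) *: g + (s *: tau + x).
rewrite -/g -/y in yx Oy ry.
move: s_eta r_eta sx yx; rewrite !lt_min => /andP[/andP[s1 s2] /andP[s3 s4]].
move=> /andP[/andP[r1 r2] _] /andP[/andP[sx1 sx2] _] /andP[/andP[y1 y2] /andP[y3 y4]].
have ggy : 0 < dot g (grad rho y).
  by have := d4H y y4; rewrite ltr_norml => /andP[+ _]; lra.
have cx : closure Omega x.
  by have /(boundary_rho oW oO Crho g0 WE Ox)[] := rx.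
have tgy : 0 <= dot tau (grad rho y).
  have := grad_supports oW cW oO Crho g0 WE Oy ry cx.
  rewrite (_ : x - y = r *: g - s *: tau); last first.
    by rewrite /y; apply/rowP => i; rewrite !mxE; ring.
  rewrite dotBr !dotZr [dot _ g]dotC [dot _ tau]dotC subr_le0 => H.
  have : 0 <= s * dot tau (grad rho y) by apply: le_trans H; rewrite mulr_ge0// ltW.
  by rewrite pmulr_rge0.
have : \sum_i grad rho y ord0 i * (b i y - b i x) <= 0.
  rewrite (_ : \sum_i _ = - dot tau (grad rho y)) ?oppr_le0//.
  rewrite (eq_bigr (fun i => b i y * grad rho y ord0 i - tau ord0 i * grad rho y ord0 i)).
    by rewrite sumrB tang// sub0r.
  by move=> i _; rewrite -mulrBl mulrC (_ : tau ord0 i = b i x)// mxE.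
apply/negP; rewrite -ltNge.
apply: lt_le_trans (_ : s * (S - e2 * Q - kappa * A - 2 * (e * B)) <= _).
  rewrite mulr_gt0//; lra.
rewrite /S /Q /A /B !mulr_sumr -!sumrB mulr_sumr; apply: ler_sum => i _.
have E1 : `|b i y - b i x - (s * a i - r * c i)| <= 2 * e * s.
  have H1 := d2H i (s *: tau + x) (- r) sx2; rewrite normrN ger0_norm// in H1.
  have {H1} := H1 r2; rewrite -/y -/(c i) => H1.
  have H2 := d1H i x s; rewrite subrr normr0 gtr0_norm// in H2.
  have {H2} := H2 d10 s1; rewrite -/(a i) => H2.
  have : e * r + e * s <= 2 * e * s.
    have : e * r <= e * s.
      rewrite ler_pM2l//; apply: le_trans rk _.
      by rewrite ler_piMl// ltW.
    lra.
  apply: le_trans; apply: le_trans (lerD H1 H2).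
  apply: le_trans (ler_normD _ _); rewrite le_eqVlt; apply/orP; left.
  by apply/eqP; congr (`|_|); ring.
have E2 := d3H i y y3.
have gE : grad rho x ord0 i = g ord0 i by [].
rewrite gE in E2; rewrite -/tau -/(a i) -/g.
move: (b i y - b i x) (grad rho y ord0 i) (g ord0 i) (a i) (c i) E1 E2 => D G g' a' c' E1 E2.
have G1 : `|G| <= `|g'| + 1.
  rewrite -(subrK g' G) (le_trans (ler_normD _ _))// addrC lerD2l.
  exact: le_trans (ltW E2) e21.
have T1 : - ((`|g'| + 1) * (2 * e * s)) <= G * (D - (s * a' - r * c')).
  rewrite lerNl -mulNr; apply: le_trans (ler_norm _) _.
  by rewrite normrM normrN ler_pM.
have T2 : - (e2 * `|a'|) <= (G - g') * a'.
  rewrite lerNl -mulNr; apply: le_trans (ler_norm _) _.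
  by rewrite normrM normrN ler_wpM2r// ltW.
have T3 : G * c' * r <= (`|g'| + 1) * `|c'| * (kappa * s).
  apply: le_trans (_ : `|G| * `|c'| * r <= _).
    by rewrite ler_wpM2r// -normrM ler_norm.
  by rewrite ler_pM// ?mulr_ge0// ler_wpM2r.
rewrite (_ : G * D = G * (D - (s * a' - r * c')) + s * (g' * a')
   + s * ((G - g') * a') - G * c' * r); last by ring.
have T2' : s * - (e2 * `|a'|) <= s * ((G - g') * a') by rewrite ler_pM2l.
apply: le_trans (_ : - ((`|g'| + 1) * (2 * e * s)) + s * (g' * a') + s * - (e2 * `|a'|) -
   (`|g'| + 1) * `|c'| * (kappa * s) <= _); last by rewrite lerB// lerD// lerD.
by rewrite le_eqVlt; apply/orP; left; apply/eqP; ring.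
Qed.

End curvature.

(** * The dissipation of the quasilinear operator *)

Section key_inequality.
#[local] Opaque Ck.
Context {R : realType} {N : nat}.
Local Notation leb := (@lebesgue_rV R N).
Implicit Types (x y z nu w : 'rV[R]_N) (Omega O : set 'rV[R]_N).

Definition sqgrad (v : 'rV[R]_N -> R) x : R := \sum_i partial i v x * partial i v x.

Definition divA (a : R -> R) (v : 'rV[R]_N -> R) x : R :=
  \sum_i partial i (fun y => a (sqgrad v y) * partial i v y) x.

Lemma sqgradE v x : dot (grad v x) (grad v x) = sqgrad v x.
Proof. by apply: eq_bigr => i _; rewrite mxE. Qed.

Lemma sqgrad_ge0 v x : 0 <= sqgrad v x.
Proof. by apply: sumr_ge0 => i _; rewrite -expr2 sqr_ge0. Qed.

Lemma sum_CS (f g : 'I_N -> R) :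
  (\sum_i f i * g i) ^+ 2 <= (\sum_i f i * f i) * (\sum_i g i * g i).
Proof.
have E (f' g' : 'I_N -> R) : dot (\row_i f' i) (\row_i g' i) = \sum_i f' i * g' i.
  by apply: eq_bigr => i _; rewrite !mxE.
by rewrite -!E dot_CS.
Qed.

(** Symmetry of the Hessian H collapses the double sums to |Hb|^2, (b . Hb)^2 and
    |H|^2, where h = Hb. *)
Lemma interior_sum_expand (b h : 'I_N -> R) (H : 'I_N -> 'I_N -> R) (a a' p p' : R) :
  (forall i k, H i k = H k i) -> (forall i, h i = \sum_l b l * H i l) ->
  \sum_i \sum_k (2 * p' * h i * b k + p * H i k) *
    (a * H k i + 2 * a' * h k * b i) =
  2 * p' * (a * \sum_i h i * h i + 2 * a' * (\sum_i b i * h i) ^+ 2) +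
  p * (a * \sum_i \sum_k H i k * H i k + 2 * a' * \sum_i h i * h i).
Proof.
move=> sym hE.
have E1 : \sum_i \sum_k h i * (b k * H k i) = \sum_i h i * h i.
  apply: eq_bigr => i _; rewrite -mulr_sumr hE; congr (_ * _).
  by apply: eq_bigr => k _; rewrite sym.
have E2 : \sum_i \sum_k (b i * h i) * (b k * h k) = (\sum_i b i * h i) ^+ 2.
  rewrite expr2 mulr_suml; apply: eq_bigr => i _.
  by rewrite mulr_sumr.
have E3 : \sum_i \sum_k H i k * (h k * b i) = \sum_i h i * h i.
  rewrite exchange_big; apply: eq_bigr => k _ /=.
  rewrite [X in _ * X]hE mulr_sumr; apply: eq_bigr => i _ /=; rewrite (sym i k); ring.
transitivity (2 * p' * a * (\sum_i \sum_k h i * (b k * H k i)) +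
    4 * p' * a' * (\sum_i \sum_k (b i * h i) * (b k * h k)) +
    p * a * (\sum_i \sum_k H i k * H i k) +
    2 * p * a' * (\sum_i \sum_k H i k * (h k * b i))); last first.
  by rewrite E1 E2 E3; ring.
rewrite !mulr_sumr -!big_split; apply: eq_bigr => i _ /=.
rewrite !mulr_sumr -!big_split; apply: eq_bigr => k _ /=.
rewrite (sym k i); ring.
Qed.

(** If a' < 0, the ellipticity a + 2 |b|^2 a' >= 0 still controls both forms,
    since (b . Hb)^2 <= |b|^2 |Hb|^2 and |Hb|^2 <= |b|^2 |H|^2. *)
Lemma interior_term_ge0 (b h : 'I_N -> R) (H : 'I_N -> 'I_N -> R) (a a' p p' : R) :
  (forall i k, H i k = H k i) -> (forall i, h i = \sum_l b l * H i l) ->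
  0 < a -> 0 <= p -> 0 <= p' -> 0 <= a + 2 * (\sum_i b i * b i) * a' ->
  0 <= \sum_i \sum_k (2 * p' * h i * b k + p * H i k) *
         (a * H k i + 2 * a' * h k * b i).
Proof.
move=> sym hE a0 p0 p'0; set s := \sum_i b i * b i => ell.
pose hh := \sum_i h i * h i; pose HH := \sum_i \sum_k H i k * H i k.
pose c := \sum_i b i * h i.
have s0 : 0 <= s by apply: sumr_ge0 => i _; rewrite -expr2 sqr_ge0.
have hh0 : 0 <= hh by apply: sumr_ge0 => i _; rewrite -expr2 sqr_ge0.
have cs1 : c ^+ 2 <= s * hh by exact: sum_CS.
have cs2 : hh <= s * HH.
  rewrite /hh /HH mulr_sumr; apply: ler_sum => i _.
  by rewrite -expr2 hE; exact: sum_CS.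
have HH0 : 0 <= HH by do 2 (apply: sumr_ge0 => ? _); rewrite -expr2 sqr_ge0.
rewrite [leRHS](interior_sum_expand a a' p p' sym hE) -/hh -/HH -/c.
have form q Q : 0 <= Q -> q <= s * Q -> 0 <= q -> 0 <= a * Q + 2 * a' * q.
  move=> Q0 qQ q0; have [a'0|a'0] := leP 0 a'.
    by rewrite addr_ge0// !mulr_ge0// ltW.
  have : 0 <= (a + 2 * s * a') * Q by rewrite mulr_ge0.
  nra.
rewrite addr_ge0// mulr_ge0//; [by rewrite mulr_ge0| |exact: form].
by apply: form => //; rewrite sqr_ge0.
Qed.

Lemma partialM O (f g : 'rV[R]_N -> R) i x : Ck 1 O f -> Ck 1 O g -> O x ->
  partial i (fun y => f y * g y) x = f x * partial i g x + g x * partial i f x.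
Proof.
move=> Cf Cg Ox; rewrite /partial [LHS]deriveM//.
  exact: (Ck_derivable Cf).
exact: (Ck_derivable Cg).
Qed.

Lemma partial_sum O (F : 'I_N -> 'rV[R]_N -> R) i x : (forall k, Ck 1 O (F k)) -> O x ->
  partial i (fun y => \sum_k F k y) x = \sum_k partial i (F k) x.
Proof.
move=> CF Ox.
by have [_] := is_derive_sum (index_enum 'I_N) (fun k => Ck1_is_derive (delta_mx ord0 i) (CF k) Ox).
Qed.

Variables (Omega O : set 'rV[R]_N) (v : 'rV[R]_N -> R) (a phi : R -> R) (J : set R).
Hypotheses (oW : open Omega) (bW : bounded_set Omega) (cW : convex_set Omega)
  (C1W : C1_domain Omega) (oO : open O) (WO : closure Omega `<=` O)
  (Cv : Ck 3 O v)
  (neumann : forall x n, boundary Omega x -> outward_unit_normal Omega x n -> 'D_n v x = 0)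
  (J0 : forall s, 0 <= s -> J s) (Ca : Ck 2 J a) (Cphi : Ck 1 J phi)
  (a0 : forall s, 0 <= s -> 0 < a s)
  (ell : forall s, 0 <= s -> 0 <= a s + 2 * s * derive1 a s)
  (phi0 : forall s, 0 <= s -> 0 <= phi s)
  (dphi0 : forall s, 0 <= s -> 0 <= derive1 phi s).

Let b i := partial i v.
Let A x := a (sqgrad v x).
Let P x := phi (sqgrad v x).
Let Y i x := A x * b i x.
(* Its divergence contains the integrand phi Dv . D(div (a Dv)); the rest is the
   nonnegative interior term. *)
Let X i x := P x * \sum_k b k x * partial k (Y i) x.

Let Cb i : Ck 2 O (b i). Proof. exact: (Ck_D _ Cv). Qed.

Let Csq : Ck 2 O (sqgrad v).
Proof. exact: (Ck_sum (index_enum 'I_N) oO (fun i => CkM oO (Cb i) (Cb i))). Qed.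

Let CA : Ck 2 O A.
Proof. by apply: (Ck_comp (A := J) oO) => // x _; exact/J0/sqgrad_ge0. Qed.

Let CP : Ck 1 O P.
Proof.
apply: (Ck_comp (A := J) oO) => //; last exact: Ck_S Csq.
by move=> x _; exact/J0/sqgrad_ge0.
Qed.

Let CY i : Ck 2 O (Y i). Proof. exact: (CkM oO CA (Cb i)). Qed.

Let CX i : Ck 1 O (X i).
Proof.
exact: (CkM oO CP (Ck_sum (index_enum 'I_N) oO (fun k =>
  CkM oO (Ck_S (Cb k)) (Ck_D (delta_mx ord0 k) (CY i))))).
Qed.

Let CL : Ck 1 O (divA a v).
Proof.
exact: (Ck_sum (index_enum 'I_N) oO (fun i => Ck_D (delta_mx ord0 i) (CY i))).
Qed.

Let symH x i k : O x -> partial i (b k) x = partial k (b i) x.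
Proof. by move=> Ox; apply: (derive_comm _ _ oO (Ck_S Cv) Ox). Qed.

Let dsq i x : O x -> partial i (sqgrad v) x = 2 * \sum_l b l x * partial i (b l) x.
Proof.
move=> Ox; pose C l := Ck_S (Cb l).
rewrite (partial_sum i (fun l => CkM oO (C l) (C l)) Ox).
rewrite mulr_sumr; apply: eq_bigr => l _.
rewrite (partialM i (C l) (C l) Ox); ring.
Qed.

Let d_comp (h : R -> R) i x : Ck 1 J h -> O x ->
  partial i (fun y => h (sqgrad v y)) x =
  derive1 h (sqgrad v x) * (2 * \sum_l b l x * partial i (b l) x).
Proof.
move=> Ch Ox; rewrite -dsq//.
have := is_derive_scomp (Ck1_is_derive (delta_mx ord0 i) (Ck_S Csq) Ox)
  (Ck1_is_derive (1 : R) Ch (J0 (sqgrad_ge0 v x))).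
by move=> [_ E]; rewrite /partial [LHS]E derive1E.
Qed.

Let dY i k x : O x -> partial k (Y i) x =
  A x * partial k (b i) x + 2 * derive1 a (sqgrad v x) *
     (\sum_l b l x * partial k (b l) x) * b i x.
Proof.
move=> Ox; rewrite (partialM k (Ck_S CA) (Ck_S (Cb i)) Ox).
rewrite (d_comp k (Ck_S Ca) Ox); ring.
Qed.

(** The diagonal of these derivatives sums to the operator in divergence form. *)
Lemma partial_flux i k x : O x ->
  partial k (fun y => a (sqgrad v y) * partial i v y) x =
  a (sqgrad v x) * partial k (partial i v) x + 2 * derive1 a (sqgrad v x) *
     (\sum_l partial l v x * partial k (partial l v) x) * partial i v x.
Proof. exact: dY. Qed.

Let dX x (h : 'I_N -> R) : O x ->
  (forall i, h i = \sum_l b l x * partial i (b l) x) ->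
  \sum_i partial i (X i) x =
  P x * \sum_k b k x * partial k (divA a v) x +
  \sum_i \sum_k (2 * derive1 phi (sqgrad v x) * h i * b k x + P x * partial i (b k) x) *
    (A x * partial k (b i) x + 2 * derive1 a (sqgrad v x) * h k * b i x).
Proof.
move=> Ox hE.
have -> : \sum_k b k x * partial k (divA a v) x =
    \sum_i \sum_k b k x * partial i (partial k (Y i)) x.
  rewrite exchange_big; apply: eq_bigr => k _ /=.
  rewrite (_ : divA a v = fun y => \sum_i partial i (Y i) y)//.
  rewrite (partial_sum k (fun i => Ck_D (delta_mx ord0 i) (CY i)) Ox).
  have swap i : partial k (partial i (Y i)) x = partial i (partial k (Y i)) x.
    exact: (derive_comm _ _ oO (CY i) Ox).
  rewrite mulr_sumr; apply: eq_bigr => i _.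
  by rewrite swap.
rewrite mulr_sumr -big_split; apply: eq_bigr => i _ /=.
have CdY k : Ck 1 O (partial k (Y i)) := Ck_D (delta_mx ord0 k) (CY i).
have CbY k : Ck 1 O (fun y => b k y * partial k (Y i) y) := CkM oO (Ck_S (Cb k)) (CdY k).
rewrite (partialM i CP (Ck_sum (index_enum 'I_N) oO CbY) Ox).
rewrite (partial_sum i CbY Ox).
have dP : partial i P x = derive1 phi (sqgrad v x) * (2 * h i).
  by rewrite hE; exact: d_comp.
rewrite dP mulr_suml !mulr_sumr -!big_split.
apply: eq_bigr => k _ /=.
have EY := dY i k Ox; rewrite -hE in EY.
rewrite (partialM i (Ck_S (Cb k)) (CdY k) Ox) EY.
move: (P x) (derive1 phi _) (derive1 a _) (A x) (h i) (h k) (b k x) (b i x)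
  (partial i (partial k (Y i)) x) (partial i (b k) x) (partial k (b i) x).
by move=> *; ring.
Qed.

Let hsupp y : boundary Omega y -> exists nu, supports Omega y nu.
Proof.
move=> By; have [U1 [rho [oU1 U1y Crho g0 WE]]] := C1W By.
have ry : rho y = 0 by apply/(boundary_rho oW oU1 Crho g0 WE U1y).
have gg : 0 < dot (grad rho y) (grad rho y) by rewrite dot_gt0// g0.
exists ((enorm (grad rho y))^-1 *: grad rho y); split.
  rewrite dotZl dotZr -enorm_sqr; have : 0 < enorm (grad rho y) by rewrite sqrtr_gt0.
  by move=> e0; field; rewrite gt_eqF.
move=> z Wz; rewrite dotZl mulr_ge0_le0// ?invr_ge0 ?enorm_ge0//.
by apply: (grad_supports oW cW oU1 Crho g0 WE) => //; exact: subset_closure.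
Qed.

Let supports_boundary x nu : closure Omega x -> supports Omega x nu -> boundary Omega x.
Proof.
move=> cx [nu1 H]; rewrite /boundary (interior_id Omega).1//; split => // Wx.
have [e e0 eW] := open_dist oW Wx.
have e20 : 0 < e / 2 by rewrite divr_gt0.
have W2 : Omega (x + (e / 2) *: nu).
  apply: eW; rewrite addrAC subrr add0r normrZ gtr0_norm//.
  rewrite (le_lt_trans (ler_piMr (ltW e20) (unit_norm_le nu1)))//.
  by rewrite ltr_pdivrMr// ltr_pMr// ltr1n.
have := H _ W2; rewrite addrAC subrr add0r dotZr nu1 mulr1; lra.
Qed.

(* The Neumann condition makes Dv tangent to the boundary, and then only the
   derivative of Dv along itself contributes to the normal component of X. *)
Let hX x nu : closure Omega x -> supports Omega x nu -> vdot X x nu <= 0.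
Proof.
move=> cx sx; have Bx := supports_boundary cx sx.
have [U1 [rho [oU1 U1x Crho g0 WE]]] := C1W Bx.
have rx : rho x = 0 by apply/(boundary_rho oW oU1 Crho g0 WE U1x).
have Ox := WO cx.
have tang y : U1 y -> rho y = 0 -> \sum_i b i y * grad rho y ord0 i = 0.
  move=> U1y ry; have By : boundary Omega y by apply/(boundary_rho oW oU1 Crho g0 WE U1y).
  have Oy : O y by apply: WO; case: By.
  have := @neumann y ((enorm (grad rho y))^-1 *: grad rho y) By.
  have out : outward_unit_normal Omega y ((enorm (grad rho y))^-1 *: grad rho y).
    by exists U1, rho.
  move=> /(_ out).
  rewrite (derive_grad _ oO (Ck_le _ Cv) Oy)// dotZl => /eqP.
  rewrite mulf_eq0 invr_eq0 gt_eqF/=; last by rewrite sqrtr_gt0 dot_gt0// g0.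
  move=> /eqP Ev; rewrite -[RHS]Ev; apply: eq_bigr => i _.
  by rewrite mulrC; congr (_ * _); rewrite mxE.
have main := tangent_derive_le0 oW cW oU1 Crho g0 WE oO (fun i => Ck_S (Cb i)) tang U1x Ox rx.
have E : nu = (enorm (grad rho x))^-1 *: grad rho x := supports_grad oU1 Crho g0 WE U1x rx sx.
pose k := (enorm (grad rho x))^-1.
have k0 : 0 <= k by rewrite invr_ge0 enorm_ge0.
pose d i := 'D_(\row_j b j x) (b i) x.
have dE i : d i = \sum_l b l x * partial l (b i) x.
  rewrite /d (derive_grad _ oO (Ck_S (Cb i)) Ox); apply: eq_bigr => l _.
  by rewrite !mxE.
pose S := \sum_l b l x * (2 * derive1 a (sqgrad v x) * \sum_m b m x * partial l (b m) x).
have XE i : X i x = P x * (A x * d i + S * b i x).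
  congr (P x * _); rewrite dE /S mulr_sumr mulr_suml -big_split; apply: eq_bigr => l _ /=.
  by rewrite (dY i l Ox) mulrDr; congr (_ + _); [rewrite mulrCA | rewrite mulrA].
have -> : vdot X x nu = P x * A x * k * (\sum_i grad rho x ord0 i * d i)
   + P x * k * S * (\sum_i b i x * grad rho x ord0 i).
  have nuE i : nu ord0 i = k * grad rho x ord0 i by rewrite E mxE.
  rewrite /vdot (eq_bigr _ (fun i _ => congr2 *%R (XE i) (nuE i))).
  have alg (p al S' k' : R) (g d' b' : 'I_N -> R) :
      \sum_i p * (al * d' i + S' * b' i) * (k' * g i) =
      p * al * k' * (\sum_i g i * d' i) + p * k' * S' * (\sum_i b' i * g i).
    by rewrite !mulr_sumr -big_split; apply: eq_bigr => i _ /=; ring.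
  exact: alg.
rewrite tang// mulr0 addr0 mulr_ge0_le0// !mulr_ge0//.
  exact/phi0/sqgrad_ge0.
exact/ltW/a0/sqgrad_ge0.
Qed.

(** The field phi * (Dv . D)(a Dv) does not point outwards by convexity of Omega,
    and its divergence exceeds phi * Dv . D(div (a Dv)) by the interior term. *)
Lemma Rintegral_dissipation_le0 :
  \int[leb]_(x in Omega) (phi (sqgrad v x) *
     \sum_k partial k v x * partial k (divA a v) x) <= 0.
Proof.
apply: le_trans (Rintegral_div_le0 oW bW oO WO CX hsupp hX).
apply: le_Rintegral.
- exact: open_measurable_rV.
- apply: (integrable_near_closure oW bW WO); apply: (@Ck_cont _ _ 0).
  apply: (CkM oO (Ck_S CP)); apply: (Ck_sum _ oO) => k.
  exact: (CkM oO (Ck_le (leq0n 2) (Cb k)) (Ck_D _ CL)).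
- apply: (integrable_near_closure oW bW WO); apply: (@Ck_cont _ _ 0).
  by apply: (Ck_sum _ oO) => i; exact: (Ck_D _ (CX i)).
move=> x Wx; have Ox : O x by exact/WO/subset_closure.
rewrite (dX Ox (fun i => erefl)) lerDl.
apply: (interior_term_ge0 (H := fun i k => partial i (b k) x)).
- by move=> i k; exact: symH.
- by [].
- exact/a0/sqgrad_ge0.
- exact/phi0/sqgrad_ge0.
- exact/dphi0/sqgrad_ge0.
- exact/ell/sqgrad_ge0.
Qed.

End key_inequality.

(** * Functions on the space-time cylinder *)

Section slab.
Context {R : realType} {N : nat}.
Local Notation leb := (@lebesgue_rV R N).
Local Notation lam := (@lebesgue_measure R).
Implicit Types (Omega : set 'rV[R]_N) (O : set (R * 'rV[R]_N)).

Lemma continuous_measurable_prod O (G : R * 'rV[R]_N -> R) :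
  open O -> (forall z, O z -> {for z, continuous G}) ->
  measurable_fun (O : set (measurableTypeR R * 'rV[R]_N)) G.
Proof.
move=> oO cG; apply: (measurability _ (RGenOpens.measurableE R)) => _ [_ [a [b ->]] <-].
apply: open_measurable_prod.
rewrite openE => x [Dx Fx].
rewrite /interior; apply: filterI; first exact: open_nbhs_nbhs.
apply: cG => //.
exact: (open_nbhs_nbhs (conj (interval_open _ _) Fx)).
Qed.

Definition slab (t : R) Omega : set (measurableTypeR R * 'rV[R]_N) :=
  (`]0, t[%classic : set R) `*` Omega.

Definition around (T : R) Omega O :=
  forall (t : R) x, 0 <= t <= T -> closure Omega x -> O (t, x).

Variables (T : R) (Omega : set 'rV[R]_N) (O : set (R * 'rV[R]_N)).
Hypotheses (oW : open Omega) (bW : bounded_set Omega) (oO : open O)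
  (WO : around T Omega O).

Lemma open_slab (t : R) : open (slab t Omega : set (R * 'rV[R]_N)).
Proof.
apply: openI.
  by apply: open_comp => // p _; exact: cvg_fst.
by apply: open_comp => // p _; exact: cvg_snd.
Qed.

Lemma bounded_around (G : R * 'rV[R]_N -> R) : (forall z, O z -> {for z, continuous G}) ->
  exists2 M : R, 0 < M & forall (t : R) x, 0 <= t <= T -> closure Omega x -> `|G (t, x)| <= M.
Proof.
move=> cG.
have cK := compact_setX (@segment_compact R 0 T) (bounded_closure bW).
have [|M M0 HM] := compact_bounded_fun cK (F := G).
  by move=> [t x] [/= tT xW]; apply: cG; apply: WO => //; move: tT; rewrite in_itv.
by exists M => // t x tT xW; apply: HM; split => //=; rewrite in_itv.
Qed.

Lemma measurable_slab (t : R) (G : R * 'rV[R]_N -> R) : t <= T ->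
  (forall z, O z -> {for z, continuous G}) -> measurable_fun (slab t Omega) G.
Proof.
move=> tT cG; apply: continuous_measurable_prod; first exact: open_slab.
move=> [s x] [/= /[!in_itv]/= /andP[s0 st] Wx]; apply/cG/WO; last exact: subset_closure.
by rewrite ltW//= ltW// (lt_le_trans st).
Qed.

Lemma integrable_slab (t : R) (G : R * 'rV[R]_N -> R) : t <= T ->
  (forall z, O z -> {for z, continuous G}) ->
  (lam \x leb)%E.-integrable (slab t Omega) (EFin \o G).
Proof.
move=> tT cG.
apply: measurable_bounded_integrable.
- by apply: measurableX => //; exact: open_measurable_rV.
- have fin : ((lam \x leb) ((`]0%R, t[%classic : set R) `*` Omega) < +oo)%E.
    rewrite product_measure1E//; last exact: open_measurable_rV.
    rewrite lte_mul_pinfty//.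
      by rewrite /= lebesgue_measure_itv; case: ifP => _ //=; rewrite -EFinB.
    exact: (lebesgue_rV_bounded (open_measurable_rV oW) bW).
  exact: fin.
- exact: measurable_slab.
have [M M0 HM] := bounded_around cG.
exists M; split; first exact: num_real.
move=> M' MM' [s x] [/= /[!in_itv]/= /andP[s0 st] Wx]; apply: le_trans (ltW MM').
apply: HM; last exact: subset_closure.
by rewrite ltW//= ltW// (lt_le_trans st).
Qed.

Lemma restrict_slab (t s : R) x (G : R * 'rV[R]_N -> R) :
  ((EFin \o G) \_ (slab t Omega)) (s, x) =
  if (0 < s < t) && (x \in Omega) then (G (s, x))%:E else 0%E.
Proof.
rewrite patchE; congr (if _ then _ else _).
apply/idP/andP => [|[st]]; rewrite !inE.
  by move=> [/= /[!in_itv]/= ? ?].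
by move=> Wx; split => //=; rewrite in_itv.
Qed.

(** Fubini's theorem: on the left the time integral is innermost, so that it can
    be evaluated when H is a time derivative, while the comparison is made for
    space integrals at fixed times. *)
Lemma slab_le (t : R) (H G : R * 'rV[R]_N -> R) : t <= T ->
  (forall z, O z -> {for z, continuous H}) ->
  (forall z, O z -> {for z, continuous G}) ->
  (forall s, 0 < s < t ->
     (\int[leb]_(x in Omega) (H (s, x))%:E <= \int[leb]_(x in Omega) (G (s, x))%:E)%E) ->
  (\int[leb]_(x in Omega) (\int[lam]_(s in `]0%R, t[) (H (s, x))%:E) <=
   \int[lam \x leb]_(z in slab t Omega) (G z)%:E)%E.
Proof.
move=> tT cH cG HG.
have mS : measurable (slab t Omega).
  by apply: measurableX => //; exact: open_measurable_rV.
have iH : (lam \x leb)%E.-integrable setT ((EFin \o H) \_ (slab t Omega)).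
  by apply/(integrable_mkcond _ mS); exact: (integrable_slab tT cH).
have iG : (lam \x leb)%E.-integrable setT ((EFin \o G) \_ (slab t Omega)).
  by apply/(integrable_mkcond _ mS); exact: (integrable_slab tT cG).
have -> : (\int[leb]_(x in Omega) (\int[lam]_(s in `]0%R, t[) (H (s, x))%:E))%E =
  (\int[leb]_x \int[lam]_s ((EFin \o H) \_ (slab t Omega)) (s, x))%E.
  rewrite integral_mkcond; apply: eq_integral => x _; rewrite patchE.
  case: ifP => xW.
    rewrite integral_mkcond; apply: eq_integral => s _.
    by rewrite restrict_slab xW andbT patchE mem_setE in_itv.
  by rewrite integral0_eq// => s _; rewrite restrict_slab xW andbF.
rewrite -(Fubini iH) [leRHS]integral_mkcond -(integral12_prod_meas1 iG).
apply: le_integral => //; [exact: integrable_fubini_F|exact: integrable_fubini_F|].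
move=> s _.
have E (K : R * 'rV[R]_N -> R) : (\int[leb]_y ((EFin \o K) \_ (slab t Omega)) (s, y) =
   if (0 < s < t)%R then \int[leb]_(x in Omega) (K (s, x))%:E else 0)%E.
  case: ifP => st.
    rewrite [RHS]integral_mkcond; apply: eq_integral => x _.
    by rewrite restrict_slab st patchE.
  by rewrite integral0_eq// => x _; rewrite restrict_slab st.
by rewrite /fubini_F !E; case: ifP => // /HG.
Qed.

End slab.

Section slices.
Context {R : realType} {N : nat}.
Implicit Types (O : set (R * 'rV[R]_N)) (G : R * 'rV[R]_N -> R).

Definition dspace (i : 'I_N) G : R * 'rV[R]_N -> R := 'D_((0 : R), delta_mx ord0 i : 'rV[R]_N) G.
Definition dtime G : R * 'rV[R]_N -> R := 'D_((1 : R), 0 : 'rV[R]_N) G.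

Lemma growth_slice G (t : R) (x v : 'rV[R]_N) :
  (fun h : R => h^-1 *: (G (t, h *: v + x) - G (t, x))) =
  (fun h : R => h^-1 *: (G (h *: ((0 : R), v) + (t, x)) - G (t, x))).
Proof.
apply/funext => h; congr (_ *: (G _ - _)).
by apply/pair_equal_spec; split => //=; rewrite [_ *: _]mulr0 add0r.
Qed.

Lemma derive_slice G (t : R) (v : 'rV[R]_N) :
  'D_v (fun x => G (t, x)) = fun x => 'D_((0 : R), v) G (t, x).
Proof. by apply/funext => x; rewrite /derive /= growth_slice. Qed.

Lemma derivable_slice G (t : R) (x v : 'rV[R]_N) :
  derivable (fun x => G (t, x)) x v = derivable G (t, x) ((0 : R), v).
Proof. by rewrite /derivable /= growth_slice. Qed.

Lemma growth_time G (t : R) (x : 'rV[R]_N) :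
  (fun h : R => h^-1 *: (G (h *: (1 : R) + t, x) - G (t, x))) =
  (fun h : R => h^-1 *: (G (h *: ((1 : R), 0 : 'rV[R]_N) + (t, x)) - G (t, x))).
Proof.
apply/funext => h; congr (_ *: (G _ - _)).
by apply/pair_equal_spec; split => //=; rewrite scaler0 add0r.
Qed.

Lemma derive_time G (t : R) (x : 'rV[R]_N) :
  'D_1 (fun s : R => G (s, x)) t = dtime G (t, x).
Proof. by rewrite /dtime /derive /= growth_time. Qed.

Lemma derivable_time G (t : R) (x : 'rV[R]_N) :
  derivable (fun s : R => G (s, x)) t 1 = derivable G (t, x) ((1 : R), 0 : 'rV[R]_N).
Proof. by rewrite /derivable /= growth_time. Qed.

Lemma continuous_pairl (t : R) : continuous (fun x : 'rV[R]_N => (t, x)).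
Proof.
move=> x; apply: (@cvg_pair _ _ _ (nbhs x) (nbhs t) (nbhs x)).
  exact: cvg_cst.
exact: cvg_id.
Qed.

Lemma open_slice O (t : R) : open O -> open [set x | O (t, x)].
Proof.
move=> oO; rewrite (_ : [set x | O (t, x)] = (fun x => (t, x)) @^-1` O)//.
apply: open_comp => // x _; exact: continuous_pairl.
Qed.

Lemma Ck_slice k O G (t : R) : Ck k O G -> Ck k [set x | O (t, x)] (fun x => G (t, x)).
Proof.
elim: k G => [|k IH] G.
  move=> cG x Ox; apply: (@continuous_comp _ _ _ (fun x => (t, x)) G); last exact: cG.
  exact: continuous_pairl.
move=> [cG H]; split.
  move=> x Ox; apply: (@continuous_comp _ _ _ (fun x => (t, x)) G); last exact: cG.
  exact: continuous_pairl.
move=> v; have [dG CG] := H ((0 : R), v); split.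
  by move=> x Ox; rewrite derivable_slice; exact: (dG (t, x) Ox).
by rewrite derive_slice; exact: (IH _ CG).
Qed.

End slices.

Section powers.
Context {R : realType}.

Lemma Ck_shift k (A : set R) (c : R) : open A -> Ck k A (fun s => s + c).
Proof.
move=> oA; have idC l : Ck l A (@id R).
  case: l => [|l]; first by move=> x _.
  split; first by move=> x _.
  move=> v; split; first by move=> x _; exact: derivable_id.
  rewrite (_ : 'D_v id = cst v); first exact: Ck_cst.
  by apply/funext => x; rewrite derive_id.
exact: (CkD oA (idC k) (Ck_cst k A c)).
Qed.

Lemma is_derive_powR_shift (q kappa s : R) : - kappa < s ->
  is_derive s 1 (fun s => (s + kappa) `^ q) (q * (s + kappa) `^ (q - 1)).
Proof.
move=> ks; have s0 : 0 < s + kappa by rewrite -ltrBlDr sub0r.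
have lin : is_derive s (1 : R) (fun s : R => s + kappa) 1.
  apply: is_derive_expansion => e e0; exists 1 => // h _.
  rewrite -[h *: 1]/(h * 1) (_ : _ - _ = 0); last by ring.
  by rewrite normr0 mulr_ge0// ltW.
have := is_derive_scomp lin (is_derive1_powR q s0).
by rewrite mulr1.
Qed.

Lemma Ck_powR_shift k (q kappa : R) :
  Ck k [set s : R | - kappa < s] (fun s => (s + kappa) `^ q).
Proof.
have oA : open [set s : R | - kappa < s] by exact: open_gt.
have cp (r s : R) : - kappa < s -> {for s, continuous (fun s => (s + kappa) `^ r)}.
  move=> ks; apply/differentiable_continuous/derivable1_diffP.
  by case: (is_derive_powR_shift r ks).
elim: k q => [|k IH] q; first by move=> s; exact: cp.
split; first by move=> s; exact: cp.
move=> v.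
have d (s : R) : - kappa < s ->
    is_derive s v (fun s => (s + kappa) `^ q) (v * q * (s + kappa) `^ (q - 1)).
  move=> ks.
  have idv : is_derive s v (@id R) v by exact: is_derive_id.
  have := is_derive_scomp idv (is_derive_powR_shift q ks).
  rewrite (_ : q * (s + kappa) `^ (q - 1) * v = v * q * (s + kappa) `^ (q - 1))//; ring.
split; first by move=> s /d[].
apply: (Ck_congr oA _ (CkM oA (Ck_cst k _ (v * q)) (IH (q - 1)))) => s /d[_ ->].
by [].
Qed.

(** Only the origin needs an argument: elsewhere a power is differentiable. *)
Lemma continuous_powR_comp (V : topologicalType) (f : V -> R) (q : R) z : 0 < q ->
  (forall y, 0 <= f y) -> {for z, continuous f} ->
  {for z, continuous (fun y => f y `^ q)}.
Proof.
move=> q0 f0 cf; have := f0 z; rewrite le_eqVlt => /orP[/eqP fz|fz]; last first.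
  apply: (@continuous_comp _ _ _ f (fun a => a `^ q)) => //.
  apply/differentiable_continuous/derivable1_diffP.
  by case: (is_derive1_powR q fz).
apply/cvgrPdist_lt => e e0 /=.
rewrite -fz powR0 ?gt_eqF//.
have : \forall y \near z, f y < e `^ q^-1.
  by apply: (cvgr_lt _ cf); rewrite -fz powR_gt0.
apply: filterS => y fy; rewrite sub0r normrN ger0_norm ?powR_ge0//.
have -> : e = (e `^ q^-1) `^ q by rewrite -powRrM mulVf ?gt_eqF// powRr1// ltW.
by apply: gt0_ltr_powR => //; rewrite nnegrE ?powR_ge0.
Qed.

(** Young's inequality with exponents m / (m - 1) and m, applied to
    w ^ (m - 1) and g. *)
Lemma young_powR (m w g : R) : 1 < m -> 0 <= w -> 0 <= g ->
  m * (w `^ (m - 1) * g) <= (m - 1) * w `^ m + g `^ m.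
Proof.
move=> m1 w0 g0.
have m0 : 0 < m by rewrite (lt_trans ltr01).
have m10 : 0 < m - 1 by rewrite subr_gt0.
have nz : m != 0 /\ m - 1 != 0 by rewrite !gt_eqF.
have [mn mn1] := nz.
have E1 : (m - 1) * (m / (m - 1)) = m by field.
have E2 : (m / (m - 1))^-1 + m^-1 = 1 by field; rewrite mn mn1.
have := @conjugate_powR R (w `^ (m - 1)) g (m / (m - 1)) m (powR_ge0 _ _) g0
  (divr_gt0 m0 m10) m0 E2.
rewrite -powRrM E1 -(ler_pM2l m0) => /le_trans; apply.
by rewrite le_eqVlt; apply/orP; left; apply/eqP; field; rewrite mn mn1.
Qed.

End powers.

(** * The energy inequality *)

Section energy.
#[local] Opaque Ck.
Context {R : realType} {N : nat}.
Local Notation leb := (@lebesgue_rV R N).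
Local Notation lam := (@lebesgue_measure R).
Implicit Types (Omega : set 'rV[R]_N) (O : set (R * 'rV[R]_N)) (U : R * 'rV[R]_N -> R).

Definition sqspace U z : R := \sum_i dspace i U z * dspace i U z.

Definition divspace (a : R -> R) U z : R :=
  \sum_i dspace i (fun y => a (sqspace U y) * dspace i U y) z.

Lemma partial_slice U (t : R) i : partial i (fun x => U (t, x)) = fun x => dspace i U (t, x).
Proof. exact: derive_slice. Qed.

Lemma sqgrad_slice U (t : R) x : sqgrad (fun y => U (t, y)) x = sqspace U (t, x).
Proof. by apply: eq_bigr => i _; rewrite partial_slice. Qed.

Lemma divA_slice a U (t : R) : divA a (fun y => U (t, y)) = fun x => divspace a U (t, x).
Proof.
apply/funext => x; apply: eq_bigr => i _.
transitivity (partial i (fun y => a (sqspace U (t, y)) * dspace i U (t, y)) x); last first.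
  by rewrite (partial_slice (fun z => a (sqspace U z) * dspace i U z)).
congr (partial i _ x); apply/funext => y.
by rewrite sqgrad_slice partial_slice.
Qed.

Lemma sqspace_ge0 U z : 0 <= sqspace U z.
Proof. by apply: sumr_ge0 => i _; rewrite -expr2 sqr_ge0. Qed.

Variables (T : R) (Omega : set 'rV[R]_N) (O : set (R * 'rV[R]_N)) (U : R * 'rV[R]_N -> R)
  (a : R -> R) (eps : R).
Hypotheses (oW : open Omega) (bW : bounded_set Omega) (cW : convex_set Omega)
  (C1W : C1_domain Omega) (oO : open O) (WO : around T Omega O) (CU : Ck 4 O U)
  (neumann : forall t x n, 0 < t < T -> boundary Omega x ->
     outward_unit_normal Omega x n -> 'D_n (fun y => U (t, y)) x = 0)
  (eps0 : 0 < eps) (Ca : Ck 2 [set s : R | - eps < s] a)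
  (a0 : forall s, 0 <= s -> 0 < a s)
  (ell : forall s, 0 <= s -> 0 <= a s + 2 * s * derive1 a s).

(** The right-hand side that the equation prescribes for U. Unlike the given
    right-hand side it makes sense, and is C^1, up to the boundary of the
    cylinder. *)
Definition source z : R := dtime U z - divspace a U z.

Let Cb i : Ck 3 O (dspace i U) := Ck_D ((0 : R), delta_mx ord0 i : 'rV[R]_N) CU.

Let Csq : Ck 3 O (sqspace U) := Ck_sum (index_enum 'I_N) oO (fun i => CkM oO (Cb i) (Cb i)).

Let oJ (e : R) : open [set s : R | - e < s]. Proof. exact: open_gt. Qed.

Let sqJ (e : R) z : 0 < e -> - e < sqspace U z.
Proof. by move=> e0; apply: lt_le_trans (sqspace_ge0 U z); rewrite oppr_lt0. Qed.

Let CL : Ck 1 O (divspace a U).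
Proof.
have Casq : Ck 2 O (fun y => a (sqspace U y)).
  by apply: (Ck_comp (A := [set s : R | - eps < s]) oO _ Ca (Ck_S Csq)) => z _; exact: sqJ.
exact: (Ck_sum (index_enum 'I_N) oO (fun i =>
  Ck_D ((0 : R), delta_mx ord0 i : 'rV[R]_N) (CkM oO Casq (Ck_S (Cb i))))).
Qed.

Lemma Ck1_source : Ck 1 O source.
Proof. exact: (CkB oO (Ck_le (isT : (1 <= 3)%N) (Ck_D ((1 : R), 0 : 'rV[R]_N) CU)) CL). Qed.

Section fixed_exponent.
Variables (m kappa : R).
Hypotheses (m2 : 2 < m) (kappa0 : 0 < kappa).

(** The power of the gradient norm, regularised by kappa so that it is twice
    differentiable where the gradient vanishes. *)
Definition density z : R := (sqspace U z + kappa) `^ (m / 2).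
Definition source_density z : R := sqspace source z `^ (m / 2).

(* Twice the derivative of the power in the density. *)
Let phi s : R := m * (s + kappa) `^ (m / 2 - 1).

Let m0 : 0 < m. Proof. by rewrite (lt_trans _ m2). Qed.

Let Cdensity : Ck 2 O density.
Proof.
apply: (Ck_comp (A := [set s : R | - kappa < s]) oO _ (Ck_powR_shift 2 (m / 2) kappa) (Ck_S Csq)).
by move=> z _; exact: sqJ.
Qed.

Let dissipation t : 0 < t < T ->
  \int[leb]_(x in Omega) (phi (sqspace U (t, x)) *
    \sum_k dspace k U (t, x) * dspace k (divspace a U) (t, x)) <= 0.
Proof.
move=> /andP[t0 tT]; pose v x := U (t, x).
(* Both the coefficient and phi are regular on J. *)
pose J := [set s : R | - Num.min eps kappa < s].
have Jeps : J `<=` [set s : R | - eps < s].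
  by move=> s /=; apply: le_lt_trans; rewrite lerN2 ge_min lexx.
have Jkappa : J `<=` [set s : R | - kappa < s].
  by move=> s /=; apply: le_lt_trans; rewrite lerN2 ge_min lexx orbT.
have J0 s : 0 <= s -> J s.
  by apply: lt_le_trans; rewrite oppr_lt0 lt_min eps0.
have Cphi : Ck 1 J phi.
  have oJ' : open J by exact: oJ.
  exact: (CkM oJ' (Ck_cst 1 J m) (Ck_sub Jkappa (Ck_powR_shift 1 (m / 2 - 1) kappa))).
have WOt : closure Omega `<=` [set x | O (t, x)].
  by move=> x cx; apply: WO => //; rewrite !ltW.
have H := @Rintegral_dissipation_le0 R N Omega [set x | O (t, x)] v a phi J
  oW bW cW C1W (@open_slice R N O t oO) WOt (@Ck_slice R N 3 O U t (Ck_S CU)).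
have E x : phi (sqgrad v x) * (\sum_k partial k v x * partial k (divA a v) x) =
    phi (sqspace U (t, x)) * \sum_k dspace k U (t, x) * dspace k (divspace a U) (t, x).
  have P1 k : partial k v x = dspace k U (t, x) := congr1 (fun f => f x) (partial_slice U t k).
  have P2 k : partial k (divA a v) x = dspace k (divspace a U) (t, x).
    by rewrite divA_slice; exact: (congr1 (fun f => f x) (partial_slice (divspace a U) t k)).
  have P0 : sqgrad v x = sqspace U (t, x) := sqgrad_slice U t x.
  have PS : \sum_k partial k v x * partial k (divA a v) x =
      \sum_k dspace k U (t, x) * dspace k (divspace a U) (t, x).
    by apply: eq_bigr => k _; exact: (congr2 *%R (P1 k) (P2 k)).
  exact: (congr2 (fun p q => phi p * q) P0 PS).
rewrite [leLHS](_ : _ = \int[leb]_(x in Omega) (phi (sqgrad v x) *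
    \sum_k partial k v x * partial k (divA a v) x)); last first.
  by apply: eq_Rintegral => x _; exact/esym/E.
apply: H => //.
- by move=> x n; apply: neumann; rewrite t0.
- exact: Ck_sub Jeps Ca.
- by move=> s s0; rewrite /phi mulr_ge0 ?powR_ge0// ltW.
- move=> s s0; have ks : - kappa < s by apply: lt_le_trans s0; rewrite oppr_lt0.
  have c : is_derive s (1 : R) (cst m) 0 by exact: is_derive_cst.
  rewrite derive1E; have [_ ->] := is_deriveM c (is_derive_powR_shift (m / 2 - 1) ks).
  rewrite scaler0 addr0 mulr_ge0//; first exact: ltW.
  by rewrite mulr_ge0 ?powR_ge0// subr_ge0 ler_pdivlMr// mul1r ltW.
Qed.

Let dtime_density z : O z -> dtime density z =
  phi (sqspace U z) * \sum_i dspace i U z * (dspace i source z + dspace i (divspace a U) z).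
Proof.
move=> Oz; pose w := ((1 : R), 0 : 'rV[R]_N).
have dsq : is_derive z w (sqspace U)
    (\sum_i (dspace i U z * dtime (dspace i U) z + dspace i U z * dtime (dspace i U) z)).
  apply: is_derive_sum => i.
  have d := Ck1_is_derive w (Cb i) Oz.
  exact: is_deriveM.
have := is_derive_scomp dsq (is_derive_powR_shift (m / 2) (sqJ z kappa0)).
move=> [_ E]; rewrite /dtime [LHS]E /phi.
have swap i : dtime (dspace i U) z = dspace i source z + dspace i (divspace a U) z.
  have -> : dtime (dspace i U) z = dspace i (dtime U) z.
    exact: (derive_comm _ _ oO (Ck_le (isT : (2 <= 4)%N) CU) Oz).
  have CUt : Ck 1 O (dtime U) := Ck_le (isT : (1 <= 3)%N) (Ck_D w CU).
  rewrite /dspace [X in _ = X + _]deriveB.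
  - by rewrite subrK.
  - exact: (Ck_derivable CUt).
  - exact: (Ck_derivable CL).
rewrite (eq_bigr (fun i => 2 * (dspace i U z * (dspace i source z + dspace i (divspace a U) z)))).
  by rewrite -mulr_sumr; field.
by move=> i _; rewrite swap; ring.
Qed.

Let source_le z : phi (sqspace U z) * (\sum_i dspace i U z * dspace i source z) <=
  (m - 1) * density z + source_density z.
Proof.
have s0 := sqspace_ge0 U z; have d0 := sqspace_ge0 source z.
have sk : 0 < sqspace U z + kappa by rewrite ltr_wpDl.
pose w := (sqspace U z + kappa) `^ (2^-1); pose g := sqspace source z `^ (2^-1).
have m1 : 1 < m by rewrite (lt_trans _ m2)// ltr1n.
have := @young_powR R m w g m1 (powR_ge0 _ _) (powR_ge0 _ _).
rewrite -!powRrM ![2^-1 * _]mulrC -/(density z) -/(source_density z).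
apply: le_trans; rewrite /phi -mulrA ler_pM2l//.
have -> : (sqspace U z + kappa) `^ ((m - 1) / 2) = (sqspace U z + kappa) `^ (m / 2 - 1) * w.
  rewrite /w -powRD; last by rewrite (gt_eqF sk) implybT.
  by congr (_ `^ _); field.
rewrite -mulrA ler_wpM2l ?powR_ge0//.
have CS := sum_CS (fun i => dspace i U z) (fun i => dspace i source z).
rewrite (le_trans (ler_norm _))// -(@ler_sqr R) ?nnegrE ?mulr_ge0 ?powR_ge0//.
rewrite real_normK ?num_real// exprMn.
have sq (y : R) : 0 <= y -> (y `^ 2^-1) ^+ 2 = y.
  by move=> y0; rewrite powR12_sqrt// sqr_sqrtr.
rewrite /w /g !sq//; last exact: ltW.
by apply: le_trans CS _; rewrite ler_wpM2r// lerDl ltW.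
Qed.

(* The time derivative of exp (- (m - 1) t) times the density. *)
Let rate z : R := expR (- (m - 1) * z.1) * (dtime density z - (m - 1) * density z).

Let csource_density z : O z -> {for z, continuous source_density}.
Proof.
move=> Oz; apply: continuous_powR_comp.
- by rewrite divr_gt0.
- exact: sqspace_ge0.
apply: (@Ck_cont _ _ 0 O) => //.
exact: (Ck_sum (index_enum 'I_N) oO (fun i => CkM oO
  (Ck_D ((0 : R), delta_mx ord0 i : 'rV[R]_N) Ck1_source)
  (Ck_D ((0 : R), delta_mx ord0 i : 'rV[R]_N) Ck1_source))).
Qed.

Let crate z : O z -> {for z, continuous rate}.
Proof.
move=> Oz; apply: continuousM.
  apply: (@continuous_comp _ _ _ (fun z : R * 'rV[R]_N => - (m - 1) * z.1) (@expR R)).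
    by apply: continuousM; [exact: cst_continuous|exact: cvg_fst].
  exact: continuous_expR.
apply: (@Ck_cont _ _ 0 O) => //.
exact: (CkB oO (Ck_le (leq0n 1) (Ck_D ((1 : R), 0 : 'rV[R]_N) Cdensity))
  (CkM oO (Ck_cst 0 O (m - 1)) (Ck_le (leq0n 2) Cdensity))).
Qed.

Let rate_FTC t x : 0 < t <= T -> Omega x ->
  (\int[lam]_(s in `]0%R, t[) (rate (s, x))%:E =
   (expR (- (m - 1) * t) * density (t, x) - density (0%R, x))%:E)%E.
Proof.
move=> /andP[t0 tT] Wx; pose F s := expR (- (m - 1) * s) * density (s, x).
have Osx s : 0 <= s <= t -> O (s, x).
  move=> /andP[s0 st]; apply: WO; last exact: subset_closure.
  by rewrite s0 (le_trans st).
have dF s : 0 <= s <= t -> is_derive s (1 : R) F (rate (s, x)).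
  move=> st; have Oz := Osx s st.
  have dd : is_derive s (1 : R) (fun s => density (s, x)) (dtime density (s, x)).
    split; last exact: derive_time.
    by rewrite derivable_time; exact: (Ck_derivable Cdensity).
  have lin : is_derive s (1 : R) (fun s : R => - (m - 1) * s) (- (m - 1)).
    apply: is_derive_expansion => e e0; exists 1 => // h _.
    rewrite -[h *: 1]/(h * 1) (_ : _ - _ = 0); last by ring.
    by rewrite normr0 mulr_ge0// ltW.
  have de := is_derive_scomp lin (is_derive_expR (- (m - 1) * s)).
  apply: is_derive_eq (is_deriveM de dd) _.
  rewrite /rate/= /GRing.scale/=.
  move: (expR _) (dtime density _) (density _) => ex dt de'; ring.
have cr s : 0 <= s <= t -> {for s, continuous (fun s => rate (s, x))}.
  move=> /Osx Oz; apply: (@continuous_comp _ _ _ (fun s : R => (s, x)) rate).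
    by apply: (@cvg_pair _ _ _ (nbhs s) (nbhs s) (nbhs x)); [exact: cvg_id|exact: cvg_cst].
  exact: crate.
have cF s : 0 <= s <= t -> {for s, continuous F}.
  move=> /dF[d _]; exact/differentiable_continuous/derivable1_diffP.
have := @continuous_FTC2 R (fun s => rate (s, x)) F 0 t t0.
rewrite -EFinB /F mulr0 expR0 mul1r => <-.
- apply/esym/integral_itv_bndoo/measurable_EFinP.
  apply: open_continuous_measurable_fun => // s; rewrite inE/= in_itv/= => /andP[s0 st].
  by apply: cr; rewrite !ltW.
- apply: continuous_in_subspaceT => s; rewrite inE/= in_itv/=; exact: cr.
- split.
  + by move=> s; rewrite in_itv/= => /andP[s0 st]; case: (dF s); rewrite ?ltW.
  + by apply: cvg_at_right_filter; apply: cF; rewrite lexx ltW.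
  + by apply: cvg_at_left_filter; apply: cF; rewrite lexx ltW.
- move=> s; rewrite in_itv/= => /andP[s0 st]; rewrite derive1E.
  by case: (dF s) => [|_ ->]//; rewrite !ltW.
Qed.

(** The time derivative of the density is phi Du . D(div (a Du)) + phi Du . Df. The
    first term has a nonpositive integral. The second one is at most (m - 1)
    times the density plus |Df| ^ m, by Young's inequality; the exponential
    weight absorbs the multiple of the density, as in Gronwall's lemma. *)
Lemma energy_le t : 0 < t <= T ->
  (\int[leb]_(x in Omega) (expR (- (m - 1) * t) * density (t, x) - density (0%R, x))%:E <=
   \int[lam \x leb]_(z in slab T Omega) (source_density z)%:E)%E.
Proof.
move=> /andP[t0 tT].
have mW := open_measurable_rV oW.
apply: (@le_trans _ _ (\int[lam \x leb]_(z in slab t Omega) (source_density z)%:E)%E); last first.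
  apply: ge0_subset_integral.
  - by apply: measurableX.
  - by apply: measurableX.
  - by apply/measurable_EFinP; apply: (measurable_slab oW WO (lexx T) csource_density).
  - by move=> z _; rewrite lee_fin powR_ge0.
  - move=> [s x] [/= /[!in_itv]/= /andP[s0 st] Wx]; split => //=.
    by rewrite in_itv/= s0 (lt_le_trans st).
rewrite (eq_integral (fun x => \int[lam]_(s in `]0%R, t[) (rate (s, x))%:E)%E); last first.
  by move=> x /set_mem Wx; rewrite rate_FTC// t0.
apply: (slab_le oW bW WO tT crate csource_density) => s /andP[s0 st].
have sT : s < T by exact: lt_le_trans st tT.
have WOs : closure Omega `<=` [set x | O (s, x)].
  by move=> x cx; apply: WO => //; rewrite !ltW.
have slice_int (K : R * 'rV[R]_N -> R) : (forall z, O z -> {for z, continuous K}) ->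
    leb.-integrable Omega (EFin \o (fun x => K (s, x))).
  move=> cK; apply: (integrable_near_closure oW bW WOs) => x Ox.
  apply: (@continuous_comp _ _ _ (fun x => (s, x)) K); last exact: cK.
  exact: continuous_pairl.
pose D z := phi (sqspace U z) * \sum_k dspace k U z * dspace k (divspace a U) z.
have cD z : O z -> {for z, continuous D}.
  apply: (@Ck_cont _ _ 0 O).
  have Cphi : Ck 0 O (fun z => phi (sqspace U z)).
    have Cp : Ck 0 [set s : R | - kappa < s] phi.
      exact: (CkM (@oJ kappa) (Ck_cst 0 _ m) (Ck_powR_shift 0 (m / 2 - 1) kappa)).
    apply: (Ck_comp (A := [set s : R | - kappa < s]) oO _ Cp (Ck_le (leq0n 3) Csq)).
    by move=> z' _; exact: sqJ.
  exact: (CkM oO Cphi (Ck_sum (index_enum 'I_N) oO (fun k =>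
    CkM oO (Ck_le (leq0n 3) (Cb k)) (Ck_D ((0 : R), delta_mx ord0 k : 'rV[R]_N) CL)))).
have iS := slice_int _ csource_density; have iD := slice_int _ cD.
have e0 := expR_gt0 (- (m - 1) * s).
have e1 : expR (- (m - 1) * s) <= 1.
  have m1 : 0 <= m - 1 by move: m2; lra.
  by rewrite -[leRHS]expR0 ler_expR mulNr oppr_le0 mulr_ge0// ltW.
apply: (@le_trans _ _ (\int[leb]_(x in Omega)
   ((expR (- (m - 1) * s))%:E * ((D (s, x))%:E + (source_density (s, x))%:E)))%E).
  apply: le_integral => //; first exact: slice_int crate.
    exact: (integrableZl mW _ (integrableD mW iD iS)).
  move=> x /set_mem Wx; rewrite -EFinD -EFinM lee_fin /rate/= ler_pM2l//.
  have Oz : O (s, x) by apply: WOs; exact: subset_closure.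
  rewrite dtime_density// lerBlDr.
  rewrite (eq_bigr (fun i => dspace i U (s, x) * dspace i source (s, x) +
     dspace i U (s, x) * dspace i (divspace a U) (s, x))); last first.
    by move=> i _; rewrite mulrDr.
  rewrite big_split/= mulrDr addrC -addrA lerD2l addrC.
  exact: source_le.
rewrite integralZl//; last exact: (integrableD mW iD iS).
rewrite integralD//.
have fD := integrable_fin_num mW iD; have fS := integrable_fin_num mW iS.
rewrite -(fineK fD) -(fineK fS) -EFinD -EFinM lee_fin.
have D0 : fine (\int[leb]_(x in Omega) (EFin \o (fun x => D (s, x))) x)%E <= 0.
  by apply: dissipation; rewrite s0.
have S0 : 0 <= fine (\int[leb]_(x in Omega) (EFin \o (fun x => source_density (s, x))) x)%E.
  by rewrite fine_ge0// integral_ge0// => x _; rewrite lee_fin powR_ge0.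
apply: le_trans (_ : expR (- (m - 1) * s) *
   fine (\int[leb]_(x in Omega) (EFin \o (fun x => source_density (s, x))) x)%E <= _).
  by rewrite ler_pM2l// gerDr.
by rewrite ler_piMl.
Qed.

End fixed_exponent.
End energy.

Section energy_bound.
#[local] Opaque Ck.
Context {R : realType} {N : nat}.
Local Notation leb := (@lebesgue_rV R N).
Local Notation lam := (@lebesgue_measure R).

Variables (T : R) (Omega : set 'rV[R]_N) (O : set (R * 'rV[R]_N)) (U : R * 'rV[R]_N -> R)
  (a : R -> R) (eps : R).
Hypotheses (T0 : 0 < T) (oW : open Omega) (bW : bounded_set Omega) (cW : convex_set Omega)
  (C1W : C1_domain Omega) (oO : open O) (WO : around T Omega O) (CU : Ck 4 O U)
  (neumann : forall t x n, 0 < t < T -> boundary Omega x ->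
     outward_unit_normal Omega x n -> 'D_n (fun y => U (t, y)) x = 0)
  (eps0 : 0 < eps) (Ca : Ck 2 [set s : R | - eps < s] a)
  (a0 : forall s, 0 <= s -> 0 < a s)
  (ell : forall s, 0 <= s -> 0 <= a s + 2 * s * derive1 a s).
Variables (m : R) (m2 : 2 < m).

Let Csq : Ck 3 O (sqspace U).
Proof.
pose Cb (i : 'I_N) := Ck_D ((0 : R), delta_mx ord0 i : 'rV[R]_N) CU.
exact: (Ck_sum (index_enum 'I_N) oO (fun i => CkM oO (Cb i) (Cb i))).
Qed.

Let mh0 : 0 < m / 2. Proof. by rewrite divr_gt0// (lt_trans _ m2). Qed.

Let WOt t : 0 <= t <= T -> closure Omega `<=` [set x | O (t, x)].
Proof. by move=> tT x cx; exact: WO. Qed.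

Let slice_int (K : R * 'rV[R]_N -> R) t : 0 <= t <= T ->
  (forall z, O z -> {for z, continuous K}) ->
  leb.-integrable Omega (EFin \o (fun x => K (t, x))).
Proof.
move=> tT cK; apply: (integrable_near_closure oW bW (WOt tT)) => x Ox.
apply: (@continuous_comp _ _ _ (fun x => (t, x)) K); last exact: cK.
exact: continuous_pairl.
Qed.

Let cdensity kappa z : 0 < kappa -> O z -> {for z, continuous (density U m kappa)}.
Proof.
move=> k0 Oz; apply: (@Ck_cont _ _ 0 O) => //.
apply: (Ck_comp (A := [set s : R | - kappa < s]) oO _ (Ck_powR_shift 0 (m / 2) kappa)).
  move=> y _ /=; apply: lt_le_trans (sqspace_ge0 U y); by rewrite oppr_lt0.
exact: Ck_le (leq0n 3) Csq.
Qed.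

Let cpow z : O z -> {for z, continuous (fun z => sqspace U z `^ (m / 2))}.
Proof.
move=> Oz; apply: continuous_powR_comp => //; first exact: sqspace_ge0.
exact: (Ck_cont Csq).
Qed.

Let intpow t : 0 <= t <= T ->
  leb.-integrable Omega (EFin \o (fun x => sqspace U (t, x) `^ (m / 2))).
Proof. by move=> tT; apply: (slice_int (K := fun z => sqspace U z `^ (m / 2))) => //; exact: cpow. Qed.

Let cvg_energy0 : (fun n : nat => \int[leb]_(x in Omega) (density U m n.+1%:R^-1 (0%R, x))%:E)%E @ \oo
  --> (\int[leb]_(x in Omega) (sqspace U (0%R, x) `^ (m / 2))%:E)%E.
Proof.
have T00 : 0 <= (0 : R) <= T by rewrite lexx ltW.
have mW := open_measurable_rV oW.
have cvx x : (fun n : nat => (density U m n.+1%:R^-1 (0, x))%:E) @ \oo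
    --> (sqspace U (0, x) `^ (m / 2))%:E.
  apply: cvg_EFin; first exact: nearW.
  pose g (y : R) := (sqspace U (0, x) + `|y|) `^ (m / 2).
  have cg : {for (0 : R), continuous g}.
    apply: continuous_powR_comp => // [y|]; first by rewrite addr_ge0// sqspace_ge0.
    by apply: continuousD; [exact: cst_continuous|exact: norm_continuous].
  have -> : (fine \o (fun n : nat => (density U m n.+1%:R^-1 (0, x))%:E)) =
      (fun n : nat => g (n.+1%:R^-1)).
    by apply/funext => n; rewrite /g ger0_norm.
  have -> : sqspace U (0, x) `^ (m / 2) = g 0 by rewrite /g normr0 addr0.
  exact: (cvg_comp harmonic g (@cvg_harmonic R) cg).
have [] := @dominated_convergence _ _ R leb Omega mW
  (fun n x => (density U m n.+1%:R^-1 (0%R, x))%:E)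
  (fun x => (sqspace U (0%R, x) `^ (m / 2))%:E)
  (fun x => (density U m 1 (0%R, x))%:E).
- by move=> n; apply: (measurable_int leb); apply: slice_int => // z; exact: cdensity.
- exact: (measurable_int leb (intpow T00)).
- by apply: aeW => x _; exact: cvx.
- by apply: slice_int => // z; exact: cdensity.
- apply: aeW => x n _; rewrite abse_EFin lee_fin ger0_norm ?powR_ge0//.
  have sq0 := sqspace_ge0 U (0, x).
  apply: ge0_ler_powR; rewrite ?nnegrE ?addr_ge0 ?(ltW mh0)//.
  by rewrite lerD2l invf_le1// ler1n.
by [].
Qed.

(** On [0, T] the weight is at least exp (- (m - 1) T). As kappa decreases to 0
    the initial energy converges by dominated convergence, while at time t
    the regularised power bounds the power from above. *)
Lemma energy_bound t : 0 <= t <= T ->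
  (\int[leb]_(x in Omega) (sqspace U (t, x) `^ (m / 2))%:E <=
   (expR ((m - 1) * T))%:E *
   (\int[leb]_(x in Omega) (sqspace U (0%R, x) `^ (m / 2))%:E +
    \int[lam \x leb]_(z in slab T Omega) (sqspace (source U a) z `^ (m / 2))%:E))%E.
Proof.
move=> /andP[t0 tT].
have mW := open_measurable_rV oW.
have m10 : 0 <= m - 1 by move: m2; lra.
have T00 : 0 <= (0 : R) <= T by rewrite lexx ltW.
pose I r := (\int[leb]_(x in Omega) (sqspace U (r, x) `^ (m / 2))%:E)%E.
pose S := (\int[lam \x leb]_(z in slab T Omega) (sqspace (source U a) z `^ (m / 2))%:E)%E.
have S0 : (0 <= S)%E by apply: integral_ge0 => z _; rewrite lee_fin powR_ge0.
have B0 : (0 <= I 0%R)%E by apply: integral_ge0 => z _; rewrite lee_fin powR_ge0.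
change (I t <= (expR ((m - 1) * T))%:E * (I 0%R + S))%E.
move: t0; rewrite le_eqVlt => /orP[/eqP <-|t0].
  apply: (@le_trans _ _ (I 0%R + S)%E); first by rewrite leeDl.
  rewrite -[leLHS]mul1e; apply: lee_wpmul2r; first exact: adde_ge0.
  by rewrite lee_fin -[leLHS]expR0 ler_expR mulr_ge0// ltW.
have tT' : 0 <= t <= T by rewrite ltW.
suff H : ((expR (- (m - 1) * T))%:E * I t <= I 0%R + S)%E.
  have e0 := expR_gt0 (- (m - 1) * T).
  rewrite -(@lee_pmul2l _ (expR (- (m - 1) * T))%:E) ?lte_fin//.
  have c : expR (- (m - 1) * T) * expR ((m - 1) * T) = 1.
    by rewrite -expRD mulNr addNr expR0.
  by rewrite muleA -EFinM c mul1e.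
apply: (cvge_ge (f := fun n : nat => (\int[leb]_(x in Omega) (density U m n.+1%:R^-1 (0%R, x))%:E + S)%E)); last first.
  have d : (I 0%R +? S)%E by apply: ge0_adde_def; rewrite inE.
  have H := cvgeD d cvg_energy0 (cvg_cst S).
  exact: H.
apply: nearW => n.
have k0 : 0 < n.+1%:R^-1 :> R by rewrite invr_gt0.
set k := n.+1%:R^-1 in k0 *.
have iD s : 0 <= s <= T -> leb.-integrable Omega (EFin \o (fun x => density U m k (s, x))).
  by move=> sT; apply: slice_int => // z; exact: cdensity.
have tT'' : 0 < t <= T by rewrite t0.
have := energy_le oW bW cW C1W oO WO CU neumann eps0 Ca a0 ell m2 k0 tT''.
move=> E.
have ie := expR_gt0 (- (m - 1) * t).
have iexp : leb.-integrable Omega (fun x => (expR (- (m - 1) * t))%:E * (density U m k (t, x))%:E)%E.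
  exact: (integrableZl mW _ (iD t tT')).
have E2 : (\int[leb]_(x in Omega) ((expR (- (m - 1) * t))%:E * (density U m k (t, x))%:E) <=
   \int[leb]_(x in Omega) (density U m k (0%R, x))%:E + S)%E.
  rewrite -leeBlDl; last exact: integrable_fin_num (iD 0 T00).
  rewrite -integralB//; last exact: iD.
apply: le_trans E2; rewrite /I -(integralZl mW (intpow tT')).
apply: le_integral => //; first exact: (integrableZl mW _ (intpow tT')).
move=> x _; rewrite -!EFinM lee_fin ler_pM ?powR_ge0 ?expR_ge0//.
  by rewrite ler_expR !mulNr lerN2 ler_wpM2l.
have sq0 := sqspace_ge0 U (t, x).
by apply: ge0_ler_powR; rewrite ?nnegrE ?addr_ge0 ?(ltW mh0) ?(ltW k0)// lerDl ltW.
exact: eventually_filter.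
Qed.

End energy_bound.

Section real_powers.
Context {R : realType}.

Lemma powR_superadd (m b s : R) : 1 <= m -> 0 <= b -> 0 <= s ->
  b `^ m + s `^ m <= (b + s) `^ m.
Proof.
move=> m1 b0 s0; have m0 : 0 < m by rewrite (lt_le_trans ltr01).
have bs0 : 0 <= b + s by rewrite addr_ge0.
rewrite -!(@mulr_powRB1 R _ m)// mulrDl lerD// ler_wpM2l// ge0_ler_powR//;
  rewrite ?nnegrE ?subr_ge0//.
  by rewrite lerDl.
by rewrite lerDr.
Qed.

(** The constant exp ((m - 1) T) has m-th root at most exp T, and the m-th root is
    subadditive. *)
Lemma root_le (m T A b s : R) : 1 < m -> 0 < T -> 0 <= A -> 0 <= b -> 0 <= s ->
  A <= expR ((m - 1) * T) * (b + s) ->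
  A `^ m^-1 <= expR T * (b `^ m^-1 + s `^ m^-1).
Proof.
move=> m1 T0 A0 b0 s0 H; have m0 : 0 < m by rewrite (lt_trans ltr01).
have rt y : 0 <= y -> (y `^ m^-1) `^ m = y.
  by move=> y0; rewrite -powRrM mulVf ?gt_eqF// powRr1.
have rt' y : 0 <= y -> (y `^ m) `^ m^-1 = y.
  by move=> y0; rewrite -powRrM mulfV ?gt_eqF// powRr1.
have X0 : 0 <= expR T * (b `^ m^-1 + s `^ m^-1).
  by rewrite mulr_ge0 ?expR_ge0// addr_ge0// powR_ge0.
rewrite -[leRHS]rt'//; apply: ge0_ler_powR; rewrite ?nnegrE ?invr_ge0 ?(ltW m0)//.
  exact: powR_ge0.
apply: le_trans H _.
rewrite powRM ?expR_ge0//; last by rewrite addr_ge0// powR_ge0.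
apply: ler_pM; rewrite ?expR_ge0 ?addr_ge0//.
  rewrite -expRM ler_expR mulrC ler_pM2l//; lra.
apply: le_trans (powR_superadd (ltW m1) (powR_ge0 _ _) (powR_ge0 _ _)).
by rewrite !rt.
Qed.

End real_powers.

(** * From powers to norms *)

Section norms.
Context {R : realType} d (X : measurableType d) (mu : {measure set X -> \bar R}).
Implicit Types (D : set X) (g : X -> R).

Lemma Lnorm_on_EFin (m : R) D g : m != 0 -> (forall x, 0 <= g x) ->
  Lnorm_on mu m%:E D g = ((\int[mu]_(x in D) (g x `^ m)%:E) `^ m^-1)%E.
Proof.
move=> m0 g0; rewrite /Lnorm_on unlock [in RHS]integral_mkcond; congr (_ `^ _)%E.
apply: eq_integral => x _; rewrite !patchE; case: ifP => _.
  by rewrite /= ger0_norm.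
by rewrite abse0 poweR0r.
Qed.

Lemma ae_le_Lnorm_on D g :
  {ae mu, forall x, D x -> ((g x)%:E <= Lnorm_on mu +oo D g)%E}.
Proof.
rewrite /Lnorm_on unlock; case: ifPn => [_|].
  apply: filterS (ess_sup_ge mu _) => x + Dx; apply: le_trans.
  by rewrite /= patchE mem_set// lee_fin ler_norm.
rewrite -leNgt => mu0; exists setT; split => //.
by apply/eqP; rewrite eq_le mu0 measure_ge0.
Qed.

Lemma Lnorm_on_le D g (c : R) : (forall x, 0 <= g x) -> 0 <= c ->
  {ae mu, forall x, D x -> g x <= c} -> (Lnorm_on mu +oo D g <= c%:E)%E.
Proof.
move=> g0 c0 gc; rewrite /Lnorm_on unlock; case: ifPn => _; last by rewrite lee_fin.
apply/ess_supP; apply: filterS gc => x gc; rewrite /= patchE.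
case: ifPn => [/set_mem /gc|_]; first by rewrite lee_fin ger0_norm.
by rewrite abse0 lee_fin.
Qed.

Lemma measurable_fun_powR D g (m : R) : measurable_fun D g ->
  measurable_fun D (fun x => (g x `^ m)%:E).
Proof.
move=> mg; apply/measurable_EFinP.
exact: (@measurableT_comp _ _ _ _ _ _ (@powR R ^~ m)).
Qed.

Lemma integral_powR_le D g (m : R) (c : R) : measurable D -> measurable_fun D g ->
  (forall x, 0 <= g x) -> 0 <= c -> 0 <= m -> {ae mu, forall x, D x -> g x <= c} ->
  (\int[mu]_(x in D) (g x `^ m)%:E <= (c `^ m)%:E * mu D)%E.
Proof.
move=> mD mg g0 c0 m0 gc; rewrite -integral_cst//.
apply: ae_ge0_le_integral => //.
- by move=> x _; rewrite lee_fin powR_ge0.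
- exact: measurable_fun_powR.
- by move=> x _; rewrite lee_fin powR_ge0.
apply: filterS gc => x gc Dx; rewrite lee_fin ge0_ler_powR ?nnegrE//.
exact: gc.
Qed.

(** Chebyshev's inequality for every exponent: the superlevel set of level c has
    measure at most K times (C / c) ^ m, which tends to 0. *)
Lemma ae_le_of_integral_powR D g (C c : R) (K : \bar R) :
  measurable D -> measurable_fun D g ->
  (forall x, 0 <= g x) -> 0 <= C -> C < c -> (K < +oo)%E ->
  (forall m : R, 2 < m -> (\int[mu]_(x in D) (g x `^ m)%:E <= (C `^ m)%:E * K)%E) ->
  {ae mu, forall x, D x -> g x <= c}.
Proof.
move=> mD mg g0 C0 Cc Koo H.
have c0 : 0 < c by exact: le_lt_trans Cc.
pose E := D `&` g @^-1` `[c, +oo[.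
have mE : measurable E by exact: mg.
have K' : (K <= (Num.max 0 (fine K))%:E)%E.
  by case: K Koo {H} => [r|//|]; rewrite ?leNye// lee_fin le_max lexx orbT.
set k := Num.max 0 (fine K) in K'.
have k0 : 0 <= k by rewrite le_max lexx.
have HE n : (mu E <= (geometric k (C / c) (n.+3))%:E)%E.
  suff S : ((c `^ n.+3%:R)%:E * mu E <= (C `^ n.+3%:R * k)%:E)%E.
    have cn : 0 < c ^+ n.+3 by rewrite exprn_gt0.
    move: S; rewrite !powR_mulrn ?(ltW c0)// -lee_pdivlMl// -EFinM => /le_trans; apply.
    rewrite lee_fin /geometric/= exprMn exprVn.
    by rewrite [leRHS](_ : _ = (c ^+ n.+3)^-1 * (C ^+ n.+3 * k)) //; ring.
  apply: (@le_trans _ _ (\int[mu]_(x in E) (g x `^ n.+3%:R)%:E)%E).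
    rewrite -integral_cst//; apply: ge0_le_integral => //.
    - by move=> x _; rewrite lee_fin powR_ge0.
    - by apply: measurable_fun_powR; apply: measurable_funS mg => // x [].
    - move=> x [_ /=]; rewrite in_itv/= andbT => cg.
      by rewrite lee_fin ge0_ler_powR ?nnegrE// ltW.
  apply: (@le_trans _ _ (\int[mu]_(x in D) (g x `^ n.+3%:R)%:E)%E).
    apply: ge0_subset_integral => //; first exact: measurable_fun_powR.
      by move=> x _; rewrite lee_fin powR_ge0.
    by move=> x [].
  apply: le_trans (H _ _) _; first by rewrite ltr_nat.
  by rewrite EFinM lee_wpmul2l// lee_fin powR_ge0.
have muE0 : mu E = 0.
  have f : mu E \is a fin_num by rewrite ge0_fin_numE// (le_lt_trans (HE 0%N))// ltry.
  rewrite -(fineK f); congr EFin; apply/eqP; rewrite eq_le fine_ge0// andbT.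
  have q1 : `|C / c| < 1.
    by rewrite ger0_norm ?divr_ge0 ?(ltW c0)// ltr_pdivrMr// mul1r.
  have := @cvg_geometric R k _ q1; rewrite -(cvg_shiftn 3) => /[dup] cv /cvg_lim <-//.
  apply: limr_ge; first by apply/cvg_ex; exists 0.
  by apply: nearW => n; rewrite -lee_fin fineK//; have := HE n; rewrite -addn3.
exists E; split => // x /= /not_implyP [Dx /negP]; rewrite -ltNge => cg.
by split => //=; rewrite in_itv/= andbT ltW.
Qed.

End norms.

Section norm_estimate.
Context {R : realType} d (X : measurableType d) (mu : {measure set X -> \bar R})
  d' (Y : measurableType d') (nu : {measure set Y -> \bar R}).

Lemma root_lee (m T : R) (A B S : \bar R) : 1 < m -> 0 < T ->
  (0 <= A -> 0 <= B -> 0 <= S -> A <= (expR ((m - 1) * T))%:E * (B + S) ->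
  A `^ m^-1 <= (expR T)%:E * (S `^ m^-1 + B `^ m^-1))%E.
Proof.
move=> m1 T0; have m0 : m^-1 != 0 by rewrite invr_neq0// gt_eqF// (lt_trans ltr01).
have y x : (0 <= x -> x + +oo = +oo :> \bar R)%E by case: x.
case: B => [b||//]; last first.
  by move=> *; rewrite poweRyr// y ?poweR_ge0// gt0_muley ?leey// lte_fin expR_gt0.
case: S => [s||//]; last first.
  by move=> *; rewrite poweRyr// addeC y ?poweR_ge0// gt0_muley ?leey// lte_fin expR_gt0.
rewrite -EFinD -EFinM; case: A => [a||//]//.
rewrite !lee_fin => a0 b0 s0 H; rewrite [_ + b `^ _]addrC.
exact: root_le.
Qed.

(** For finite exponents take roots. The constant exp T does not depend on the
    exponent, so the essential bound follows by letting the exponent grow: both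
    integrals on the right are then at most powers of the essential bounds times
    finite measures. *)
Lemma Lnorm_on_estimate (T : R) (D : set X) (Q : set Y) (g g0 : X -> R) (h : Y -> R) (m : \bar R) :
  0 < T -> measurable D -> measurable Q -> (mu D < +oo)%E -> (nu Q < +oo)%E ->
  measurable_fun D g -> measurable_fun D g0 -> measurable_fun Q h ->
  (forall x, 0 <= g x) -> (forall x, 0 <= g0 x) -> (forall x, 0 <= h x) ->
  (forall q : R, 2 < q -> (\int[mu]_(x in D) (g x `^ q)%:E <=
     (expR ((q - 1) * T))%:E *
     (\int[mu]_(x in D) (g0 x `^ q)%:E + \int[nu]_(y in Q) (h y `^ q)%:E))%E) ->
  (2%:E < m)%E ->
  (Lnorm_on mu m D g <= (expR T)%:E * (Lnorm_on nu m Q h + Lnorm_on mu m D g0))%E.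
Proof.
move=> T0 mD mQ Doo Qoo mg mg0 mh pg pg0 ph H.
have int0 d1 (Z : measurableType d1) (rho : {measure set Z -> \bar R}) A (k : Z -> R) q :
    (0 <= \int[rho]_(x in A) (k x `^ q)%:E)%E.
  by apply: integral_ge0 => x _; rewrite lee_fin powR_ge0.
case: m => [m|_|//].
  rewrite lte_fin => m2; have m1 : 1 < m by rewrite (lt_trans _ m2)// ltr1n.
  have m0 : m != 0 by rewrite gt_eqF// (lt_trans ltr01).
  by rewrite !Lnorm_on_EFin//; apply: root_lee => //; exact: H.
have N0 : (0 <= Lnorm_on mu +oo D g0)%E by exact: Lnorm_ge0.
have M0 : (0 <= Lnorm_on nu +oo Q h)%E by exact: Lnorm_ge0.
have := ae_le_Lnorm_on mu D g0; have := ae_le_Lnorm_on nu Q h.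
have e0 := expR_gt0 T.
have y x : (0 <= x -> x + +oo = +oo :> \bar R)%E by case: x.
case: (Lnorm_on nu _ _ _) M0 => [s||//] s0 hs; last first.
  by rewrite addeC y// gt0_muley ?leey// lte_fin.
case: (Lnorm_on mu _ _ g0) N0 => [b||//] b0 hb; last first.
  by rewrite y// gt0_muley ?leey// lte_fin.
rewrite lee_fin in s0; rewrite lee_fin in b0.
rewrite -EFinD -EFinM; apply/lee_addgt0Pr => e e0'; rewrite -EFinD.
set C := expR T * (s + b); have C0 : 0 <= C by rewrite mulr_ge0 ?addr_ge0// ltW.
apply: Lnorm_on_le => //; first by rewrite addr_ge0// ltW.
apply: (@ae_le_of_integral_powR _ _ _ _ D g C _ (mu D + nu Q)%E) => //.
- by rewrite ltrDl.
- by rewrite lte_add_pinfty.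
move=> q q2; apply: le_trans (H q q2) _.
have q0 : 0 <= q by rewrite (le_trans _ (ltW q2)).
have sb : 0 <= s + b by rewrite addr_ge0.
apply: (@le_trans _ _ ((expR T `^ q)%:E * ((s + b) `^ q)%:E * (mu D + nu Q))%E); last first.
  by rewrite -EFinM -powRM// ltW.
rewrite -muleA; apply: lee_pmul => //.
- by rewrite adde_ge0.
- by rewrite lee_fin -expRM ler_expR mulrC ler_pM2l// gerBl.
rewrite ge0_muleDr//; apply: leeD.
  apply: (le_trans (integral_powR_le mD mg0 pg0 b0 q0 hb)).
  by rewrite lee_wpmul2r// lee_fin ge0_ler_powR ?nnegrE// lerDr.
apply: (le_trans (integral_powR_le mQ mh ph s0 q0 hs)).
by rewrite lee_wpmul2r// lee_fin ge0_ler_powR ?nnegrE// lerDl.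
Qed.

End norm_estimate.

(** * The equation and the gradient estimate *)

Section shifted_coefficient.
#[local] Opaque Ck.
Context {R : realType}.
Variables (alpha : R -> R) (eps : R).
Hypotheses (eps0 : 0 < eps) (alpha0 : forall s, 0 < s -> 0 < alpha s)
  (Calpha : Ck 2 [set s : R | 0 < s] alpha) (hi : ((-1)%:E < i_index alpha)%E).

Lemma shift_coef_gt0 s : 0 <= s -> 0 < shift_coef alpha eps s.
Proof. by move=> s0; apply: alpha0; rewrite ltr_wpDl. Qed.

Lemma Ck_shift_coef : Ck 2 [set s : R | - eps < s] (shift_coef alpha eps).
Proof.
have oJ : open [set s : R | - eps < s] by exact: open_gt.
apply: (Ck_comp (A := [set s : R | 0 < s]) oJ _ Calpha (Ck_shift 2 eps oJ)).
by move=> s /= es; rewrite -ltrBlDr sub0r.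
Qed.

Lemma derive1_shift_coef s : 0 <= s ->
  derive1 (shift_coef alpha eps) s = derive1 alpha (s + eps).
Proof.
move=> s0; have es : - eps < s by apply: lt_le_trans s0; rewrite oppr_lt0.
have se : 0 < s + eps by rewrite ltr_wpDl.
have oJ : open [set s : R | - eps < s] by exact: open_gt.
have lin : is_derive s (1 : R) (fun s : R => s + eps) 1.
  apply: is_derive_expansion => e e0; exists 1 => // h _.
  rewrite -[h *: 1]/(h * 1) (_ : _ - _ = 0); last by ring.
  by rewrite normr0 mulr_ge0// ltW.
have := is_derive_scomp lin (Ck1_is_derive (1 : R) (Ck_S Calpha) se).
by move=> [_ E]; rewrite !derive1E [LHS]E mulr1.
Qed.

(** The lower bound of the index says that alpha + 2 r alpha' > 0 at r = s + eps.
    Where alpha' is negative, replacing r by the smaller s increases the sum. *)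
Lemma shift_coef_elliptic s : 0 <= s ->
  0 <= shift_coef alpha eps s + 2 * s * derive1 (shift_coef alpha eps) s.
Proof.
move=> s0; rewrite derive1_shift_coef// /shift_coef.
have r0 : 0 < s + eps by rewrite ltr_wpDl.
have a0 := alpha0 r0.
have : - 1 < 2 * (s + eps) * derive1 alpha (s + eps) / alpha (s + eps).
  rewrite -lte_fin; apply: lt_le_trans hi _.
  by apply: ereal_inf_lbound; exists (s + eps).
rewrite ltr_pdivlMr// mulN1r => H.
have [d0|d0] := leP 0 (derive1 alpha (s + eps)).
  by rewrite addr_ge0 ?mulr_ge0// ltW.
have : eps * derive1 alpha (s + eps) <= 0 by rewrite mulr_ge0_le0// ltW.
nra.
Qed.

End shifted_coefficient.

Section operator.
#[local] Opaque Ck.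
Context {R : realType} {N : nat}.

Lemma opA_divA (alpha : R -> R) (eps : R) (O : set 'rV[R]_N) v x : open O ->
  Ck 3 O v -> O x -> 0 < eps -> (forall s, 0 < s -> 0 < alpha s) ->
  Ck 2 [set s : R | 0 < s] alpha ->
  shift_coef alpha eps (enorm (grad v x) ^+ 2) * opA alpha eps v x (hessian v x) =
  divA (shift_coef alpha eps) v x.
Proof.
move=> oO Cv Ox eps0 alpha0 Calpha.
rewrite /opA enorm_sqr sqgradE; set q := sqgrad v x; set a := shift_coef alpha eps.
have aq : a q != 0 by rewrite gt_eqF// shift_coef_gt0// sqgrad_ge0.
have J0 (s : R) : 0 <= s -> [set s : R | - eps < s] s.
  by apply: lt_le_trans; rewrite oppr_lt0.
have flux i := partial_flux oO Cv J0 (Ck_shift_coef eps Calpha) i i Ox.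
rewrite /divA (eq_bigr _ (fun i _ => flux i)) -/a -/q big_split /=.
have E1 : a q * \tr (hessian v x) = \sum_i a q * partial i (partial i v) x.
  by rewrite [LHS]mulr_sumr; apply: eq_bigr => i _; rewrite mxE.
have E2 : dot (grad v x *m hessian v x) (grad v x) =
    \sum_i (\sum_l partial l v x * partial i (partial l v) x) * partial i v x.
  transitivity (\sum_j \sum_i partial i v x * partial i (partial j v) x * partial j v x).
    apply: eq_bigr => j _; rewrite [X in X * _]mxE mulr_suml; apply: eq_bigr => i _.
    by rewrite !mxE.
  rewrite exchange_big; apply: eq_bigr => i _ /=; rewrite mulr_suml.
  have alg (p r s : R) : p * r * s = s * r * p by ring.
  by apply: eq_bigr => l _; exact: alg.
have E3 : a q * (2 * derive1 a q / a q) = 2 * derive1 a q.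
  by rewrite mulrC divfK.
rewrite E2 [LHS]mulrDr E1 [X in _ + X]mulrA E3; congr (_ + _).
by rewrite [LHS]mulr_sumr; apply: eq_bigr => i _; rewrite mulrA.
Qed.

End operator.

Section solution.
#[local] Opaque Ck.
Context {R : realType} {N : nat}.
Local Notation leb := (@lebesgue_rV R N).
Local Notation lam := (@lebesgue_measure R).
Variables (T : R) (Omega : set 'rV[R]_N) (alpha : R -> R) (eps : R)
  (f : R -> 'rV[R]_N -> R) (u0 : 'rV[R]_N -> R) (u : R -> 'rV[R]_N -> R).
Hypotheses (T0 : 0 < T) (bW : bounded_set Omega) (cW : convex_set Omega)
  (oW : open Omega) (C1W : C1_domain Omega)
  (alpha0 : forall s, 0 < s -> 0 < alpha s)
  (Calpha : Ck 2 [set s : R | 0 < s] alpha) (hi : ((-1)%:E < i_index alpha)%E)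
  (eps0 : 0 < eps) (sol : classical_solution alpha eps T Omega f u0 u).

Lemma grad_norm_powR (v : 'rV[R]_N -> R) x (q : R) :
  enorm (grad v x) `^ q = sqgrad v x `^ (q / 2).
Proof.
rewrite /enorm sqgradE -powR12_sqrt ?sqgrad_ge0// -powRrM.
by rewrite mulrC.
Qed.

Let U (z : R * 'rV[R]_N) := u z.1 z.2.
Let a := shift_coef alpha eps.

(** By the equation f is the source of u, and u0 is the initial value of u, so the
    energy bound for u is an inequality between powers of gradient norms. *)
Lemma grad_norm_estimate t (m : \bar R) : 0 <= t <= T -> (2%:E < m)%E ->
  (Lnorm_on leb m Omega (fun x => enorm (grad (u t) x)) <=
   (expR T)%:E * (Lnorm_on (lam \x leb) m (slab T Omega) (fun z => enorm (grad (f z.1) z.2)) +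
     Lnorm_on leb m Omega (fun x => enorm (grad u0 x))))%E.
Proof.
move=> tT m2; have [smo eqf neu ini] := sol; case: smo => O [oO cO CU].
have WO : around T Omega O by move=> s x sT cx; apply: cO; split => //=; rewrite in_itv.
have mW := open_measurable_rV oW.
have T00 : 0 <= (0 : R) <= T by rewrite lexx ltW.
have CU4 : Ck 4 O U := CU 4%N.
have gradU s x : sqgrad (u s) x = sqspace U (s, x) := sqgrad_slice U s x.
have CS : Ck 1 O (source U a).
  exact: (Ck1_source oO CU4 eps0 (Ck_shift_coef eps Calpha)).
have fE s x : 0 < s < T -> Omega x -> f s x = source U a (s, x).
  move=> sT Wx; have Oz : O (s, x).
    by apply: WO; [case/andP: sT => ? ?; rewrite !ltW | exact: subset_closure].
  have dv : divA a (u s) x = divspace a U (s, x) :=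
    congr1 (fun G => G x) (divA_slice a U s).
  have dt : derive1 (u ^~ x) s = dtime U (s, x).
    by rewrite derive1E; exact: (derive_time U s x).
  have op := @opA_divA R N alpha eps [set x | O (s, x)] (u s) x (@open_slice R N O s oO)
    (@Ck_slice R N 3 O U s (CU 3%N)) Oz eps0 alpha0 Calpha.
  exact: (etrans (esym (eqf s x sT Wx)) (congr2 (fun p q => p - q) dt (etrans op dv))).
have gradf s x : 0 < s < T -> Omega x -> sqgrad (f s) x = sqspace (source U a) (s, x).
  move=> sT Wx; apply: eq_bigr => i _.
  have E : partial i (f s) x = dspace i (source U a) (s, x).
    have S := congr1 (fun G => G x) (partial_slice (source U a) s i).
    apply: etrans S; apply: (eq_open_derive _ oW Wx) => y Wy; exact: fE.
  exact: (congr2 *%R E E).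
have gradu0 x : Omega x -> sqgrad u0 x = sqspace U (0, x).
  move=> Wx; rewrite -gradU; apply: eq_bigr => i _.
  have E : partial i u0 x = partial i (u 0) x.
    by apply: (eq_open_derive _ oW Wx) => y Wy; exact/esym/ini.
  exact: (congr2 *%R E E).
have nE (v : 'rV[R]_N -> R) x : enorm (grad v x) = sqgrad v x `^ 2^-1.
  by rewrite /enorm sqgradE -powR12_sqrt ?sqgrad_ge0.
have cont (G : R * 'rV[R]_N -> R) : Ck 1 O G ->
    forall z, O z -> {for z, continuous (fun z => sqspace G z `^ 2^-1)}.
  move=> CG z Oz; apply: continuous_powR_comp => //; first exact: sqspace_ge0.
  apply: (@Ck_cont _ _ 0 O) => //.
  exact: (Ck_sum (index_enum 'I_N) oO (fun i => CkM oO
    (Ck_D ((0 : R), delta_mx ord0 i : 'rV[R]_N) CG)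
    (Ck_D ((0 : R), delta_mx ord0 i : 'rV[R]_N) CG))).
have mslice s : 0 <= s <= T -> measurable_fun Omega (fun x => sqspace U (s, x) `^ 2^-1).
  move=> sT; apply: (continuous_measurable_rV oW) => x Wx.
  apply: (@continuous_comp _ _ _ (fun x => (s, x)) (fun z => sqspace U z `^ 2^-1)).
    exact: continuous_pairl.
  by apply: cont; [exact: (CU 1%N)|apply: WO => //; exact: subset_closure].
have slabP z : slab T Omega z -> 0 < z.1 < T /\ Omega z.2.
  by case: z => s x [/=]; rewrite in_itv.
have mQ : measurable (slab T Omega) by apply: measurableX.
have Woo := lebesgue_rV_bounded mW bW.
have Qoo : ((lam \x leb)%E (slab T Omega) < +oo)%E.
  rewrite /slab product_measure1E//; apply: lte_mul_pinfty => //.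
  suff : lam `]0%R, T[%classic \is a fin_num by [].
  by rewrite lebesgue_measure_itv/= lte_fin T0.
apply: Lnorm_on_estimate => //; try by move=> *; exact: enorm_ge0.
- apply: eq_measurable_fun (mslice t tT) => x _.
  by rewrite nE gradU.
- apply: eq_measurable_fun (mslice 0 T00) => x /set_mem Wx.
  by rewrite nE gradu0.
- apply: eq_measurable_fun (measurable_slab oW WO (lexx T) (cont _ CS)) => -[s x] /set_mem /slabP[sT Wx].
  by rewrite nE; exact/esym/(congr1 (fun r => r `^ 2^-1) (gradf s x sT Wx)).
move=> q q2.
have H := energy_bound T0 oW bW cW C1W oO WO CU4 neu eps0 (Ck_shift_coef eps Calpha)
  (shift_coef_gt0 eps0 alpha0) (shift_coef_elliptic eps0 alpha0 Calpha hi) q2 tT.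
have Et : (\int[leb]_(x in Omega) (enorm (grad (u t) x) `^ q)%:E =
    \int[leb]_(x in Omega) (sqspace U (t, x) `^ (q / 2))%:E)%E.
  by apply: eq_integral => x _; rewrite grad_norm_powR gradU.
have E0 : (\int[leb]_(x in Omega) (enorm (grad u0 x) `^ q)%:E =
    \int[leb]_(x in Omega) (sqspace U (0%R, x) `^ (q / 2))%:E)%E.
  by apply: eq_integral => x /set_mem Wx; rewrite grad_norm_powR gradu0.
have Ef : (\int[lam \x leb]_(z in slab T Omega) (enorm (grad (f z.1) z.2) `^ q)%:E =
    \int[lam \x leb]_(z in slab T Omega) (sqspace (source U a) z `^ (q / 2))%:E)%E.
  apply: eq_integral => -[s x] /set_mem /slabP[sT Wx]; rewrite grad_norm_powR.
  exact: (congr1 (fun r => (r `^ (q / 2))%:E) (gradf s x sT Wx)).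
have eqW (A B : \bar R) : A = B -> (A <= B)%E by move=> ->.
exact: (le_trans (eqW _ _ Et) (le_trans H
  (eqW _ _ (congr2 (fun A B => (_ * (A + B))%E) (esym E0) (esym Ef))))).
Qed.

End solution.

Theorem theorem2p1 (R : realType) (N : nat) (p T : R)
    (Omega : set 'rV[R]_N) (alpha : R -> R) (alo ahi : R)
    (hN : (1 <= N)%N) (hp : 1 < p) (hT : 0 < T)
    (hbounded : bounded_set Omega) (hconvex : convex_set Omega)
    (hopen : open Omega) (hC1 : C1_domain Omega)
    (halpha_pos : forall s : R, 0 < s -> 0 < alpha s)
    (halpha_C2 : Ck 2 [set s : R | 0 < s] alpha)
    (hi : ((-1)%:E < i_index alpha)%E) (hs : (s_index alpha < +oo)%E)
    (halo : 0 < alo) (hahi : alo <= ahi)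
    (halpha_growth : forall s : R, 0 < s ->
      alo * s `^ ((p - 2) / 2) <= alpha s <= ahi * s `^ ((p - 2) / 2)) :
  exists C : \bar R -> R,
    (forall m : \bar R, (2%:E < m)%E ->
      0 < C m /\
      forall (eps : R) (f : R -> 'rV[R]_N -> R) (u0 : 'rV[R]_N -> R)
          (u : R -> 'rV[R]_N -> R),
        0 < eps ->
        smooth (cylinder [set` `]0, T[] Omega) (fun z => f z.1 z.2) ->
        bochner_sobolev m T Omega f ->
        sobolev m Omega u0 ->
        classical_solution alpha eps T Omega f u0 u ->
        (ess_sup lebesgue_measure
           ((fun t => Lnorm_on (lebesgue_rV N) m Omega
                        (fun x => enorm (grad (u t) x))) \_ [set` `[0%R, T]])
         <= (C m)%:E *
            (Lnorm_on (lebesgue_measure \x lebesgue_rV N) m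
               (cylinder [set` `]0%R, T[] Omega)
               (fun z => enorm (grad (f z.1) z.2)) +
             Lnorm_on (lebesgue_rV N) m Omega (fun x => enorm (grad u0 x))))%E)
    /\
    exists2 Cbar : R, 0 < Cbar & C r%:E @[r --> +oo] --> Cbar.
Proof.
(* The m-th root of exp ((m - 1) T) is bounded by exp T for all m. *)
exists (fun=> expR T); split; last first.
  by exists (expR T); [exact: expR_gt0|exact: cvg_cst].
move=> m m2; split; first exact: expR_gt0.
move=> eps f u0 u eps0 _ _ _ sol; apply/ess_supP; apply: aeW => t.
rewrite patchE; case: ifPn => [/set_mem/=|_].
  rewrite in_itv/= => tT.
  exact: (grad_norm_estimate hT hbounded hconvex hopen hC1 halpha_pos halpha_C2 hi eps0 sol tT m2).
rewrite mule_ge0// ?lee_fin ?expR_ge0//.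
by apply: adde_ge0; exact: Lnorm_ge0.
Qed.
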